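(* Let $c_0,\delta_0>0$ and let $a\in[0,1]^{\mathbb{Z}}$ be an irreducible, aperiodic sequence. Let $\alpha\in(0,2/3)$. There are $C_-,C_+,c_-,c_+\in(0,+\infty)$ and $n_0\geq 0$ such that the following holds. For any $n\geq n_0$, any independent sequence $X_1,\dots,X_n$ of random variables with laws in $\mathcal{M}_{\delta_0,c_0}^a$, any $\lambda\geq\sqrt n$, and any $0\leq u,v\leq\lambda$ with $P_u(\bar S_n=v)>0$ and $|u-v|\leq n^{\alpha}$, $$P_u\bigl(0\leq\min_{i=1,\dots,n}\bar S_i,\ \max_{i=1,\dots,n}\bar S_i\leq\lambda,\ \bar S_n=v\bigr)\geq\frac{C_-(\min(u,\lambda-u,\sqrt n)+1)(\min(v,\lambda-v,\sqrt n)+1)}{n^{3/2}}\exp\Bigl(-\frac{c_-(u-v)^2}{n}\Bigr)$$ and $$P_u\bigl(0\leq\min_{i=1,\dots,n}\bar S_i,\ \max_{i=1,\dots,n}\bar S_i\leq\lambda,\ \bar S_n=v\bigr)\leq\frac{C_+(\min(u,\lambda-u,\sqrt n)+1)(\min(v,\lambda-v,\sqrt n)+1)}{n^{3/2}}\exp\Bigl(-\frac{c_+(u-v)^2}{n}\Bigr).$$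
   Context: Here $u,v$ are real. Write $\bar X_i=X_i-E(X_i)$. Under $P_u$, $\bar S_0=u$ and $\bar S_k=u+\bar X_1+\dots+\bar X_k$. $\mathcal{M}_{\mathbb{Z}}$ is the set of probability measures on $\mathbb{Z}$; $p(i)$ is the mass of $p$ at $i$. A measure $p\in\mathcal{M}_{\mathbb{Z}}$ is called irreducible (resp. aperiodic) if the random walk on $\mathbb{Z}$ with i.i.d. steps of law $p$ is an irreducible (resp. aperiodic) Markov chain. A sequence $a=(a_i)_{i\in\mathbb{Z}}\in[0,1]^{\mathbb{Z}}$ is irreducible and aperiodic if there are an irreducible and aperiodic $p\in\mathcal{M}_{\mathbb{Z}}$ and numbers $b_i>0$, $i\in\mathbb{Z}$, with $a_i=b_ip(i)$ for all $i$. For $\delta,c>0$, $$\mathcal{M}_{\delta,c}^a=\Bigl\{p\in\mathcal{M}_{\mathbb{Z}}:\ \sup_{|t|\leq\delta}\sum_{k\in\mathbb{Z}}p(k)e^{tk}\leq c,\ p(i)\geq a_i\ \forall i\in\mathbb{Z}\Bigr\}.$$ *)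

(* Defs.v *)
From HB Require Import structures.
From mathcomp Require Import all_boot all_order all_algebra.
From mathcomp Require Import all_classical all_reals all_analysis.

Set Implicit Arguments.
Unset Strict Implicit.
Unset Printing Implicit Defensive.

Import Order.TTheory GRing.Theory Num.Theory.
Import numFieldNormedType.Exports.

Local Open Scope classical_set_scope.
Local Open Scope ring_scope.

(* The integers with the sigma-algebra of all subsets, so that
   [probability int R] is the set of probability measures on Z and the
   mass of [p] at [i] is [p [set i]]. *)
HB.instance Definition _ := isPointed.Build int 0.
HB.instance Definition _ := @isMeasurable.Build default_measure_display
  int discrete_measurable discrete_measurable0
  discrete_measurableC discrete_measurableU.

Section MarkovChain.
Context {R : realType} {S : choiceType}.
Implicit Type Q : S -> S -> \bar R.

Fixpoint trans_iter Q (n : nat) (x y : S) : \bar R :=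
  if n is m.+1 then (\esum_(z in [set: S]) (Q x z * trans_iter Q m z y))%E
  else ((x == y)%:R)%:E.

Definition irreducible_chain Q : Prop :=
  forall x y : S, exists n : nat, (0 < trans_iter Q n x y)%E.

(* Every state has period 1: the only common divisor of its return times
   is 1 (a state without positive return times is not aperiodic). *)
Definition aperiodic_chain Q : Prop :=
  forall (x : S) (d : nat),
    (forall n : nat, (0 < n)%N -> (0 < trans_iter Q n x x)%E -> (d %| n)%N) ->
    d = 1%N.

End MarkovChain.

Section StepLaws.
Context {R : realType}.
Implicit Types (p : probability int R) (a : int -> R).

Definition walk_trans p (x y : int) : \bar R := p [set y - x].

Definition irreducible_law p : Prop := irreducible_chain (walk_trans p).

Definition aperiodic_law p : Prop := aperiodic_chain (walk_trans p).

Definition irreducible_aperiodic_seq a : Prop :=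
  exists (p : probability int R) (b : int -> R),
    [/\ irreducible_law p, aperiodic_law p, forall i, 0 < b i &
        forall i, (a i)%:E = ((b i)%:E * p [set i])%E].

Definition law_class (delta c : R) a : set (probability int R) :=
  [set p | (ereal_sup
             [set \esum_(k in [set: int]) (p [set k] * (expR (t * k%:~R))%:E)
             | t in [set t : R | (`|t| <= delta)%R]] <= c%:E)%E
         /\ forall i, ((a i)%:E <= p [set i])%E].

End StepLaws.

Definition mutually_independent {R : realType} {d d' : measure_display}
    {T : measurableType d} {T' : measurableType d'} (P : probability T R)
    {I : finType} (X : I -> {RV P >-> T'}) : Prop :=
  forall (J : {set I}) (A : I -> set T'), (forall i, measurable (A i)) ->
    P (\bigcap_(i in [set` J]) X i @^-1` A i) =
    (\prod_(i in J) P (X i @^-1` A i))%E.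

Section CenteredWalk.
Context {R : realType} {d : measure_display} {T : measurableType d}.
Context {P : probability T R} {n : nat}.
Variable X : 'I_n -> {RV P >-> int}.

(* [fine] is harmless on laws in [law_class delta c a] with [0 < delta]: they
   have exponential moments, hence a finite expectation. *)
Definition centered (i : 'I_n) (w : T) : R :=
  (X i w)%:~R - fine ('E_P[fun w' => (X i w')%:~R])%E.

(* The variable X_j of the text is [X] at the ordinal of value j - 1. *)
Definition centered_walk (u : R) (k : nat) (w : T) : R :=
  u + \sum_(i < n | (i < k)%N) centered i w.

(* The default value S_1 of the iterated minimum and maximum is one of the
   terms as soon as 1 <= n. *)
Definition walk_min (u : R) (w : T) : R :=
  \big[Num.min/centered_walk u 1 w]_(1 <= k < n.+1) centered_walk u k w.

Definition walk_max (u : R) (w : T) : R :=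
  \big[Num.max/centered_walk u 1 w]_(1 <= k < n.+1) centered_walk u k w.

End CenteredWalk.

Definition bridge_bound {R : realType} (C c : R) (n : nat) (lambda u v : R) : R :=
  C * (Num.min u (Num.min (lambda - u) (Num.sqrt n%:R)) + 1)
    * (Num.min v (Num.min (lambda - v) (Num.sqrt n%:R)) + 1)
    / (n%:R `^ (3 / 2))
  * expR (- (c * (u - v) ^+ 2 / n%:R)).

(* Main.v *)
Require Import Defs.
From mathcomp Require Import all_boot all_order all_algebra.
From mathcomp Require Import all_classical all_reals all_analysis.
From mathcomp Require Import measurable_realfun.
From mathcomp Require Import ring lra zify.

(** By independence, the probability of the bridge event is the value at u of
the composition of n substochastic operators
f |-> (x |-> E[f (x + Xbar_i); 0 <= x + Xbar_i <= lambda]), applied to the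
indicator of v ([prob_bridge_event]).  The estimates are proved for such
compositions, with constants depending only on an exponential moment, on a
lower bound for a truncated variance and on lower bounds for finitely many
masses; these are uniform over the class of laws ([rv_regular]).

Two ingredients are needed.

Survival.  A centred walk started at x survives m steps in the half-line
with probability of order (x + 1) / sqrt m.  For the upper bound
([ballot]) a bounded perturbation of (1 - exp (- th x)) / th is
superharmonic for the killed walk and loses about th exp (- th x) at every
step, which bounds the expected lifetime; one takes th = 1 / sqrt m.  A drift
of order th does no harm.  For the lower bound ([escape]), the parabola
z (M - z) / M on [0, M], with M of order sqrt m, loses at most a constant
over M at every step, and the expected lifetime is already under control, so
with probability of order (x + 1) / sqrt m the walk ends in the bulk.

Local limit.  Irreducibility and aperiodicity provide two lists of l points
of the support with sums 0 and 1 ([unit_shift]), so the law of the sum of l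
successive steps dominates a multiple of the law of a fair 0-1 coin.  Among
n steps, a number of order n of such coins is used, and the sum of these
coins is binomial, with masses at most of order n^(-1/2) everywhere and at
least of that order near the centre.  Chebyshev's inequality for the number
of coins and for the position then gives [llt_upper] and [llt_lower], without
Fourier analysis.

Upper bound ([bridge_upper]).  Cut the walk into three thirds.  The first
third and the time-reversed last third have to survive, the middle one
contributes n^(-1/2).  The Gaussian factor comes from tilting all the steps
by exp (th t) with th proportional to (v - u) / n: the normalisations cost
exp (O(n th^2)), the endpoints gain exp (- th (v - u)), and the drift which
the tilt creates is tolerated by the survival estimate.

Lower bound ([bridge_lower]).  Short initial and final pieces bring the walk
into the bulk ([start_lower]).  In between, the path is cut into i blocks, i of
order 1 + (u - v)^2 / n, over each of which the walk moves by at most the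
square root of the block length while staying in the interval
([block_lower]).  A block hits a given point with probability of order one
over that square root; summing over a window of endpoints leaves a
constant factor per block, hence the Gaussian factor ([chain_lower]).  Blocks
have to be long, and the tilt in the upper bound has to be small: this is where
|u - v| <= n^alpha with alpha < 2/3 enters, in the form |u - v|^3 <= n^2. *)

Set Implicit Arguments.
Unset Strict Implicit.
Unset Printing Implicit Defensive.
Import Order.TTheory GRing.Theory Num.Theory.
Import numFieldNormedType.Exports.
Local Open Scope classical_set_scope.
Local Open Scope ring_scope.

(** * Killed walks as compositions of expectation functionals *)

(** Sign goals for sums, products, powers and inverses of expressions of known
    sign. *)
Ltac pos := solve [ repeat first
  [ done | by rewrite ltr0n | by apply: ltW | exact: expR_ge0 | exact: expR_gt0 | exact: ler0n
  | exact: normr_ge0 | exact: sqrtr_ge0 | exact: sqr_ge0 | exact: powR_ge0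
  | rewrite sqrtr_gt0 | apply: exprn_ge0 | apply: exprn_gt0 | rewrite invr_ge0 | rewrite invr_gt0
  | apply: addr_ge0 | apply: mulr_ge0 | apply: mulr_gt0 | apply: addr_gt0 | lra ] ].

Ltac clra := clear; lra.

Section ExpBounds.
Context {R : realType}.
Implicit Types x y d : R.

(** This is 1 - x <= exp (- x) multiplied by exp x. *)
Lemma expR_sub1_le_mul x : expR x - 1 <= x * expR x.
Proof.
have h := expR_ge1Dx (- x); have e0 := expR_gt0 x.
have hi : expR x * expR (- x) = 1 by rewrite -expRD subrr expR0.
have : 0 <= expR x * (expR (- x) - 1 + x) by rewrite mulr_ge0 ?expR_ge0//; lra.
by rewrite !mulrDr hi; lra.
Qed.

Lemma expR_sub1_le x : `|expR x - 1| <= `|x| * expR `|x|.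
Proof.
have h1 : x <= expR x - 1 by have := expR_ge1Dx x; lra.
have h2 := expR_sub1_le_mul x.
have [x0|x0] := leP 0 x.
  by rewrite (ger0_norm x0) ger0_norm//; lra.
have e1 : 1 <= expR `|x| by rewrite -expR0 ler_expR.
have hx : expR x < 1 by rewrite expR_lt1.
rewrite ltr0_norm; last by lra.
have nx : `|x| = - x by rewrite ltr0_norm.
rewrite nx in e1 *; set E := expR (- x) in e1 *.
have := expR_gt0 x; nra.
Qed.

Lemma expR_sub1x_le x : expR x - 1 - x <= x ^+ 2 * expR `|x|.
Proof.
have h := expR_sub1_le x.
have h2 := expR_sub1_le_mul x.
have h3 : expR x - 1 - x <= x * (expR x - 1) by lra.
apply: (le_trans h3); apply: (le_trans (ler_norm _)).
rewrite normrM -[x ^+ 2]real_normK ?num_real// expr2 -mulrA.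
by rewrite ler_wpM2l.
Qed.

(** Square 1 + x / 2 <= exp (x / 2), both sides being nonnegative. *)
Lemma expR_ge_quad x : - 2 <= x -> 1 + x + x ^+ 2 / 4 <= expR x.
Proof.
move=> x2; have h := expR_ge1Dx (x / 2).
have -> : x = x / 2 + x / 2 by lra.
rewrite expRD; set e := expR _ in h *; nra.
Qed.

Lemma sqr_le_expR d x : 0 < d -> x ^+ 2 <= 2 / d ^+ 2 * expR (d * `|x|).
Proof.
move=> d0; have := @expR_ge1Dxn R (d * `|x|) 1 (mulr_ge0 (ltW d0) (normr_ge0 x)).
rewrite exprMn real_normK ?num_real// => h.
have h2 : d ^+ 2 * x ^+ 2 <= 2 * expR (d * `|x|) by move: h; rewrite (_ : 2`!%:R = 2)//; lra.
rewrite mulrAC ler_pdivlMr ?exprn_gt0//; lra.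
Qed.

Lemma abs_le_expR d x : 0 < d -> `|x| <= d^-1 * expR (d * `|x|).
Proof.
move=> d0; have := expR_ge1Dx (d * `|x|) => h.
rewrite mulrC ler_pdivlMr//; lra.
Qed.

End ExpBounds.

Section Admissible.
Context {R : realType}.
Implicit Types (d c th x : R) (f g : R -> R).

(** The growth class on which the expectation functionals are defined: its
    elements are integrable against a law with an exponential moment of order
    d. *)
Definition adm d f := exists A, forall x, `|f x| <= A * expR (d * `|x|).

Lemma adm_le d f g : (forall x, `|f x| <= `|g x|) -> adm d g -> adm d f.
Proof. by move=> fg [A hA]; exists A => x; rewrite (le_trans (fg x)). Qed.

Lemma adm_pos d f : adm d f ->
  exists A, 0 <= A /\ forall x, `|f x| <= A * expR (d * `|x|).
Proof.
move=> [A hA]; exists `|A|; split=> // x; apply: le_trans (hA x) _.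
by rewrite ler_wpM2r ?expR_ge0 ?ler_norm.
Qed.

Lemma admD d f g : adm d f -> adm d g -> adm d (fun x => f x + g x).
Proof.
move=> [A hA] [B hB]; exists (A + B) => x.
by rewrite mulrDl (le_trans (ler_normD _ _))// lerD.
Qed.

Lemma admZ d c f : adm d f -> adm d (fun x => c * f x).
Proof.
move=> [A hA]; exists (`|c| * A) => x.
by rewrite normrM -mulrA ler_wpM2l.
Qed.

Lemma admB d f g : adm d f -> adm d g -> adm d (fun x => f x - g x).
Proof.
move=> hf hg; apply: (@adm_le _ _ (fun x => f x + (-1) * g x)).
  by move=> x; rewrite mulN1r.
exact/admD/admZ.
Qed.

Lemma adm_expabs d : adm d (fun x => expR (d * `|x|)).
Proof. by exists 1 => x; rewrite mul1r ger0_norm ?expR_ge0. Qed.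

Lemma adm_exp d th : `|th| <= d -> adm d (fun x => expR (th * x)).
Proof.
move=> h; apply: adm_le (adm_expabs d) => x.
rewrite !(ger0_norm (expR_ge0 _)) ler_expR.
by rewrite (le_trans (ler_norm _))// normrM ler_wpM2r.
Qed.

Lemma adm_cst d c : 0 <= d -> adm d (fun=> c).
Proof.
move=> d0; exists `|c| => x; rewrite ler_peMr//.
by rewrite -expR0 ler_expR mulr_ge0.
Qed.

Lemma adm_id d : 0 < d -> adm d id.
Proof. by move=> d0; exists (d^-1) => x; exact: abs_le_expR. Qed.

Lemma adm_sqr d : 0 < d -> adm d (fun x => x ^+ 2).
Proof.
by move=> d0; exists (2 / d ^+ 2) => x; rewrite ger0_norm ?sqr_ge0 ?sqr_le_expR.
Qed.

Lemma adm_bounded d f A : 0 <= d -> (forall x, `|f x| <= A) -> adm d f.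
Proof.
move=> d0 h; apply: (@adm_le _ _ (fun=> A)); last exact: adm_cst.
by move=> x; rewrite (le_trans (h x))// ler_norm.
Qed.

Lemma adm_if d (D : R -> bool) f : adm d f ->
  adm d (fun x => if D x then f x else 0).
Proof. by apply: adm_le => x; case: ifP => // _; rewrite normr0. Qed.

Lemma adm_shift d x f : 0 <= d -> adm d f -> adm d (fun t => f (x + t)).
Proof.
move=> d0 /adm_pos[A [A0 hA]]; exists (A * expR (d * `|x|)) => t.
rewrite (le_trans (hA _))// -mulrA ler_wpM2l// -expRD ler_expR -mulrDr.
by rewrite ler_wpM2l// ler_normD.
Qed.

Lemma adm_opp d f : adm d f -> adm d (fun t => f (- t)).
Proof. by move=> [A hA]; exists A => t; rewrite (le_trans (hA _))// normrN. Qed.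

Lemma adm_mulexp d e th f : `|th| <= e -> adm d f ->
  adm (d + e) (fun t => expR (th * t) * f t).
Proof.
move=> he /adm_pos[A [A0 hA]]; exists A => t.
rewrite normrM (ger0_norm (expR_ge0 _)) mulrDl expRD mulrA [X in _ <= X]mulrC.
rewrite ler_pM ?expR_ge0// ler_expR (le_trans (ler_norm _))// normrM.
by rewrite ler_wpM2r.
Qed.

Lemma adm_norm d f : adm d f -> adm d (fun t => `|f t|).
Proof. by apply: adm_le => x; rewrite normr_id. Qed.

Lemma adm_sum d (I : Type) (r : seq I) (F : I -> R -> R) : 0 <= d ->
  (forall i, adm d (F i)) -> adm d (fun x => \sum_(i <- r) F i x).
Proof.
move=> d0 h; elim: r => [|i r ih].
  by apply: (@adm_le _ _ (fun=> 0)) => [x|]; [rewrite big_nil|exact: adm_cst].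
apply: (@adm_le _ _ (fun x => F i x + \sum_(j <- r) F j x)) => [x|].
  by rewrite big_cons.
exact: admD.
Qed.

End Admissible.

Section Each.
Variables T T' : Type.
Implicit Types (Q : T -> Prop) (s : seq T).

(** A [Prop]-valued variant of [all]: the properties of steps quantify over
    functions. *)
Fixpoint each Q s : Prop := if s is p :: s' then Q p /\ each Q s' else True.

Lemma each_cat Q s1 s2 : each Q (s1 ++ s2) <-> each Q s1 /\ each Q s2.
Proof. by elim: s1 => [|p s ih] /=; [tauto|rewrite ih; tauto]. Qed.

Lemma each_rcons Q s p : each Q (rcons s p) <-> each Q s /\ Q p.
Proof. by rewrite -cats1 each_cat /=; tauto. Qed.

Lemma each_rev Q s : each Q (rev s) <-> each Q s.
Proof. by elim: s => //= p s ih; rewrite rev_cons each_rcons ih; tauto. Qed.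

Lemma each_imp Q Q' s : (forall p, Q p -> Q' p) -> each Q s -> each Q' s.
Proof. by move=> h; elim: s => //= p s ih [/h ? /ih]. Qed.

Lemma each_and Q Q' s : each Q s -> each Q' s -> each (fun p => Q p /\ Q' p) s.
Proof. by elim: s => //= p s ih [? /ih h] [? /h]. Qed.

Lemma each_take Q n s : each Q s -> each Q (take n s).
Proof. by rewrite -{1}(cat_take_drop n s) each_cat => -[]. Qed.

End Each.

Lemma each_map T T' (Q : T' -> Prop) (F : T -> T') s :
  each Q (map F s) <-> each (fun p => Q (F p)) s.
Proof. by elim: s => //= p s ->. Qed.

Section Steps.
Context {R : realType}.
Implicit Types (d c th x : R) (f g : R -> R).

(** A step (E, m) stands for a random variable X with mean m through the
    functional E g = E[g (X - m)]. *)
Definition step : Type := (((R -> R) -> R) * R)%type.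
Implicit Types (p : step) (s : seq step).

(** In [ex_le] the two functions are compared on Z - m only: this records that
    X takes integer values. *)
Record is_step d p : Prop := IsStep {
  step_d : 0 < d;
  ex1 : p.1 (fun=> 1) = 1;
  exD : forall f g, adm d f -> adm d g ->
    p.1 (fun t => f t + g t) = p.1 f + p.1 g;
  exZ : forall c f, adm d f -> p.1 (fun t => c * f t) = c * p.1 f;
  ex_le : forall f g, adm d f -> adm d g ->
    (forall t, t + p.2 \is a Num.int -> f t <= g t) -> p.1 f <= p.1 g }.

Section OneStep.
Variables (d : R) (p : step).
Hypothesis sp : is_step d p.

Let d0 : 0 < d := step_d sp.

Lemma ex_cst c : p.1 (fun=> c) = c.
Proof.
have := exZ sp c (adm_cst 1 (ltW d0)).
by rewrite (ex1 sp) (_ : (fun=> c * 1) = (fun=> c)) ?mulr1//; apply/funext => t; rewrite mulr1.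
Qed.

Lemma exB f g : adm d f -> adm d g ->
  p.1 (fun t => f t - g t) = p.1 f - p.1 g.
Proof.
move=> hf hg; rewrite (_ : (fun t => _) = (fun t => f t + (-1) * g t)).
  by rewrite (exD sp) ?(exZ sp) ?mulN1r//; exact: admZ.
by apply/funext => t; rewrite mulN1r.
Qed.

Lemma ex_ge0 f : adm d f -> (forall t, t + p.2 \is a Num.int -> 0 <= f t) ->
  0 <= p.1 f.
Proof.
by move=> hf h; rewrite -(ex_cst 0) (ex_le sp)//; exact/adm_cst/ltW.
Qed.

Lemma ex_norm f : adm d f -> `|p.1 f| <= p.1 (fun t => `|f t|).
Proof.
move=> hf; have hn := adm_norm hf; rewrite ler_norml; apply/andP; split.
  rewrite -[- _]mulN1r -(exZ sp)// (ex_le sp)//; first exact: admZ.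
  by move=> t _; rewrite mulN1r lerNl -normrN ler_norm.
by rewrite (ex_le sp)// => t _; rewrite ler_norm.
Qed.

End OneStep.

(** The transition operator of the walk killed outside of D. *)
Definition kstep (D : R -> bool) p f x : R :=
  p.1 (fun t => if D (x + t) then f (x + t) else 0).

(** [kwalk D s f x] is E[f (S_n); S_1, ..., S_n in D] for the walk S started at
    x with steps s.  The starting point itself may lie outside of D. *)
Fixpoint kwalk (D : R -> bool) s f : R -> R :=
  if s is p :: s' then kstep D p (kwalk D s' f) else f.

Definition drift_sum s : R := \sum_(p <- s) p.2.

Implicit Types (D : R -> bool).

Lemma kwalk_cat D s1 s2 f : kwalk D (s1 ++ s2) f = kwalk D s1 (kwalk D s2 f).
Proof. by elim: s1 => //= p s ->. Qed.

Lemma kwalk_rcons D s p f : kwalk D (rcons s p) f = kwalk D s (kstep D p f).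
Proof. by rewrite -cats1 kwalk_cat. Qed.

Section KStep.
Variables (d : R).

Lemma adm_in D x f : 0 <= d -> adm d f ->
  adm d (fun t => if D (x + t) then f (x + t) else 0).
Proof. by move=> d0 hf; exact: (adm_shift x d0 (adm_if D hf)). Qed.

Lemma adm_kstep D p f : is_step d p -> adm d f -> adm d (kstep D p f).
Proof.
move=> sp /adm_pos[A [A0 hA]]; have d0 := ltW (step_d sp).
exists (A * p.1 (fun t => expR (d * `|t|))) => x.
have hf : adm d f by exists A.
apply: le_trans (ex_norm sp (adm_in D x d0 hf)) _.
rewrite mulrAC -(exZ sp); last exact: adm_expabs.
apply: (ex_le sp); [exact/adm_norm/adm_in|exact/admZ/adm_expabs|].
move=> t _; case: ifP => _.
  rewrite (le_trans (hA _))// -mulrA ler_wpM2l// -expRD ler_expR -mulrDr.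
  by rewrite ler_wpM2l// ler_normD.
by rewrite normr0 !mulr_ge0 ?expR_ge0.
Qed.

Lemma kstep_le D p f g x : is_step d p -> adm d f -> adm d g ->
  (forall z, D z -> z - x + p.2 \is a Num.int -> f z <= g z) ->
  kstep D p f x <= kstep D p g x.
Proof.
move=> sp hf hg h; have d0 := ltW (step_d sp).
apply: (ex_le sp); [exact: adm_in|exact: adm_in|] => t ht.
by case: ifP => // Dt; apply: h => //; rewrite [x + t]addrC addrK.
Qed.

Lemma kstepD D p f g x : is_step d p -> adm d f -> adm d g ->
  kstep D p (fun z => f z + g z) x = kstep D p f x + kstep D p g x.
Proof.
move=> sp hf hg; have d0 := ltW (step_d sp).
rewrite /kstep -(exD sp); [|exact: adm_in|exact: adm_in].
by congr (p.1 _); apply/funext => t; case: ifP => // _; rewrite addr0.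
Qed.

Lemma kstepZ D p c f x : is_step d p -> adm d f ->
  kstep D p (fun z => c * f z) x = c * kstep D p f x.
Proof.
move=> sp hf; have d0 := ltW (step_d sp).
rewrite /kstep -(exZ sp); last exact: adm_in.
by congr (p.1 _); apply/funext => t; case: ifP => // _; rewrite mulr0.
Qed.

Lemma kstep_dom D D' p f x : is_step d p -> adm d f ->
  (forall z, 0 <= f z) -> (forall z, D z -> D' z) ->
  kstep D p f x <= kstep D' p f x.
Proof.
move=> sp hf f0 DD; have d0 := ltW (step_d sp).
apply: (ex_le sp); [exact: adm_in|exact: adm_in|] => t ht.
by case: ifP => [/DD->//|_]; case: ifP.
Qed.

Lemma kstep_ge0 D p f x : is_step d p -> adm d f ->
  (forall z, D z -> 0 <= f z) -> 0 <= kstep D p f x.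
Proof.
move=> sp hf f0; have d0 := ltW (step_d sp).
apply: (ex_ge0 sp); first exact: adm_in.
by move=> t _; case: ifP => // /f0.
Qed.

Lemma adm_kwalk D s f : each (is_step d) s -> adm d f -> adm d (kwalk D s f).
Proof. by elim: s => //= p s ih [sp ss] hf; exact/adm_kstep/ih. Qed.

(** Only the sites of D that the walk can reach from x matter, and these lie
    on a coset of the integers. *)
Lemma kwalk_le D s f g x : each (is_step d) s -> adm d f -> adm d g -> D x ->
  (forall z, D z -> z - x + drift_sum s \is a Num.int -> f z <= g z) ->
  kwalk D s f x <= kwalk D s g x.
Proof.
move=> ss hf hg; elim: s x ss => [|p s ih] x /=.
  by move=> _ Dx h; apply: h => //; rewrite subrr /drift_sum big_nil addr0 rpred0.
move=> [sp ss] Dx h; apply: kstep_le => //; [exact: adm_kwalk..|].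
move=> z Dz hz; apply: ih => // w Dw hw; apply: h => //.
rewrite /drift_sum big_cons -/(drift_sum s).
have -> : w - x + (p.2 + drift_sum s) = (w - z + drift_sum s) + (z - x + p.2).
  by ring.
by rewrite rpredD.
Qed.

Lemma kwalkD D s f g x : each (is_step d) s -> adm d f -> adm d g ->
  kwalk D s (fun z => f z + g z) x = kwalk D s f x + kwalk D s g x.
Proof.
move=> ss hf hg; elim: s x ss => [|p s ih] x //= [sp ss].
rewrite -(kstepD D x sp); [|exact: adm_kwalk..].
by congr (kstep D p _ x); apply/funext => z; rewrite ih.
Qed.

Lemma kwalkZ D s c f x : each (is_step d) s -> adm d f ->
  kwalk D s (fun z => c * f z) x = c * kwalk D s f x.
Proof.
move=> ss hf; elim: s x ss => [|p s ih] x //= [sp ss].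
rewrite -(kstepZ D c x sp); [|exact: adm_kwalk].
by congr (kstep D p _ x); apply/funext => z; rewrite ih.
Qed.

Lemma kwalkB D s f g x : each (is_step d) s -> adm d f -> adm d g ->
  kwalk D s (fun z => f z - g z) x = kwalk D s f x - kwalk D s g x.
Proof.
move=> ss hf hg; rewrite -[- kwalk D s g x]mulN1r -kwalkZ// -kwalkD//; last exact: admZ.
by congr (kwalk D s _ x); apply/funext => z; rewrite mulN1r.
Qed.

Lemma kwalk_ge0 D s f x : each (is_step d) s -> adm d f ->
  (forall z, 0 <= f z) -> 0 <= kwalk D s f x.
Proof.
move=> ss hf f0; elim: s x ss => [|p s ih] x //= [sp ss].
by apply: kstep_ge0 => //; [exact: adm_kwalk|move=> z _; exact: ih].
Qed.

Lemma kwalk_dom D D' s f x : each (is_step d) s -> adm d f ->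
  (forall z, 0 <= f z) -> (forall z, D z -> D' z) ->
  kwalk D s f x <= kwalk D' s f x.
Proof.
move=> ss hf f0 DD; elim: s x ss => [|p s ih] x //= [sp ss].
apply: (@le_trans _ _ (kstep D p (kwalk D' s f) x)).
  by apply: kstep_le => //; [exact: adm_kwalk..|move=> z Dz _; exact: ih].
apply: kstep_dom => //; first exact: adm_kwalk.
by move=> z; exact: kwalk_ge0.
Qed.

Lemma kwalk_sum D s (I : Type) (r : seq I) (F : I -> R -> R) x : 0 <= d ->
  each (is_step d) s -> (forall i, adm d (F i)) ->
  kwalk D s (fun z => \sum_(i <- r) F i z) x = \sum_(i <- r) kwalk D s (F i) x.
Proof.
move=> d0 ss h; elim: r => [|i r ih].
  rewrite big_nil (_ : (fun z => _) = (fun=> 0 * 1)); last first.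
    by apply/funext => t; rewrite big_nil mul0r.
  by rewrite kwalkZ ?mul0r//; exact: adm_cst.
rewrite big_cons -ih -kwalkD//; last exact: adm_sum.
by congr (kwalk D s _ x); apply/funext => t; rewrite big_cons.
Qed.

Lemma kwalk_le1 D s x : 0 <= d -> each (is_step d) s -> D x ->
  kwalk D s (fun=> 1) x <= 1.
Proof.
move=> d0 ss; elim: s x ss => [|p s ih] x //= [sp ss] Dx.
rewrite -[leRHS](ex1 sp); apply: (ex_le sp).
- by apply: adm_in => //; apply: adm_kwalk => //; exact: adm_cst.
- exact: adm_cst.
- by move=> t _; case: ifP => // Dt; exact: ih.
Qed.

Lemma kwalk_free1 s x : 0 <= d -> each (is_step d) s ->
  kwalk predT s (fun=> 1) x = 1.
Proof.
move=> d0; elim: s x => [|p s ih] x //= [sp ss].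
rewrite -[RHS](ex1 sp); congr (p.1 _).
by apply/funext => t; rewrite ih.
Qed.

Lemma kwalk_cst s c x : 0 <= d -> each (is_step d) s ->
  kwalk predT s (fun=> c) x = c.
Proof.
move=> d0 ss; rewrite -[RHS]mulr1 -(kwalk_free1 x d0 ss) -(kwalkZ _ _ _ ss).
  by congr (kwalk predT s _ x); apply/funext => z; rewrite mulr1.
exact: adm_cst.
Qed.

End KStep.

End Steps.

(** * Survival on a half-line: upper bound *)

Section Ballot.
Context {R : realType}.
Implicit Types (d C k H mu th x y t : R) (p : @step R) (s : seq (@step R)).

(** Uniform control of a step: exponential moment C, truncated variance k, and a
    mean displacement mu, which is zero for the original steps and small for
    the tilted ones. *)
Record good d C k H mu p : Prop := Good {
  good_step : is_step d p;
  good_exp : p.1 (fun t => expR (d * `|t|)) <= C;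
  good_var : k <= p.1 (fun t => if `|t| <= H then t ^+ 2 else 0);
  good_drift : `|p.1 id| <= mu }.

Lemma good_each d C k H mu s : each (good d C k H mu) s -> each (is_step d) s.
Proof. by apply: each_imp => p []. Qed.

Lemma var_le d C p : is_step d p -> p.1 (fun t => expR (d * `|t|)) <= C ->
  p.1 (fun t => t ^+ 2) <= 2 / d ^+ 2 * C.
Proof.
move=> sp h; have d0 := step_d sp.
apply: (@le_trans _ _ (2 / d ^+ 2 * p.1 (fun t => expR (d * `|t|)))).
  rewrite -(exZ sp); last exact: adm_expabs.
  apply: (ex_le sp); [exact: adm_sqr|exact/admZ/adm_expabs|].
  by move=> t _; exact: sqr_le_expR.
by rewrite ler_wpM2l// divr_ge0// exprn_ge0// ltW.
Qed.

(** Convexity: exp x >= 1 + x everywhere, and exp x >= 1 + x + x^2 / 4 on the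
    event |t| <= H, where th * H <= 2. *)
Lemma laplace_lower d C k H mu p th : good d C k H mu p -> 0 <= th -> th <= d ->
  th * H <= 2 -> 1 + (k / 4 * th ^+ 2 - mu * th) <= p.1 (fun t => expR (- th * t)).
Proof.
move=> [sp _ hk hm] th0 thd thH; have d0 := step_d sp.
have ae : adm d (fun t => expR (- th * t)) by apply: adm_exp; rewrite normrN ger0_norm.
have ac : adm d (fun=> 1 : R) by exact/adm_cst/ltW.
have ai : adm d (fun t : R => t) by exact: adm_id.
have aq : adm d (fun t : R => if `|t| <= H then t ^+ 2 else 0).
  by apply: (@adm_if _ _ (fun t => `|t| <= H)); exact: adm_sqr.
have -> : p.1 (fun t => expR (- th * t)) =
    p.1 (fun t => expR (- th * t) - 1 + th * t) + 1 - th * p.1 id.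
  rewrite (exD sp); [|exact: admB|exact: admZ].
  by rewrite (exB sp)// (exZ sp)// (ex_cst sp); ring.
have h1 : k / 4 * th ^+ 2 <= p.1 (fun t => expR (- th * t) - 1 + th * t).
  apply: (@le_trans _ _ (th ^+ 2 / 4 * p.1 (fun t => if `|t| <= H then t ^+ 2 else 0))).
    by have := sqr_ge0 th; nra.
  rewrite -(exZ sp)//; apply: (ex_le sp) => [||t _].
  - exact: admZ.
  - by apply: admD; [exact: admB|exact: admZ].
  have := expR_ge1Dx (- th * t); case: ifP => tH; last by lra.
  move=> _; have : - 2 <= - th * t.
    move: tH; rewrite ler_norml => /andP[_ tH]; nra.
  by move=> /expR_ge_quad; rewrite exprMn sqrrN; lra.
have h2 : th * p.1 id <= mu * th.
  by rewrite mulrC ler_wpM2r// (le_trans _ hm)// ler_norm.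
by lra.
Qed.

Lemma expR_half_split w y : 0 < w -> expR y <= w * expR (y + y) + (4 * w)^-1.
Proof.
move=> w0; rewrite expRD; set e := expR y.
have : 0 <= w * (e - (2 * w)^-1) ^+ 2 by rewrite mulr_ge0 ?sqr_ge0// ltW.
have -> : w * (e - (2 * w)^-1) ^+ 2 = w * (e * e) + (4 * w)^-1 - e.
  by field; rewrite gt_eqF.
by lra.
Qed.

(** Bounds the first term of the potential [bal] at an overshoot y below the
    origin. *)
Lemma linexp_le d th y : 0 < d -> 0 < th -> th <= d / 2 -> 0 <= y ->
  (expR (th * y) - 1) / th <= 2 / d * expR (d * y).
Proof.
move=> d0 th0 thd y0; rewrite ler_pdivrMr//.
have := expR_sub1_le_mul (th * y).
have h1 : expR (th * y) <= expR (d / 2 * y) by rewrite ler_expR ler_wpM2r.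
have h2 : d / 2 * y <= expR (d / 2 * y) by have := expR_ge1Dx (d / 2 * y); lra.
have -> : expR (d * y) = expR (d / 2 * y) * expR (d / 2 * y).
  by rewrite -expRD; congr expR; lra.
move: h1 h2; set e := expR (th * y); set E := expR _ => h1 h2 h.
have e0 : 0 < e := expR_gt0 _.
have hy : y * e <= 2 / d * (E * E).
  rewrite mulrAC ler_pdivlMr// -[leLHS]mulrA.
  have : 0 <= (E - d / 2 * y) * E by rewrite mulr_ge0 ?subr_ge0// ?expR_ge0//.
  have : 0 <= d / 2 * y * (E - e) by rewrite !mulr_ge0 ?subr_ge0// ltW.
  by nra.
by nra.
Qed.

(** The ballot potential.  Its first term behaves like min (x, 1 / th) and is
    strictly superharmonic on the whole line.  It becomes negative below the
    origin, whereas the killed walk collects 0 there; the second term, bounded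
    on the half-line, is superharmonic with a gain that pays for this
    overshoot. *)
Definition bal th B A0 eps x := (1 - expR (- th * x)) / th + B * (A0 - expR (- eps * x)).

Section Potential.
Variables (d C k H eps : R).
Hypotheses (C0 : 0 < C) (k0 : 0 < k) (e0 : 0 < eps) (ed : eps <= d / 2)
  (eH : eps * H <= 2).
Let w := k * eps ^+ 2 / (16 * C).
Let B := 32 * C / (d * k * eps ^+ 2).
Let A0 := (4 * w)^-1 + 1.
Variables (th mu : R).
Hypotheses (th0 : 0 < th) (the : th <= eps) (muth : mu <= k / 8 * th).
Let d0 : 0 < d. Proof. by have := e0; have := ed; lra. Qed.
Let w0 : 0 < w. Proof. by rewrite divr_gt0 ?mulr_gt0 ?exprn_gt0. Qed.
Let B0 : 0 < B. Proof. by rewrite divr_gt0 ?mulr_gt0 ?exprn_gt0. Qed.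
Let A1 : 1 <= A0. Proof. by rewrite lerDr invr_ge0 mulr_ge0// ltW. Qed.

Let f := bal th B A0 eps.

Lemma bal_ge x : 0 <= x -> (1 - expR (- th * x)) / th <= f x.
Proof.
move=> x0; rewrite /f /bal lerDl mulr_ge0 ?(ltW B0)// subr_ge0.
by rewrite (le_trans _ A1)// -expR0 ler_expR mulNr oppr_le0 mulr_ge0// ltW.
Qed.

Lemma bal_ge0 x : 0 <= x -> 0 <= f x.
Proof.
move=> x0; apply: le_trans (bal_ge x0); rewrite divr_ge0 ?(ltW th0)// subr_ge0.
by rewrite -expR0 ler_expR mulNr oppr_le0 mulr_ge0// ltW.
Qed.

(** Hence the potential is at most linear, uniformly in th. *)
Lemma bal_le x : 0 <= x -> f x <= x + B * A0.
Proof.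
move=> x0; rewrite /f /bal lerD//.
  by rewrite ler_pdivrMr//; have := expR_ge1Dx (- th * x); lra.
by rewrite ler_wpM2l ?(ltW B0)// gerBl expR_ge0.
Qed.

Let thd : th <= d. Proof. by have := ed; have := the; have := d0; lra. Qed.
Let edd : eps <= d. Proof. by have := ed; have := d0; lra. Qed.

Lemma adm_bal : adm d f.
Proof.
have ac c : adm d (fun=> c : R) by exact/adm_cst/ltW.
apply: admD.
  apply: (@adm_le _ _ _ (fun x => th^-1 * (1 - expR (- th * x)))).
    by move=> x; rewrite mulrC.
  by apply/admZ/admB => //; apply: adm_exp; rewrite normrN ger0_norm// ltW.
by apply/admZ/admB => //; apply: adm_exp; rewrite normrN ger0_norm// ltW.
Qed.

(** Replacing the killed operator by the free one costs, at the point x + t < 0,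
    at most a multiple of exp (- d (x + t)) <= exp (- d x) exp (d |t|); the
    constants B and w are such that the gain of the second term of the
    potential cancels this cost. *)
Lemma kstep_bal (D : R -> bool) p x : (forall z, D z -> 0 <= z) ->
  good d C k H mu p -> D x ->
  kstep D p f x <= f x - k / 8 * th * expR (- th * x).
Proof.
move=> D0 gp Dx; have x0 := D0 _ Dx; have [sp hC _ _] := gp.
have ac c : adm d (fun=> c : R) by exact/adm_cst/ltW.
have aex c : `|c| <= d -> adm d (fun t => expR (c * (x + t))).
  by move=> hc; exact: (adm_shift x (ltW d0) (adm_exp hc)).
have afx : adm d (fun t => f (x + t)) by exact: (adm_shift x (ltW d0) adm_bal).
pose W := (2 / d + B * w) * expR (- d * x).
apply: (@le_trans _ _ (p.1 (fun t => f (x + t) + W * expR (d * `|t|)))).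
  apply: (ex_le sp); first exact: (adm_in D x (ltW d0) adm_bal).
    by apply: admD => //; exact/admZ/adm_expabs.
  move=> t _; have W0 : 0 <= W * expR (d * `|t|).
    by rewrite /W; pos.
  have [y0|y0] := leP 0 (x + t).
    by case: ifP => _; [lra|have := bal_ge0 y0; lra].
  case: ifP => [/D0|_]; first by lra.
  set y := - (x + t).
  have yp : 0 <= y by rewrite /y; lra.
  have h : expR (d * y) <= expR (- d * x) * expR (d * `|t|).
    rewrite -expRD ler_expR mulNr addrC -mulrBr ler_wpM2l ?(ltW d0)//.
    by rewrite /y; have := ler_norm (- t); rewrite normrN; lra.
  have -> : x + t = - y by rewrite /y opprK.
  clearbody y.
  have h1 := linexp_le d0 th0 (le_trans the ed) yp.
  have h2 := expR_half_split (eps * y) w0.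
  have h3 : expR (eps * y + eps * y) <= expR (d * y).
    by rewrite ler_expR -mulrDl ler_wpM2r//; have := ed; lra.
  (* the choice A0 = 1 / (4 w) + 1 makes this the completed square of
     [expR_half_split] *)
  have h4 : expR (eps * y) - A0 <= w * expR (d * y).
    have h5 : w * expR (eps * y + eps * y) <= w * expR (d * y).
      by rewrite ler_wpM2l// ltW.
    by rewrite /A0; lra.
  have h6 : B * (expR (eps * y) - A0) <= B * (w * expR (d * y)).
    by rewrite ler_wpM2l// ltW.
  have h7 : (2 / d + B * w) * expR (d * y) <= W * expR (d * `|t|).
    by rewrite /W -[leRHS]mulrA ler_wpM2l//; pos.
  rewrite /f /bal !mulrNN.
  have -> : 1 - expR (th * y) = - (expR (th * y) - 1) by ring.
  have -> : A0 - expR (eps * y) = - (expR (eps * y) - A0) by ring.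
  rewrite mulNr mulrN; lra.
have exE c : `|c| <= d -> p.1 (fun t => expR (c * (x + t))) = expR (c * x) * p.1 (fun t => expR (c * t)).
  move=> hc; rewrite -(exZ sp); last exact: adm_exp.
  by congr (p.1 _); apply/funext => t; rewrite mulrDr expRD.
have nth : `|- th| <= d by rewrite normrN ger0_norm// ltW.
have nep : `|- eps| <= d by rewrite normrN ger0_norm// ltW.
rewrite (exD sp)//; last exact/admZ/adm_expabs.
rewrite (exZ sp); last exact: adm_expabs.
have -> : p.1 (fun t => f (x + t)) = (1 - expR (- th * x) * p.1 (fun t => expR (- th * t))) / th
    + B * (A0 - expR (- eps * x) * p.1 (fun t => expR (- eps * t))).
  rewrite -!exE//.
  rewrite (_ : (fun t => f (x + t)) = (fun t =>
    th^-1 * (1 - expR (- th * (x + t))) + B * (A0 - expR (- eps * (x + t))))); last first.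
    by apply/funext => t; rewrite /f /bal [th^-1 * _]mulrC.
  rewrite (exD sp); [|by apply/admZ/admB => //; exact: aex..].
  rewrite !(exZ sp); [|by apply/admB => //; exact: aex..].
  rewrite !(exB sp); [|by []|exact: aex|by []|exact: aex].
  by rewrite !(ex_cst sp) [th^-1 * _]mulrC.
have l1 := laplace_lower gp (ltW th0) thd.
have thH : th * H <= 2.
  have [H0|H0] := leP 0 H; first by apply: le_trans eH; rewrite ler_wpM2r.
  by have := mulr_gt0 th0 (_ : 0 < - H); rewrite oppr_gt0 => /(_ H0); lra.
have {}l1 := l1 thH.
have l2 := laplace_lower gp (ltW e0) edd eH.
set Lt := p.1 (fun t => expR (- th * t)) in l1 *.
set Le := p.1 (fun t => expR (- eps * t)) in l2 *.
set u := expR (- th * x); set v := expR (- eps * x).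
have u0 : 0 < u := expR_gt0 _; have v0 : 0 < v := expR_gt0 _.
have l1' : 1 + k / 8 * th ^+ 2 <= Lt.
  apply: le_trans l1; have := ler_wpM2r (ltW th0) muth; lra.
have l2' : 1 + k / 8 * eps ^+ 2 <= Le.
  apply: le_trans l2.
  have me : mu <= k / 8 * eps by apply: le_trans muth _; rewrite ler_wpM2l//; pos.
  have := ler_wpM2r (ltW e0) me; lra.
have q1 : (1 - u * Lt) / th <= (1 - u) / th - k / 8 * th * u.
  rewrite ler_pdivrMr// mulrBl divfK ?gt_eqF//.
  by have := ler_wpM2l (ltW u0) l1'; lra.
have q2 : B * (A0 - v * Le) <= B * (A0 - v) - B * (k / 8 * eps ^+ 2) * v.
  have := ler_wpM2l (ltW B0) (ler_wpM2l (ltW v0) l2'); lra.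
have vd : expR (- d * x) <= v by rewrite ler_expR ler_wpM2r// lerN2.
have q3 : W * p.1 (fun t => expR (d * `|t|)) <= (2 / d + B * w) * v * C.
  apply: ler_pM => //.
  - by rewrite /W; pos.
  - by apply: (ex_ge0 sp); [exact: adm_expabs|move=> t _; exact: expR_ge0].
  - by rewrite ler_wpM2l//; pos.
(* the cost of the overshoot equals the gain of the second term of the
   potential *)
have q4 : (2 / d + B * w) * C = B * (k / 8 * eps ^+ 2).
  rewrite /B /w; field; rewrite !gt_eqF//.
have : (2 / d + B * w) * v * C = B * (k / 8 * eps ^+ 2) * v by rewrite -q4; ring.
rewrite /f /bal -/u -/v; lra.
Qed.

(** A unit of lifetime is exp (- th x) + (1 - exp (- th x)).  The first part is
    paid by the decrease of the potential, the second one is at most th times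
    the potential. *)
Lemma kwalk_bal_sum (D : R -> bool) s x : (forall z, D z -> 0 <= z) ->
  each (good d C k H mu) s -> D x ->
  \sum_(i < size s) kwalk D (take i s) (fun=> 1) x <=
    (th * (size s)%:R + (k / 8 * th)^-1) * f x.
Proof.
move=> D0; elim: s x => [|p s ih] x /=.
  by move=> _ Dx; rewrite big_ord0 mulr0 add0r; apply: mulr_ge0; [pos|apply: bal_ge0; exact: D0].
move=> [gp gs] Dx; have sp := good_step gp; have ss := good_each gs.
have ac c : adm d (fun=> c : R) by exact/adm_cst/ltW.
rewrite big_ord_recl /=.
pose c := th * (size s)%:R + (k / 8 * th)^-1.
have c0 : 0 <= c.
  by rewrite /c; pos.
have -> : \sum_(i < size s) kstep D p (kwalk D (take i s) (fun=> 1)) x =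
    kstep D p (fun z => \sum_(i < size s) kwalk D (take i s) (fun=> 1) z) x.
  have E := @kwalk_sum _ d D [:: p] _ (index_enum 'I_(size s))
    (fun (i : 'I_(size s)) => kwalk D (take i s) (fun=> 1)) x (ltW d0) (conj sp I).
  by rewrite /= in E; rewrite E// => i; apply: adm_kwalk => //; exact: each_take.
have h1 : kstep D p (fun z => \sum_(i < size s) kwalk D (take i s) (fun=> 1) z) x
    <= kstep D p (fun z => c * f z) x.
  apply: (kstep_le sp).
  - apply: (adm_sum _ (ltW d0)) => i; apply: adm_kwalk => //; exact: each_take.
  - exact/admZ/adm_bal.
  - by move=> z Dz _; exact: ih.
rewrite (kstepZ D c x sp adm_bal) in h1.
have h2 := ler_wpM2l c0 (kstep_bal D0 gp Dx).
have h3 := bal_ge (D0 _ Dx).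
rewrite ler_pdivrMr// in h3.
have e1 : 0 < expR (- th * x) := expR_gt0 _.
have h4 : expR (- th * x) <= c * (k / 8 * th * expR (- th * x)).
  rewrite mulrA ler_peMl ?(ltW e1)// /c mulrDl mulVf; last first.
    by rewrite gt_eqF//; pos.
  by rewrite lerDr; pos.
have -> : th * (size s).+1%:R + (k / 8 * th)^-1 = c + th.
  by rewrite -natr1 /c; ring.
by rewrite mulrDl; lra.
Qed.

End Potential.

Lemma kwalk_mono_len d (D : R -> bool) s1 s2 x : each (is_step d) (s1 ++ s2) -> 0 < d -> D x ->
  kwalk D (s1 ++ s2) (fun=> 1) x <= kwalk D s1 (fun=> 1) x.
Proof.
move=> /each_cat[st1 st2] d0 Dx; have ac : adm d (fun=> 1 : R) by exact/adm_cst/ltW.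
rewrite kwalk_cat; apply: (kwalk_le st1) => //; first exact: adm_kwalk.
by move=> z Dz _; exact: (kwalk_le1 (ltW d0) st2 Dz).
Qed.

(** The potential is at most a constant times x + 1, and survival probabilities
    decrease in time, so the last one is at most the average of all of
    them. *)
Lemma ballot d C k H : 0 < d -> 0 < C -> 0 < k -> 0 < H ->
  exists K th1, [/\ 0 < K, 0 < th1 & forall th mu, 0 < th <= th1 -> mu <= k / 8 * th ->
  forall (D : R -> bool) s x, (forall z, D z -> 0 <= z) ->
  each (good d C k H mu) s -> D x ->
  \sum_(i < size s) kwalk D (take i s) (fun=> 1) x <=
    K * (x + 1) * (th * (size s)%:R + th^-1) /\
  ((0 < size s)%N ->
   kwalk D s (fun=> 1) x <= K * (x + 1) * (th + ((size s)%:R * th)^-1))].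
Proof.
move=> d0 C0 k0 H0.
pose eps := Num.min (d / 2) (2 / H).
have e0 : 0 < eps by rewrite lt_min; apply/andP; split; pos.
have ed : eps <= d / 2 by rewrite ge_min lexx.
have eH : eps * H <= 2 by rewrite -ler_pdivlMr// ge_min lexx orbT.
pose w := k * eps ^+ 2 / (16 * C).
pose B := 32 * C / (d * k * eps ^+ 2).
pose A := (4 * w)^-1 + 1.
have B0 : 0 < B by rewrite /B; pos.
have w0 : 0 < w by rewrite /w; pos.
have A0 : 0 < A by rewrite /A; pos.
pose K := (1 + B * A) * (1 + 8 / k).
have K0 : 0 < K by rewrite /K; pos.
exists K, eps; split=> // th mu /andP[th0 the] muth D s x D0 gs Dx.
have x0 := D0 _ Dx.
have sum : \sum_(i < size s) kwalk D (take i s) (fun=> 1) x <=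
    K * (x + 1) * (th * (size s)%:R + th^-1).
  apply: le_trans (kwalk_bal_sum C0 k0 e0 ed eH th0 the muth D0 gs Dx) _.
  have fx := bal_le C0 k0 e0 ed th0 x0.
  have f0 := bal_ge0 C0 k0 e0 ed th0 x0.
  have h1 : bal th B A eps x <= (1 + B * A) * (x + 1).
    apply: le_trans fx _; rewrite -/B -/w -/A.
    have : 0 <= B * A * x by pos.
    by lra.
  have h2 : th * (size s)%:R + (k / 8 * th)^-1 <= (1 + 8 / k) * (th * (size s)%:R + th^-1).
    rewrite invfM invf_div.
    have : 0 <= 8 / k * (th * (size s)%:R) by pos.
    have : 0 <= th^-1 by pos.
    by nra.
  have h3 : 0 <= th * (size s)%:R + (k / 8 * th)^-1 by pos.
  apply: le_trans (ler_pM h3 f0 h2 h1) _.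
  by rewrite /K le_eqVlt; apply/orP; left; apply/eqP; ring.
split=> // s0.
have sR : 0 < (size s)%:R :> R by rewrite ltr0n.
have h : (size s)%:R * kwalk D s (fun=> 1) x <=
    \sum_(i < size s) kwalk D (take i s) (fun=> 1) x.
  rewrite -[X in X%:R * _](card_ord (size s)) mulr_natl -sumr_const.
  apply: ler_sum => i _; rewrite -{1}(cat_take_drop i s).
  by apply: (@kwalk_mono_len d) => //; rewrite cat_take_drop; exact: good_each gs.
rewrite -(ler_pM2l sR); apply: le_trans (le_trans h sum) _.
rewrite le_eqVlt; apply/orP; left; apply/eqP; field.
by rewrite !gt_eqF.
Qed.

End Ballot.

(** * Lattice decomposition and time reversal *)

Section Lattice.
Context {R : realType}.
Implicit Types (d x y z u v lo hi : R) (p : @step R) (s : seq (@step R)).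
Implicit Types (D A B : R -> bool) (pts : seq R) (f : R -> R).

(** The points of a coset of Z in a bounded interval form a finite set, over which
    one can sum. *)
Lemma lattice_points b lo hi : exists pts, uniq pts /\
  forall z, (z \in pts) = (lo <= z <= hi) && (z - b \is a Num.int).
Proof.
have [K Kp] : exists K : nat, forall z, lo <= z <= hi -> `|z - b| <= K%:R.
  exists (Num.truncn (`|lo - b| + `|hi - b|)).+1 => z /andP[z1 z2].
  apply: le_trans (ltW (truncnS_gt _)).
  rewrite ler_norml; apply/andP; split.
    by have := ler_norm (- (lo - b)); have := normr_ge0 (hi - b); rewrite normrN; lra.
  by have := ler_norm (hi - b); have := normr_ge0 (lo - b); lra.
pose pt (i : nat) := b + ((i%:Z - K%:Z)%:~R : R).
exists [seq z <- map pt (iota 0 (2 * K).+1) | lo <= z <= hi]; split.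
  rewrite filter_uniq// map_inj_uniq ?iota_uniq// => i j /addrI/intr_inj.
  by move=> /addIr [].
move=> z; rewrite mem_filter; case: (boolP (lo <= z <= hi)) => // hz; rewrite !andTb.
apply/idP/idP.
  by move=> /mapP[i _ ->]; rewrite /pt addrAC subrr add0r intr_int.
move=> /intrP[j zj]; have := Kp _ hz; rewrite zj -intr_norm.
have -> : K%:R = (K%:Z)%:~R :> R by [].
rewrite ler_int => jK; apply/mapP; exists (absz (j + K%:Z)%R).
  by rewrite mem_iota; lia.
rewrite /pt (_ : (absz (j + K%:Z)%R)%:Z - K%:Z = j); last by lia.
by rewrite -zj addrC subrK.
Qed.

Definition ind z : R -> R := fun x => (x == z)%:R.

Lemma ind_ge0 z x : 0 <= ind z x. Proof. by rewrite /ind ler0n. Qed.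

Lemma adm_ind d z : 0 <= d -> adm d (ind z).
Proof.
move=> d0; apply: (@adm_bounded _ _ _ 1) => // x.
by rewrite /ind ger0_norm ?ler0n// lern1 leq_b1.
Qed.

Lemma sum_ind pts f x : uniq pts ->
  \sum_(z <- pts) f z * ind z x = if x \in pts then f x else 0.
Proof.
move=> up; case: ifP => hx.
  rewrite (bigD1_seq x)//= /ind eqxx mulr1 big1 ?addr0// => i /negPf.
  by rewrite eq_sym => ->; rewrite mulr0.
rewrite big_seq big1// => z zp; rewrite /ind; case: eqVneq => [xz|]; last by rewrite mulr0.
by rewrite -xz hx in zp.
Qed.

(** The Chapman-Kolmogorov decomposition according to the endpoint: on the reachable
    sites f coincides with the finite sum of f z * ind z. *)
Lemma kwalk_lattice d D s f x pts : 0 < d -> each (is_step d) s -> adm d f -> D x ->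
  uniq pts -> (forall z, D z -> z - x + drift_sum s \is a Num.int -> z \in pts) ->
  kwalk D s f x = \sum_(z <- pts) kwalk D s (ind z) x * f z.
Proof.
move=> d0 ss hf Dx up hp; have d0' := ltW d0.
have aF z : adm d (fun y => f z * ind z y) by exact/admZ/adm_ind.
transitivity (kwalk D s (fun y => \sum_(z <- pts) f z * ind z y) x); last first.
  rewrite (kwalk_sum D pts x d0' ss aF); apply: eq_bigr => z _.
  by rewrite (kwalkZ D (f z) x ss (adm_ind z d0')) mulrC.
apply/eqP; rewrite eq_le; apply/andP; split; apply: (kwalk_le ss) => //.
- exact: adm_sum.
- by move=> z Dz hz; rewrite sum_ind// hp.
- exact: adm_sum.
- by move=> z Dz hz; rewrite sum_ind// hp.
Qed.

(** The step of - X. *)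
Definition refl p : @step R := (fun g => p.1 (fun t => g (- t)), - p.2).
(** The steps of the time-reversed walk. *)
Definition srev s := rev (map refl s).

Lemma is_step_refl d p : is_step d p -> is_step d (refl p).
Proof.
move=> [d0 e1 eD eZ ele]; split=> //=.
- by move=> f g hf hg; rewrite -eD//; exact: adm_opp.
- by move=> c f hf; rewrite -eZ//; exact: adm_opp.
- move=> f g hf hg h; apply: ele; [exact: adm_opp|exact: adm_opp|].
  by move=> t ht; apply: h; rewrite -opprD rpredN.
Qed.

Lemma size_srev s : size (srev s) = size s.
Proof. by rewrite size_rev size_map. Qed.

Lemma each_srev (Q : step -> Prop) s : (forall p, Q p -> Q (refl p)) ->
  each Q s -> each Q (srev s).
Proof. by move=> h hs; rewrite /srev each_rev each_map; exact: each_imp hs. Qed.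

Lemma drift_sum_cat s1 s2 : drift_sum (s1 ++ s2) = drift_sum s1 + drift_sum s2 :> R.
Proof. by rewrite /drift_sum big_cat. Qed.

Lemma drift_sum_srev s : drift_sum (srev s) = - drift_sum s :> R.
Proof.
elim: s => [|p s ih]; first by rewrite /drift_sum big_nil oppr0.
rewrite /srev /= rev_cons -cats1 drift_sum_cat -/(srev s) ih /drift_sum !big_cons.
by rewrite big_nil /= addr0 opprD addrC.
Qed.

Definition seg lo hi : R -> bool := fun x => lo <= x <= hi.

Lemma kstep_refl lo hi p x y : seg lo hi x -> seg lo hi y ->
  kstep (seg lo hi) p (ind y) x = kstep (seg lo hi) (refl p) (ind x) y.
Proof.
move=> hx hy; rewrite /kstep /=; congr (p.1 _); apply/funext => t.
rewrite /ind; have -> : (y - t == x) = (x + t == y).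
  by rewrite subr_eq eq_sym.
case: eqVneq => [e|_]; last by do 2?case: ifP.
by rewrite e hy -e addrK hx.
Qed.

(** A path from x to y inside the interval, read backwards, is a path from y to
    x with the opposite steps in the opposite order. *)
Lemma kwalk_rev d lo hi s x y : 0 < d -> each (is_step d) s ->
  seg lo hi x -> seg lo hi y ->
  kwalk (seg lo hi) s (ind y) x = kwalk (seg lo hi) (srev s) (ind x) y.
Proof.
move=> d0; set D := seg lo hi; elim: s x => [|p s ih] x /=.
  by move=> _ _ _; rewrite /ind eq_sym.
move=> [sp ss] Dx Dy.
have sp' := is_step_refl sp; have ss' := each_srev (@is_step_refl d) ss.
have [P1 [u1 m1]] := lattice_points (x - p.2) lo hi.
have [P2 [u2 m2]] := lattice_points (y - drift_sum (srev s)) lo hi.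
pose P := undup (P1 ++ P2).
have memP z : z \in P -> D z.
  by rewrite mem_undup mem_cat m1 m2 => /orP[] /andP[].
have aw : adm d (kwalk D s (ind y)) by apply: adm_kwalk => //; exact/adm_ind/ltW.
have -> : kstep D p (kwalk D s (ind y)) x = \sum_(z <- P) kstep D p (ind z) x * kwalk D s (ind y) z.
  apply: (@kwalk_lattice d D [:: p]) => //; first exact: undup_uniq.
  move=> z Dz; rewrite /drift_sum big_seq1 mem_undup mem_cat m1 => hz.
  by rewrite (Dz : is_true (lo <= z <= hi)) opprB addrA addrAC hz.
rewrite /srev /= rev_cons kwalk_rcons -/(srev s).
rewrite (@kwalk_lattice d D (srev s) _ y P)//.
- rewrite big_seq [RHS]big_seq; apply: eq_bigr => z /memP Dz.
  by rewrite kstep_refl// ih// mulrC.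
- by apply: adm_kstep => //; exact/adm_ind/ltW.
- exact: undup_uniq.
- move=> z Dz hz; rewrite mem_undup mem_cat m2 (Dz : is_true (lo <= z <= hi)) opprB addrA addrAC.
  by rewrite hz orbT.
Qed.

(** The last piece is read backwards, so that it only has to survive from v. *)
Lemma kwalk_three_le d lo hi s1 s2 s3 u v q : 0 < d ->
  each (is_step d) s1 -> each (is_step d) s2 -> each (is_step d) s3 ->
  let D := seg lo hi in D u -> D v -> 0 <= q ->
  (forall y w, D y -> D w -> kwalk D s2 (ind w) y <= q) ->
  kwalk D (s1 ++ s2 ++ s3) (ind v) u <=
    q * kwalk D s1 (fun=> 1) u * kwalk D (srev s3) (fun=> 1) v.
Proof.
move=> d0 t1 t2 t3 D Du Dv q0 hq; rewrite !kwalk_cat.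
have d0' := ltW d0; have ac : adm d (fun=> 1 : R) by exact: adm_cst.
have t3' := each_srev (@is_step_refl d) t3.
have a3 : adm d (kwalk D s3 (ind v)) by apply: adm_kwalk => //; exact: adm_ind.
have a3' z : adm d (kwalk D (srev s3) (ind z)) by apply: adm_kwalk => //; exact: adm_ind.
have [P [uP mP]] := lattice_points (u - (drift_sum s1 + drift_sum s2)) lo hi.
set S := kwalk D (srev s3) (fun=> 1) v.
have sumS : \sum_(w <- P) kwalk D s3 (ind v) w <= S.
  rewrite (_ : \sum_(w <- P) _ = \sum_(w <- P) kwalk D (srev s3) (ind w) v).
    rewrite -(@kwalk_sum _ d D (srev s3) _ P (fun w => ind w) v d0' t3'); last first.
      by move=> w; exact: adm_ind.
    apply: (kwalk_le t3') => //.
      by apply: adm_sum => // w; exact: adm_ind.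
    move=> z Dz _; have := sum_ind (fun=> 1) z uP.
    under eq_bigr do rewrite mul1r; move=> ->; by case: ifP.
  rewrite big_seq [RHS]big_seq; apply: eq_bigr => w; rewrite mP => /andP[Dw _].
  by rewrite (@kwalk_rev d).
apply: (@le_trans _ _ (kwalk D s1 (fun=> q * S * 1) u)); last first.
  by rewrite (kwalkZ _ _ _ t1)// mulrAC.
apply: (kwalk_le t1) => //; first exact: adm_kwalk.
  exact: admZ.
move=> y Dy hy; rewrite mulr1.
rewrite (@kwalk_lattice d D s2 _ y P)//; last first.
  move=> z Dz hz; rewrite mP (Dz : is_true (lo <= z <= hi))/=.
  have -> : z - (u - (drift_sum s1 + drift_sum s2)) =
    (z - y + drift_sum s2) + (y - u + drift_sum s1) by ring.
  by rewrite rpredD.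
apply: (@le_trans _ _ (\sum_(w <- P) q * kwalk D s3 (ind v) w)).
  rewrite big_seq [leRHS]big_seq; apply: ler_sum => w; rewrite mP => /andP[Dw _].
  rewrite ler_wpM2r ?hq//; apply: (kwalk_ge0 D w t3); first exact: adm_ind.
  exact: ind_ge0.
by rewrite -mulr_sumr ler_wpM2l.
Qed.

Definition on A : R -> R := fun x => if A x then 1 else 0.

Lemma adm_on d A : 0 <= d -> adm d (on A).
Proof. by move=> d0; apply: adm_if; exact: adm_cst. Qed.

Lemma on_ge0 A x : 0 <= on A x. Proof. by rewrite /on; case: ifP. Qed.

(** The counterpart with prescribed zones A and B for the endpoints of the middle
    piece. *)
Lemma kwalk_three_ge d lo hi s1 s2 s3 u v q A B : 0 < d ->
  each (is_step d) s1 -> each (is_step d) s2 -> each (is_step d) s3 ->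
  let D := seg lo hi in D u -> D v -> 0 <= q ->
  v - u + drift_sum (s1 ++ s2 ++ s3) \is a Num.int ->
  (forall y w, D y -> D w -> A y -> B w -> w - y + drift_sum s2 \is a Num.int ->
    q <= kwalk D s2 (ind w) y) ->
  q * kwalk D s1 (on A) u * kwalk D (srev s3) (on B) v <=
  kwalk D (s1 ++ s2 ++ s3) (ind v) u.
Proof.
move=> d0 t1 t2 t3 D Du Dv q0; rewrite !drift_sum_cat => huv hq; rewrite !kwalk_cat.
have d0' := ltW d0.
have t3' := each_srev (@is_step_refl d) t3.
have a3 : adm d (kwalk D s3 (ind v)) by apply: adm_kwalk => //; exact: adm_ind.
have aA : adm d (on A) := adm_on A d0'.
have aB : adm d (on B) := adm_on B d0'.
have [P [uP mP]] := lattice_points (u - (drift_sum s1 + drift_sum s2)) lo hi.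
set S := kwalk D (srev s3) (on B) v.
have latP z : D z -> z - u + (drift_sum s1 + drift_sum s2) \is a Num.int -> z \in P.
  move=> Dz hz; rewrite mP (Dz : is_true (lo <= z <= hi)).
  by rewrite (_ : z - _ = z - u + (drift_sum s1 + drift_sum s2)); [rewrite hz|ring].
have sumS : S = \sum_(w <- P) kwalk D s3 (ind v) w * on B w.
  rewrite /S (@kwalk_lattice d D (srev s3) _ v P)//.
    rewrite big_seq [RHS]big_seq; apply: eq_bigr => w; rewrite mP => /andP[Dw _].
    by rewrite -(@kwalk_rev d).
  move=> z Dz; rewrite drift_sum_srev => hz; apply: latP => //.
  have -> : z - u + (drift_sum s1 + drift_sum s2) =
    (z - v - drift_sum s3) + (v - u + (drift_sum s1 + (drift_sum s2 + drift_sum s3))) by ring.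
  by rewrite rpredD.
have h3 w : 0 <= kwalk D s3 (ind v) w.
  by apply: (kwalk_ge0 D w t3); [exact: adm_ind|exact: ind_ge0].
apply: (@le_trans _ _ (kwalk D s1 (fun x => q * S * on A x) u)).
  by rewrite (kwalkZ _ _ _ t1)// mulrAC.
apply: (kwalk_le t1) => //; [exact: admZ|exact: adm_kwalk|].
move=> y Dy hy; rewrite {1}/on; case: ifP => Ay; last first.
  by rewrite mulr0; apply: (kwalk_ge0 D y t2).
rewrite mulr1 (@kwalk_lattice d D s2 _ y P)//; last first.
  move=> z Dz hz; apply: latP => //.
  have -> : z - u + (drift_sum s1 + drift_sum s2) =
    (z - y + drift_sum s2) + (y - u + drift_sum s1) by ring.
  by rewrite rpredD.
rewrite sumS mulr_sumr big_seq [leRHS]big_seq; apply: ler_sum => w.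
rewrite mP => /andP[Dw hw]; rewrite {1}/on; case: ifP => Bw; last first.
  rewrite !mulr0 mulr_ge0//; apply: (kwalk_ge0 D y t2); first exact: adm_ind.
  exact: ind_ge0.
rewrite mulr1 ler_wpM2r// hq//.
have -> : w - y + drift_sum s2 = (w - (u - (drift_sum s1 + drift_sum s2))) - (y - u + drift_sum s1).
  by ring.
by rewrite rpredB.
Qed.

End Lattice.

(** * Binomial estimates *)

Section CentralBinomial.
Context {R : realType}.

Lemma bin_central_rec k : (k.+1 * 'C(k.+1.*2, k.+1) = 2 * (k.*2.+1) * 'C(k.*2, k))%N.
Proof.
have h1 := mul_bin_diag k.*2.+2 k; have h5 := mul_bin_down k.*2.+1 k.
rewrite (_ : k.+1.*2 = k.*2.+2) ?doubleS// -h1 /=.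
have e : (k.+1 * 'C(k.*2.+1, k) = k.*2.+1 * 'C(k.*2, k))%N.
  by move: h5; rewrite (_ : k.*2.+1 - k = k.+1)%N /=; lia.
have -> : (k.*2.+2 * 'C(k.*2.+1, k) = 2 * (k.+1 * 'C(k.*2.+1, k)))%N by lia.
by rewrite e mulnA.
Qed.

(** The ratio of successive central coefficients is 2 (2k + 1) / (k + 1), to be
    compared with 4 sqrt ((2k + 1) / (2k + 3)). *)
Lemma bin_central_upper k : ('C(k.*2, k) ^ 2 * k.*2.+1 <= 16 ^ k)%N.
Proof.
elim: k => [|k ih]; first by [].
have h := bin_central_rec k.
rewrite -(leq_pmul2l (_ : 0 < k.+1 ^ 2)%N) ?expn_gt0//.
rewrite mulnA -expnMn h expnMn [(16 ^ _)%N]expnS.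
have h2 : ((2 * k.*2.+1) ^ 2 * k.+1.*2.+1 <= k.*2.+1 * (k.+1 ^ 2 * 16))%N.
  by rewrite -!muln2; nia.
rewrite mulnAC; apply: leq_trans (leq_mul h2 (leqnn ('C(k.*2, k) ^ 2))%N) _.
rewrite [leqRHS]mulnA; apply: leq_trans (leq_mul (leqnn (k.+1 ^ 2 * 16)%N) ih).
by rewrite leq_eqVlt; apply/orP; left; apply/eqP; ring.
Qed.

(** The same recursion, compared with 4 sqrt (k / (k + 1)). *)
Lemma bin_central_lower k : (0 < k)%N -> (16 ^ k <= 4 * k * 'C(k.*2, k) ^ 2)%N.
Proof.
case: k => // k _; elim: k => [|k ih]; first by [].
have h := bin_central_rec k.+1.
rewrite -(leq_pmul2l (_ : 0 < k.+2 ^ 2)%N) ?expn_gt0//.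
rewrite [leqRHS]mulnCA -expnMn h expnMn [(16 ^ _)%N]expnS.
have h2 : (k.+2 * (16 * k.+1) <= (2 * k.+1.*2.+1) ^ 2)%N.
  by rewrite -!muln2; nia.
set c := ('C(_, _) ^ 2)%N in ih *; set e := (16 ^ k.+1)%N in ih *.
rewrite [leqLHS]mulnCA [leqLHS]mulnA; apply: leq_trans (leq_mul (leqnn (16 * k.+2 ^ 2)%N) ih) _.
have -> : (16 * k.+2 ^ 2 * (4 * k.+1 * c) = 4 * k.+2 * c * (k.+2 * (16 * k.+1)))%N by ring.
by rewrite [((2 * _) ^ 2 * c)%N]mulnC [leqRHS]mulnA leq_mul2l h2 orbT.
Qed.

Lemma bin_le_central k j : ('C(k.*2, j) <= 'C(k.*2, k))%N.
Proof.
have incr i : (i <= k)%N -> ('C(k.*2, k - i) <= 'C(k.*2, k))%N.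
  elim: i => [|i ih] ik; first by rewrite subn0.
  apply: leq_trans (ih (ltnW ik)).
  have h := mul_bin_left k.*2 (k - i.+1).
  rewrite (_ : (k - i.+1).+1 = k - i)%N in h; last by lia.
  rewrite -(leq_pmul2l (_ : 0 < k - i)%N) ?h; last by lia.
  by rewrite leq_mul2r; apply/orP; right; lia.
have [jk|kj] := leqP j k.
  by have := incr (k - j)%N (leq_subr _ _); rewrite subKn.
have [j2|j2] := leqP j k.*2; last by rewrite bin_small.
rewrite -bin_sub//; have := incr (j - k)%N.
rewrite (_ : k - (j - k) = k.*2 - j)%N; last by lia.
by apply; lia.
Qed.

Definition bprob N j : R := 'C(N, j)%:R / 2 ^+ N.

Lemma bprob_ge0 N j : 0 <= bprob N j.
Proof. by rewrite divr_ge0 ?ler0n ?exprn_ge0. Qed.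

Lemma bprobSr N j : bprob N.+1 j.+1 = (bprob N j.+1 + bprob N j) / 2.
Proof. by rewrite /bprob binS natrD exprS; field; rewrite ?expf_neq0 ?pnatr_eq0. Qed.

Lemma bprobS0 N : bprob N.+1 0 = bprob N 0 / 2.
Proof. by rewrite /bprob !bin0 exprS; field; rewrite ?expf_neq0 ?pnatr_eq0. Qed.

Lemma bprob_sym N j : (j <= N)%N -> bprob N (N - j) = bprob N j.
Proof. by move=> jN; rewrite /bprob bin_sub. Qed.

Lemma exp16 k : (16 : R) ^+ k = (2 ^+ k.*2) ^+ 2.
Proof. by rewrite (_ : 16 = 2 ^+ 4) -?natrX// !natrX -!exprM; congr (_ ^+ _); lia. Qed.

Lemma bprob_sqr_even k j : bprob k.*2 j ^+ 2 * (k.*2.+1)%:R <= 1.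
Proof.
have := bin_central_upper k; rewrite -(ler_nat R) natrM !natrX exp16 => h.
have h2 : 'C(k.*2, j)%:R ^+ 2 <= 'C(k.*2, k)%:R ^+ 2 :> R.
  by rewrite ler_sqr ?nnegrE ?ler0n// ler_nat bin_le_central.
have p0 : 0 < (2 : R) ^+ k.*2 by rewrite exprn_gt0.
rewrite /bprob expr_div_n mulrAC ler_pdivrMr ?exprn_gt0// mul1r.
by apply: le_trans h; rewrite ler_wpM2r.
Qed.

Lemma bprob_sqr N j : bprob N j ^+ 2 * N%:R <= 1.
Proof.
have [k [e|e]] : exists k, N = k.*2 \/ N = k.*2.+1.
  by exists N./2; have := odd_double_half N; case: (odd N) => /=; lia.
  have := bprob_sqr_even k j; rewrite e -natr1 mulrDr mulr1.
  by have := sqr_ge0 (bprob k.*2 j); lra.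
rewrite e; case: j => [|j].
  rewrite bprobS0 expr_div_n; have := bprob_sqr_even k 0.
  set b := _ ^+ 2; set n := _%:R => h; have : 0 <= b * n by rewrite mulr_ge0 ?sqr_ge0 ?ler0n.
  by lra.
rewrite bprobSr expr_div_n; have := bprob_sqr_even k j; have := bprob_sqr_even k j.+1.
set b := bprob _ _; set c := bprob _ _; set n := _%:R => h1 h2.
have : 0 <= (b - c) ^+ 2 * n by rewrite mulr_ge0 ?sqr_ge0 ?ler0n.
by lra.
Qed.

(** Moving away from the centre by at most I, each ratio of successive
    coefficients is at least 1 - 2 I / k. *)
Lemma bprob_off_center k i I : (i <= I)%N -> (I * 2 < k)%N ->
  bprob k.*2 k * (1 - (I * 2)%:R / k%:R) ^+ i <= bprob k.*2 (k + i).
Proof.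
move=> + Ik; elim: i => [|i ih] iI; first by rewrite expr0 mulr1 addn0.
have k0 : 0 < k%:R :> R by rewrite ltr0n; lia.
rewrite exprSr mulrA addnS.
set r := 1 - _; have r0 : 0 <= r.
  by rewrite subr_ge0 ler_pdivrMr// mul1r ler_nat ltnW.
apply: le_trans (ler_wpM2r r0 (ih (ltnW iI))) _.
have h := mul_bin_left k.*2 (k + i); rewrite (_ : k.*2 - (k + i) = k - i)%N in h; last by lia.
have hR : ((k + i).+1)%:R * 'C(k.*2, (k + i).+1)%:R = (k - i)%:R * 'C(k.*2, k + i)%:R :> R.
  by rewrite -!natrM h.
have s0 : 0 < ((k + i).+1)%:R :> R by rewrite ltr0n.
have p0 : 0 < (2 : R) ^+ k.*2 by rewrite exprn_gt0.
rewrite /bprob mulrAC ler_pM2r ?invr_gt0//.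
rewrite -(ler_pM2l s0) hR mulrCA [leRHS]mulrC ler_wpM2l ?ler0n//.
have zk : (I * 2)%:R / k%:R * k%:R = (I * 2)%:R :> R by rewrite divfK ?gt_eqF.
have z0 : 0 <= (I * 2)%:R / k%:R :> R by pos.
have i0 : 0 <= i%:R :> R by rewrite ler0n.
have iI2 : i%:R + i%:R + 1 <= (I * 2)%:R :> R.
  by rewrite -natrD natr1 ler_nat; lia.
rewrite natrB; last by lia.
rewrite /r -natr1 natrD; move: zk z0; set zz := _ / _; set I2 : R := (I * 2)%:R in iI2 *.
move=> zk z0; nra.
Qed.

(** In a range A sqrt k around the centre the ratios of [bprob_off_center] multiply
    to at least exp (- 4 A^2). *)
Lemma bprob_even_lower (A : R) : 0 < A -> exists c k0, [/\ 0 < c, (0 < k0)%N &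
  forall k i, (k0 <= k)%N -> i%:R <= A * Num.sqrt k%:R ->
    c / Num.sqrt k%:R <= bprob k.*2 (k + i)].
Proof.
move=> A0; exists (expR (- (4 * A ^+ 2)) / 2), (Num.truncn (16 * A ^+ 2 + 1)).+1.
split=> //; first by pos.
move=> k i kK hi.
have k0 : (0 < k)%N by apply: leq_trans kK.
have kR : 0 < k%:R :> R by rewrite ltr0n.
have kA : 16 * A ^+ 2 < k%:R.
  have : 16 * A ^+ 2 + 1 < k%:R by apply: lt_le_trans (truncnS_gt _) _; rewrite ler_nat.
  by lra.
set s := Num.sqrt k%:R in hi *.
have s0 : 0 < s by rewrite sqrtr_gt0.
have ss : s ^+ 2 = k%:R by rewrite sqr_sqrtr ?ler0n.
have sA : 4 * A < s.
  rewrite -(ltr_pXn2r (_ : 0 < 2)%N) ?nnegrE//; [|pos|exact: ltW].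
  by rewrite ss exprMn; lra.
have i0 : 0 <= i%:R :> R by rewrite ler0n.
have ik4 : i%:R * 4 < k%:R :> R by rewrite -ss; nra.
have ik : (i * 2 < k)%N by move: ik4; rewrite -natrM ltr_nat; lia.
apply: le_trans (bprob_off_center (leqnn i) ik).
have hc : (2 * s)^-1 <= bprob k.*2 k.
  have := bin_central_lower k0; rewrite -(ler_nat R) natrM !natrX exp16 natrM -ss.
  set b : R := 'C(_, _)%:R; set P := 2 ^+ k.*2 => h.
  have P0 : 0 < P by rewrite exprn_gt0.
  have : P <= 2 * s * b.
    rewrite -(ler_pXn2r (_ : 0 < 2)%N) ?nnegrE//; [|exact: ltW|by rewrite /b; pos].
    by rewrite !exprMn; lra.
  by move=> h2; rewrite /bprob -/b -/P ler_pdivlMr// mulrC ler_pdivrMr ?mulr_gt0//; lra.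
have hr : expR (- (4 * A ^+ 2)) <= (1 - (i * 2)%:R / k%:R) ^+ i.
  set y : R := (i * 2)%:R / k%:R.
  have y0 : 0 <= y by rewrite /y; pos.
  have y2 : y <= 1 / 2 by rewrite /y natrM ler_pdivrMr//; lra.
  have h1 : expR (- (2 * y)) <= 1 - y.
    have := expR_ge1Dx (2 * y); rewrite expRN => h.
    rewrite -[leRHS]invrK lef_pV2 ?posrE ?invr_gt0 ?expR_gt0//; last by lra.
    apply: le_trans h; rewrite -[leLHS]mul1r ler_pdivrMr; last by lra.
    by nra.
  have h2 : expR (- (2 * y)) ^+ i <= (1 - y) ^+ i.
    by rewrite lerXn2r ?nnegrE ?expR_ge0//; lra.
  apply: le_trans h2; rewrite -expRM_natl ler_expR -mulr_natl /y natrM.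
  have h3 : i%:R * (2 * (i%:R * 2 / s ^+ 2)) = 4 * (i%:R / s) ^+ 2 :> R.
    by field; rewrite gt_eqF.
  have h4 : (i%:R / s) ^+ 2 <= A ^+ 2.
    rewrite ler_sqr ?nnegrE; [|by pos|exact: ltW].
    by rewrite ler_pdivrMr.
  by rewrite -ss mulrN h3; lra.
have -> : expR (- (4 * A ^+ 2)) / 2 / s = (2 * s)^-1 * expR (- (4 * A ^+ 2)).
  by field; rewrite gt_eqF.
by apply: ler_pM => //; pos.
Qed.

End CentralBinomial.

(** * Extracting fair coins from blocks of steps *)

Section LocalLimit.
Context {R : realType}.
Implicit Types (d x y z u v : R) (p : @step R) (s b : seq (@step R)).
Implicit Types (g : R -> R) (h : nat -> R -> R) (N j q : nat).

(** The mean of g (x + B), B a binomial variable with N fair trials. *)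
Fixpoint bavg N g x : R :=
  if N is N'.+1 then (bavg N' g x + bavg N' g (x + 1)) / 2 else g x.

Lemma bavg_ge0 N g x : (forall z, 0 <= g z) -> 0 <= bavg N g x.
Proof. by move=> g0; elim: N x => [|N ih] x //=; rewrite divr_ge0 ?addr_ge0. Qed.

Lemma bavg_le1 N g x : (forall z, g z <= 1) -> bavg N g x <= 1.
Proof.
move=> g0; elim: N x => [|N ih] x //=.
by have := ih x; have := ih (x + 1); lra.
Qed.

Lemma bavg_term N j g x : (forall z, 0 <= g z) ->
  bprob N j * g (x + j%:R) <= bavg N g x.
Proof.
move=> g0; elim: N j x => [|N ih] [|j] x /=.
- by rewrite /bprob bin0 expr0 invr1 !mul1r addr0.
- by rewrite /bprob bin0n mul0r mul0r.
- rewrite bprobS0; have := ih 0%N x; have := bavg_ge0 N (x + 1) g0.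
  by set b := bprob _ _; lra.
- rewrite bprobSr; have := ih j.+1 x; have := ih j (x + 1).
  rewrite -natr1 -!addrA [1 + j%:R]addrC.
  by set b := bprob _ _; set c := bprob _ _; set G := g _; lra.
Qed.

Lemma bavg_ind_out N x y : (forall j, y - x != j%:R) -> bavg N (ind y) x = 0.
Proof.
elim: N x => [|N ih] x hx /=.
  rewrite /ind; case: eqVneq => // e; have := hx 0%N.
  by rewrite e subrr eqxx.
rewrite ih// ih ?addr0 ?mul0r// => j; have := hx j.+1.
by apply: contraNneq => e; rewrite -natr1 -e; apply/eqP; ring.
Qed.

Lemma bavg_ind_in N j x y : y - x = j%:R -> bavg N (ind y) x = bprob N j.
Proof.
elim: N j x => [|N ih] [|j] x e /=.
- rewrite /ind (_ : x = y) ?eqxx ?/bprob ?bin0 ?expr0 ?invr1 ?mul1r//; lra.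
- rewrite /ind /bprob bin0n mul0r; case: eqVneq => // xy.
  by move: e; rewrite xy subrr => /esym/eqP; rewrite pnatr_eq0.
- rewrite bprobS0 (ih 0%N)// bavg_ind_out ?addr0// => j.
  apply/negP => /eqP e2; have : (j.+1)%:R = 0 :> R by rewrite -natr1; move: e e2; lra.
  by move/eqP; rewrite pnatr_eq0.
- rewrite bprobSr (ih j.+1 x)// (ih j (x + 1))//.
  by move: e; rewrite -natr1; lra.
Qed.

Lemma bavg_ind_le N x y (K : R) : 0 < K -> K <= N%:R ->
  bavg N (ind y) x <= (Num.sqrt K)^-1.
Proof.
move=> K0 KN; have s0 : 0 < Num.sqrt K by rewrite sqrtr_gt0.
have [[j e]|h] := pselect (exists j, y - x = j%:R); last first.
  rewrite bavg_ind_out ?invr_ge0 ?ltW// => j; apply/eqP => e; apply: h; by exists j.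
rewrite (bavg_ind_in _ e) -[leRHS]mul1r ler_pdivlMr//.
have := bprob_sqr (R := R) N j; have b0 := bprob_ge0 (R := R) N j => h.
rewrite -(ler_pXn2r (_ : 0 < 2)%N) ?nnegrE//; last by pos.
rewrite exprMn sqr_sqrtr ?(ltW K0)// expr1n; apply: le_trans h.
by rewrite ler_wpM2l ?sqr_ge0.
Qed.

Lemma adm_bavg d N g : 0 <= d -> adm d g -> adm d (bavg N g).
Proof.
move=> d0 hg; elim: N => [//|N ih].
apply: (@adm_le _ _ _ (fun x => 2^-1 * (bavg N g x + bavg N g (1 + x)))).
  by move=> x /=; rewrite mulrC [1 + x]addrC.
by apply/admZ/admD => //; exact: (adm_shift 1 d0 ih).
Qed.

Lemma kwalk_shift s g c x :
  kwalk predT s (fun z => g (z + c)) x = kwalk predT s g (x + c).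
Proof.
elim: s x => //= p s ih x; congr (p.1 _); apply/funext => t.
by rewrite ih addrAC.
Qed.

Lemma kwalk_bavg d s N g x : 0 <= d -> each (is_step d) s -> adm d g ->
  kwalk predT s (bavg N g) x = bavg N (kwalk predT s g) x.
Proof.
move=> d0 ss hg; elim: N x => [//|N ih] x; rewrite [RHS]/=.
rewrite (_ : bavg N.+1 g = fun z => 2^-1 * (bavg N g z + bavg N g (z + 1))); last first.
  by apply/funext => z /=; rewrite mulrC.
have ab := adm_bavg N d0 hg.
have ab' : adm d (fun z => bavg N g (z + 1)).
  apply: (@adm_le _ _ _ (fun z => bavg N g (1 + z))) => [z|]; first by rewrite addrC.
  exact: (adm_shift 1 d0 ab).
rewrite (kwalkZ _ _ _ ss); last exact: admD.
by rewrite (kwalkD _ _ ss)// (kwalk_shift s (bavg N g) 1 x) !ih mulrC.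
Qed.

(** The sum of the block b dominates a multiple of a fair coin with values 0
    and 1 (shifted by the total mean). *)
Definition spread (d kap : R) b : Prop := each (is_step d) b /\
  forall g x, adm d g -> (forall z, 0 <= g z) ->
  kap * (g (x - drift_sum b) + g (x - drift_sum b + 1)) <= kwalk predT b g x.

(** Write the operator of a block as 2 kap (fair coin) + remainder.  The
    operator [tw] records in the counter N how many blocks have used their coin
    and postpones the coin itself: with h N = bavg N g the postponed coins are
    all tossed at the end and the free walk is recovered ([tw_bavg]), while
    for other h one gets a positive operator ([tw_le]) acting on functions of
    the pair (counter, position). *)
Fixpoint tw (kap : R) (bs : seq (seq (@step R))) h : nat -> R -> R :=
  if bs is b :: bs' then fun N x =>
    2 * kap * tw kap bs' h N.+1 (x - drift_sum b) + kwalk predT b (tw kap bs' h N) x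
    - kap * (tw kap bs' h N (x - drift_sum b) + tw kap bs' h N (x - drift_sum b + 1))
  else h.

(** A binomial with N + 1 trials is one coin followed by N more, so the postponed
    coin restores the part of the block operator that was taken out. *)
Lemma tw_bavg d kap bs g N x : 0 <= d -> each (spread d kap) bs -> adm d g ->
  tw kap bs (fun N => bavg N g) N x = bavg N (kwalk predT (flatten bs) g) x.
Proof.
move=> d0; elim: bs N x => [//|b bs ih] N x /= [[tb gb] gbs] hg.
have sb : each (is_step d) (flatten bs).
  elim: bs {ih} gbs => //= b' bs' ih' [[tb' _] /ih' ?]; apply/each_cat; by split.
rewrite !ih//.
rewrite (_ : tw kap bs (fun N0 => bavg N0 g) N = bavg N (kwalk predT (flatten bs) g)); last first.
  by apply/funext => z; rewrite ih.
rewrite (kwalk_bavg _ _ d0 tb); last exact: adm_kwalk.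
rewrite kwalk_cat /=; set A := bavg N _ _; set B := bavg N _ _; lra.
Qed.

Lemma adm_tw d kap bs h N : 0 <= d -> each (spread d kap) bs ->
  (forall N, adm d (h N)) -> adm d (tw kap bs h N).
Proof.
move=> d0 + hh; elim: bs N => [|b bs ih] N; first by move=> _; exact: hh.
move=> /= [[tb gb] gbs].
have sh M c : adm d (fun x => tw kap bs h M (x + c)).
  apply: (@adm_le _ _ _ (fun x => tw kap bs h M (c + x))) => [x|]; first by rewrite addrC.
  exact: (adm_shift c d0 (ih M gbs)).
apply: admB; last first.
  apply/admZ/admD; first exact: sh.
  apply: (@adm_le _ _ _ (fun x => tw kap bs h N (x + (- drift_sum b + 1)))) => //.
  by move=> x; rewrite addrA.
by apply: admD; [exact/admZ/sh|apply: adm_kwalk => //; exact: ih].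
Qed.

(** The remainder is a positive operator, by [spread]. *)
Lemma tw_le d kap bs h h' N x : 0 <= d -> 0 <= kap -> each (spread d kap) bs ->
  (forall N, adm d (h N)) -> (forall N, adm d (h' N)) ->
  (forall N x, h N x <= h' N x) -> tw kap bs h N x <= tw kap bs h' N x.
Proof.
move=> d0 k0 + ah ah' hh; elim: bs N x => [|b bs ih] N x /=; first by [].
move=> [[tb gb] gbs].
have a1 := adm_tw N d0 gbs ah; have a2 := adm_tw N d0 gbs ah'.
have := gb (fun z => tw kap bs h' N z - tw kap bs h N z) x (admB a2 a1).
rewrite (kwalkB _ _ tb)// => /(_ (fun z => _)) => H.
have {}H := H ltac:(by move=> z; rewrite subr_ge0; exact: ih).
have := ler_wpM2l (mulr_ge0 (ler0n R 2) k0) (ih N.+1 (x - drift_sum b) gbs).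
by lra.
Qed.

Lemma tw_opp d kap bs h N x : 0 <= d -> each (spread d kap) bs ->
  (forall N, adm d (h N)) -> tw kap bs (fun N x => - h N x) N x = - tw kap bs h N x.
Proof.
move=> d0 + ah; elim: bs N x => [|b bs ih] N x /=; first by [].
move=> [[tb gb] gbs]; rewrite !ih//.
rewrite (_ : tw kap bs (fun N x => - h N x) N = fun z => (-1) * tw kap bs h N z); last first.
  by apply/funext => z; rewrite ih// mulN1r.
by rewrite (kwalkZ _ _ _ tb); [lra|exact: adm_tw].
Qed.

(** Test functions for Chebyshev's inequality: the counter should be near n0,
    and x + N / 2, which is the position once the postponed coins are replaced
    by their mean, near y. *)
Definition quad (a be ga n0 y : R) N x : R :=
  a - be * (N%:R - n0) ^+ 2 - ga * (x + N%:R / 2 - y) ^+ 2.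

Lemma adm_quad d a be ga n0 y N : 0 < d -> adm d (quad a be ga n0 y N).
Proof.
move=> d0; apply: admB; first exact/adm_cst/ltW.
apply: admZ; apply: (@adm_le _ _ _ (fun x => (N%:R / 2 - y + x) ^+ 2)).
  by move=> x; rewrite [x + _]addrC addrAC.
exact: (adm_shift (N%:R / 2 - y) (ltW d0) (adm_sqr d0)).
Qed.

(** Both squares grow by a bounded amount per block: the counter because its
    increments are bounded, the compensated position because the block has
    bounded variance.  Replacing a coin by its mean only decreases the second
    square. *)
Lemma tw_quad d kap bs a be ga n0 y V N x : 0 < d -> 0 <= kap -> 0 <= be -> 0 <= ga ->
  each (spread d kap) bs ->
  each (fun b => forall w z, ga * kwalk predT b (fun z => (z - w) ^+ 2) z <=
     ga * ((z - w) ^+ 2 + V)) bs ->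
  quad (a - (be + ga * V) * (size bs)%:R) be ga (n0 - 2 * kap * (size bs)%:R) y N x
  <= tw kap bs (quad a be ga n0 y) N x.
Proof.
move=> d0 k0 be0 ga0; elim: bs N x => [|b bs ih] N x /=.
  by move=> _ _; rewrite !mulr0 !subr0.
move=> [sb gbs] [qb qbs]; have [tb gb] := sb.
have d0' := ltW d0.
set a' := a - (be + ga * V) * (size bs)%:R.
set n0' := n0 - 2 * kap * (size bs)%:R.
set h := quad a' be ga n0' y.
have := @tw_le d kap [:: b] h (tw kap bs (quad a be ga n0 y)) N x d0' k0 (conj sb I).
move=> /(_ (fun N => adm_quad a' be ga n0' y N d0)).
move=> /(_ (fun N => adm_tw N d0' gbs (fun N => adm_quad a be ga n0 y N d0))).
move=> /(_ (fun N x => ih N x gbs qbs)) /=; apply: le_trans.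
have -> : kwalk predT b (h N) x = a' - be * (N%:R - n0') ^+ 2 -
    ga * kwalk predT b (fun z => (z - (y - N%:R / 2)) ^+ 2) x.
  have aq : adm d (fun z : R => (z - (y - N%:R / 2)) ^+ 2).
    apply: (@adm_le _ _ _ (fun x => (- (y - N%:R / 2) + x) ^+ 2)).
      by move=> z; rewrite addrC.
    exact: (adm_shift _ d0' (adm_sqr d0)).
  rewrite -(kwalkZ _ _ _ tb)// -[X in X - _](@kwalk_cst _ d b _ x d0' tb) -(kwalkB _ _ tb).
  - congr (kwalk predT b _ x); apply/funext => z.
    by rewrite /h /quad; congr (_ - ga * _ ^+ 2); ring.
  - exact: adm_cst.
  - exact: admZ.
have := qb (y - N%:R / 2) x.
set Q := kwalk predT b _ x; rewrite /h /quad -(natr1 N) -(natr1 (size bs)).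
set m := drift_sum b; set nn : R := N%:R; set L : R := (size bs)%:R => hq.
have -> : a - (be + ga * V) * (L + 1) = a' - be - ga * V by rewrite /a' -/L; ring.
have -> : nn - (n0 - 2 * kap * (L + 1)) = nn - n0' + 2 * kap by rewrite /n0' -/L; ring.
set D := nn - n0'.
have -> : nn + 1 - n0' = D + 1 by rewrite /D; ring.
set X := x + nn / 2 - y; set Y := x - m + nn / 2 - y.
have -> : x - m + (nn + 1) / 2 - y = Y + 1 / 2 by rewrite /Y; ring.
have -> : x - m + 1 + nn / 2 - y = Y + 1 by rewrite /Y; ring.
have eX : x - (y - nn / 2) = X by rewrite /X; ring.
rewrite eX in hq.
have k1 : 0 <= kap * ga by rewrite mulr_ge0.
have k2 : 0 <= be * (4 * kap ^+ 2 - 2 * kap + 1).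
  by rewrite mulr_ge0//; have := sqr_ge0 (2 * kap - 1 / 2); lra.
clearbody X Y D Q a'.
by lra.
Qed.

Lemma kwalk_ind_le1 d (D : R -> bool) s x y : 0 < d -> each (is_step d) s -> D x ->
  kwalk D s (ind y) x <= 1.
Proof.
move=> d0 ss Dx; apply: le_trans (kwalk_le1 (ltW d0) ss Dx).
apply: (kwalk_le ss) => //; [exact/adm_ind/ltW|exact/adm_cst/ltW|].
by move=> z _ _; rewrite /ind lern1 leq_b1.
Qed.

(** Half of the expected number 2 kap q of coins is enough to bound the binomial
    masses; the second term bounds the probability of having fewer. *)
Lemma spread_upper d kap bs x y : 0 < d -> 0 < kap -> (0 < size bs)%N ->
  each (spread d kap) bs ->
  kwalk predT (flatten bs) (ind y) x <=
    (Num.sqrt kap)^-1 / Num.sqrt (size bs)%:R + (kap ^+ 2 * (size bs)%:R)^-1.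
Proof.
move=> d0 k0 q0 gbs; set q : R := (size bs)%:R; have qR : 0 < q by rewrite ltr0n.
have d0' := ltW d0; have kq : 0 < kap * q by rewrite mulr_gt0.
(* a bounds the binomial masses with at least kap q trials; be makes the
   penalty 1 for fewer trials *)
pose a := (Num.sqrt (kap * q))^-1; pose be := ((kap * q) ^+ 2)^-1.
have ai : adm d (ind y) := adm_ind y d0'.
have := tw_bavg 0 x d0' gbs ai; rewrite /= => <-.
have an0 N : adm d (bavg N (ind y)) by exact: adm_bavg.
have := @tw_le d kap bs (quad (- a) be 0 (2 * kap * q) 0) (fun N x => - bavg N (ind y) x) 0 x
   d0' (ltW k0) gbs (fun N => adm_quad _ _ _ _ _ N d0).
move=> /(_ (fun N => _)) H.
have {}H := H ltac:(by move=> N; apply: (@adm_le _ _ _ (bavg N (ind y))) => // z; rewrite normrN).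
have {H} : tw kap bs (quad (- a) be 0 (2 * kap * q) 0) 0 x <= - tw kap bs (fun N => bavg N (ind y)) 0 x.
  rewrite -(tw_opp _ _ d0' gbs)//; apply: H => N z.
  rewrite /quad mul0r subr0 lerNr opprB opprK.
  have [h|h] := boolP (kap * q <= N%:R).
    apply: le_trans (bavg_ind_le z y kq h) _; rewrite lerDr; rewrite /be; pos.
  rewrite -ltNge in h; apply: (@le_trans _ _ 1).
    by apply: bavg_le1 => w; rewrite /ind lern1 leq_b1.
  have : 1 <= be * (N%:R - 2 * kap * q) ^+ 2.
    rewrite /be mulrC ler_pdivlMr ?exprn_gt0// mul1r -[leRHS]sqrrN.
    rewrite ler_pXn2r ?nnegrE//; [|exact: ltW|]; lra.
  by have : 0 < a by [rewrite invr_gt0 sqrtr_gt0]; lra.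
have h2 := @tw_quad d kap bs (- a) be 0 (2 * kap * q) 0 0 0 x d0 (ltW k0) _ (lexx _) gbs.
have be0 : 0 <= be by rewrite /be; pos.
have triv : each (fun b => forall w z, 0 * kwalk predT b (fun z => (z - w) ^+ 2) z <=
     0 * ((z - w) ^+ 2 + 0)) bs.
  by apply: each_imp gbs => b _ w z; rewrite !mul0r.
have {}h2 := h2 be0 triv.
move=> h3; have {h2 h3} := le_trans h2 h3.
rewrite /quad -/q mul0r addr0 subrr subr0 expr0n /= mulr0 mul0r !subr0 lerNr opprB opprK.
move/le_trans; apply; rewrite addrC le_eqVlt; apply/orP; left; apply/eqP.
rewrite /a /be sqrtrM ?(ltW k0)// invfM; congr (_ + _); field.
by rewrite !gt_eqF.
Qed.

End LocalLimit.

(** * Local limit theorem: upper bound *)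

Section LocalLimitTheorems.
Context {R : realType}.
Implicit Types (d C kap x y z u v : R) (p : @step R) (s b : seq (@step R)).
Implicit Types (g : R -> R) (h : nat -> R -> R) (N j q k : nat) (js xs ys : seq int).

Lemma sqrt_nat_le m n (l : R) : 0 <= l -> m%:R <= l * n%:R ->
  Num.sqrt m%:R <= Num.sqrt l * Num.sqrt n%:R.
Proof. by move=> l0 h; rewrite -sqrtrM// ler_wsqrtr. Qed.

(** The central estimate for an arbitrary number of trials between kap q and
    2 q, reduced to an even number of trials by [bprobSr]. *)
Lemma bin_window (A kap : R) : 0 < A -> 0 < kap -> exists c q0, 0 < c /\
  forall q N j, (q0 <= q)%N -> kap * q%:R <= N%:R -> (N <= 2 * q)%N ->
    `|j%:R - N%:R / 2| <= A * Num.sqrt q%:R + 1 / 2 ->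
    c / Num.sqrt q%:R <= bprob N j :> R.
Proof.
move=> A0 kap0; pose A' := A * Num.sqrt (4 / kap) + 1.
have A'0 : 0 < A' by rewrite /A'; pos.
have [c [k0 [c0 k00 hc]]] := bprob_even_lower A'0.
exists (c / 2), (Num.truncn (4 * (k0%:R + 1) / kap)).+1; split; first by pos.
move=> q N j hq hN N2 hj.
have qk : 4 * (k0%:R + 1) < kap * q%:R.
  rewrite [kap * _]mulrC -ltr_pdivrMr//; apply: lt_le_trans (truncnS_gt _) _.
  by rewrite ler_nat.
set k := N./2; have oN := odd_double_half N; rewrite -/k in oN.
have Nk : N%:R <= 2 * k%:R + 1 :> R.
  by rewrite -natrM natr1 ler_nat -[leqLHS]oN mul2n; case: (odd N) => /=; rewrite ?add0n ?add1n.
have Nk' : 2 * k%:R <= N%:R :> R by rewrite -natrM ler_nat -[leqRHS]oN mul2n leq_addl.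
have k1 : 1 <= k0%:R :> R by rewrite ler1n.
have kk : k0%:R + 1 <= k%:R :> R by lra.
have kk0 : (k0 <= k)%N by rewrite -(ler_nat R); lra.
have k4 : q%:R <= 4 / kap * k%:R by rewrite mulrAC ler_pdivlMr//; lra.
have sk : Num.sqrt q%:R <= Num.sqrt (4 / kap) * Num.sqrt k%:R.
  by apply: sqrt_nat_le => //; pos.
have kq : (k <= q)%N.
  by move: N2; rewrite -!(ler_nat R) natrM; lra.
have kp : 0 < k%:R :> R by lra.
have qp : 0 < q%:R :> R by apply: lt_le_trans kp _; rewrite ler_nat.
have sk1 : 1 <= Num.sqrt k%:R :> R.
  by rewrite -{1}sqrtr1 ler_wsqrtr//; lra.
have hjk : `|j%:R - k%:R| <= A' * Num.sqrt k%:R :> R.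
  apply: (@le_trans _ _ (A * Num.sqrt q%:R + 1)).
    move: hj; rewrite !ler_norml => /andP[h1 h2]; apply/andP; split; lra.
  rewrite /A' mulrDl mul1r lerD//; rewrite -mulrA ler_wpM2l//; exact: ltW.
have even : c / Num.sqrt q%:R <= bprob k.*2 j :> R.
  apply: (@le_trans _ _ (c / Num.sqrt k%:R)).
    rewrite ler_pM2l// lef_pV2 ?posrE ?sqrtr_gt0// ler_wsqrtr// ler_nat//.
  have [jk|kj] := leqP k j.
    have := hc k (j - k)%N kk0; rewrite subnKC//; apply.
    by rewrite natrB//; apply: le_trans hjk; exact: ler_norm.
  have := hc k (k - j)%N kk0; rewrite natrB ?(ltnW kj)//.
  rewrite -(@bprob_sym _ k.*2 j); last by rewrite -addnn (leq_trans (ltnW kj))// leq_addr.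
  rewrite (_ : k + (k - j) = k.*2 - j)%N; last by rewrite -addnn addnBA// ltnW.
  by apply; apply: le_trans hjk; rewrite -normrN opprB ler_norm.
have s0 : 0 < Num.sqrt q%:R :> R by rewrite sqrtr_gt0.
rewrite mulrAC; move: oN; case: (odd N) => oN.
  rewrite -oN; apply: (@le_trans _ _ (bprob k.*2 j / 2)); first by lra.
  case: j {hj hjk even} => [|j]; first by rewrite bprobS0.
  by rewrite bprobSr; have := bprob_ge0 (R := R) k.*2 j; lra.
by rewrite -oN add0n; have : 0 <= c / Num.sqrt q%:R by [pos]; lra.
Qed.

(** On a coset of Z through y this window contains y only; unlike [ind], its
    binomial mean has a lower bound for every x. *)
Definition win y : R -> R := fun x => ((y - 1 / 2 < x) && (x <= y + 1 / 2))%:R.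

Lemma win_ge0 y x : 0 <= win y x. Proof. exact: ler0n. Qed.

Lemma adm_win d y : 0 <= d -> adm d (win y).
Proof.
move=> d0; apply: (@adm_bounded _ _ _ 1) => // x.
by rewrite /win ger0_norm ?ler0n// lern1 leq_b1.
Qed.

(** If N or x + N / 2 is far from its target then [quad] is nonpositive.
    Otherwise the window is hit by the term of the binomial sum whose index is
    the integer nearest to y - x, within O(sqrt q) of N / 2. *)
Lemma bavg_win (A kap : R) : 0 < A -> 0 < kap -> kap <= 1 / 2 -> exists c q0, 0 < c /\
  forall q N x y a, (q0 <= q)%N -> (0 < q)%N -> a = c / Num.sqrt q%:R ->
  quad a (a / (kap * q%:R) ^+ 2) (a / (A ^+ 2 * q%:R)) (2 * kap * q%:R) y N x
    <= bavg N (win y) x.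
Proof.
move=> A0 k0 k2; have [c [q0 [c0 hc]]] := bin_window A0 k0.
exists c, (maxn q0 (Num.truncn (4 * A ^+ 2 / kap ^+ 2)).+1); split=> // q N x y a.
rewrite geq_max => /andP[hq hq'] q1 ea.
have qp : 0 < q%:R :> R by rewrite ltr0n.
set s := Num.sqrt q%:R in ea *.
have s0 : 0 < s by rewrite sqrtr_gt0.
have ss : s ^+ 2 = q%:R by rewrite sqr_sqrtr ?ler0n.
have a0 : 0 < a by rewrite ea; pos.
have b0 : 0 <= bavg N (win y) x by apply: bavg_ge0; exact: win_ge0.
have n1 : 0 <= (N%:R - 2 * kap * q%:R) ^+ 2 :> R by exact: sqr_ge0.
have n2 : 0 <= (x + N%:R / 2 - y) ^+ 2 by exact: sqr_ge0.
set P := (kap * q%:R) ^+ 2; set Q := A ^+ 2 * q%:R.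
have P0 : 0 < P by rewrite /P; pos.
have Q0 : 0 < Q by rewrite /Q; pos.
have [h1|h1] := leP P ((N%:R - 2 * kap * q%:R) ^+ 2).
  apply: le_trans b0; rewrite /quad.
  have : a <= a / P * (N%:R - 2 * kap * q%:R) ^+ 2.
    by rewrite mulrAC ler_pdivlMr// ler_pM2l.
  have : 0 <= a / Q * (x + N%:R / 2 - y) ^+ 2 by pos.
  by lra.
have [h2|h2] := leP Q ((x + N%:R / 2 - y) ^+ 2).
  apply: le_trans b0; rewrite /quad.
  have : a <= a / Q * (x + N%:R / 2 - y) ^+ 2.
    by rewrite mulrAC ler_pdivlMr// ler_pM2l.
  have : 0 <= a / P * (N%:R - 2 * kap * q%:R) ^+ 2 by pos.
  by lra.
apply: (@le_trans _ _ a).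
  rewrite /quad; have : 0 <= a / P * (N%:R - 2 * kap * q%:R) ^+ 2 by pos.
  have : 0 <= a / Q * (x + N%:R / 2 - y) ^+ 2 by pos.
  by lra.
have kq0 : 0 < kap * q%:R by pos.
have {}h1 : `|N%:R - 2 * kap * q%:R| < kap * q%:R.
  by rewrite -(ltr_pXn2r (_ : 0 < 2)%N) ?nnegrE ?(ltW kq0)// real_normK ?num_real.
have {}h2 : `|x + N%:R / 2 - y| < A * s.
  rewrite -(ltr_pXn2r (_ : 0 < 2)%N) ?nnegrE//; last by pos.
  by rewrite real_normK ?num_real// exprMn ss.
move: h1 h2; rewrite !ltr_norml => /andP[h1 h1'] /andP[h2 h2'].
have big : 2 * A * s < kap * q%:R.
  have : 4 * A ^+ 2 < kap ^+ 2 * q%:R.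
    rewrite [kap ^+ 2 * _]mulrC -ltr_pdivrMr ?exprn_gt0//; apply: lt_le_trans (truncnS_gt _) _.
    by rewrite ler_nat.
  rewrite -ss => h; rewrite -(ltr_pXn2r (_ : 0 < 2)%N) ?nnegrE//; [|by pos|by pos].
  have s20 : 0 < s ^+ 2 by pos.
  by nra.
have yx : 0 <= y - x by nra.
pose j := Num.truncn (y - x + 1 / 2).
have {}j1 : j%:R <= y - x + 1 / 2 by rewrite truncn_le; lra.
have {}j2 : y - x + 1 / 2 < j%:R + 1 by rewrite natr1; exact: truncnS_gt.
apply: le_trans (bavg_term N j x (win_ge0 y)).
rewrite (_ : win y (x + j%:R) = 1) ?mulr1; last first.
  by rewrite /win (_ : _ && _ = true)//; apply/andP; split; lra.
rewrite ea; apply: hc => //; first by lra.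
  by rewrite -(ler_nat R) natrM; nra.
rewrite -/s ler_norml; apply/andP; split; lra.
Qed.

(** The list js of integers has masses at least kap. *)
Definition mass kap js p : Prop :=
  forall j : int, j \in js -> kap <= p.1 (ind (j%:~R - p.2)).

(** Prescribe the values js of the successive steps: this has probability at
    least kap^l. *)
Lemma block_mass d kap s js all g x : 0 <= kap -> size js = size s ->
  {subset js <= all} -> each (is_step d) s -> each (mass kap all) s ->
  adm d g -> (forall z, 0 <= g z) ->
  kap ^+ size s * g (x - drift_sum s + (\sum_(j <- js) j)%:~R) <= kwalk predT s g x.
Proof.
move=> k0 sz + ss ms hg g0; elim: s js x sz ss ms => [|p s ih] [|j js] x //=.
  by move=> *; rewrite expr0 mul1r /drift_sum !big_nil subr0 addr0.
move=> [sz] [sp ss] [mp ms] sub.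
have {}ih := ih js _ sz ss ms.
have d0 := step_d sp; have d0' := ltW d0.
have G0 z : 0 <= kwalk predT s g z by exact: (kwalk_ge0 predT z ss).
have aG : adm d (kwalk predT s g) by exact: adm_kwalk.
set t0 := j%:~R - p.2.
apply: (@le_trans _ _ (kwalk predT s g (x + t0) * p.1 (ind t0))); last first.
  rewrite /kstep -(exZ sp); last exact: adm_ind.
  apply: (ex_le sp) => //.
  - exact/admZ/adm_ind.
  - exact: (adm_in predT x d0' aG).
  - by move=> t _; rewrite /ind /=; case: eqVneq => [->|]; rewrite ?mulr1 ?mulr0.
have hj := mp j (sub j (mem_head _ _)).
have {}ih := ih (x + t0) (fun i ii => sub i (mem_behead (s := j :: js) ii)).
rewrite exprSr mulrAC; apply: ler_pM => //.
  by rewrite mulr_ge0 ?exprn_ge0.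
apply: le_trans ih; rewrite /drift_sum !big_cons -/(drift_sum s) rmorphD /= le_eqVlt; apply/orP; left.
by apply/eqP; congr (_ * g _); rewrite /t0; ring.
Qed.

(** The values xs lead to the mean plus 0, the values ys to the mean plus 1. *)
Lemma block_spread d kap xs ys b : 0 <= kap ->
  size xs = size b -> size ys = size b -> \sum_(j <- xs) j = 0 -> \sum_(j <- ys) j = 1 ->
  each (is_step d) b -> each (mass kap (xs ++ ys)) b ->
  spread d (kap ^+ size b / 2) b.
Proof.
move=> k0 sx sy Sx Sy tb mb; split=> // g x hg g0.
have := @block_mass d kap b xs (xs ++ ys) g x k0 sx _ tb mb hg g0.
have := @block_mass d kap b ys (xs ++ ys) g x k0 sy _ tb mb hg g0.
rewrite Sx Sy addr0 => /(_ _)h1 /(_ _)h2.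
have {}h1 := h1 ltac:(by move=> i ii; rewrite mem_cat ii orbT).
have {}h2 := h2 ltac:(by move=> i ii; rewrite mem_cat ii).
by lra.
Qed.

(** The blocks are cut from the end, which leaves the remainder r at the
    beginning. *)
Lemma block_split (T : Type) l q (s : seq T) : (q * l <= size s)%N ->
  exists r bs, [/\ s = r ++ flatten bs, size bs = q, each (fun w : seq T => size w = l) bs &
    size r = (size s - q * l)%N].
Proof.
elim: q s => [|q ih] s hs; first by exists s, [::]; rewrite /= cats0 mul0n subn0.
pose s1 := take (size s - q.+1 * l) s; pose s2 := drop (size s - q.+1 * l) s.
have [r' [bs' [er' eb' el' es']]] := ih (drop l s2) ltac:(by rewrite !size_drop subKn// mulSn addKn).
have h2 : size s2 = (q.+1 * l)%N by rewrite size_drop subKn.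
have l2 : (l <= size s2)%N by rewrite h2 mulSn leq_addr.
exists s1, (take l s2 :: bs'); split=> /=.
- have r0 : r' = [::] by apply/size0nil; rewrite es' size_drop h2 mulSn addKn subnn.
  by rewrite -{1}(cat_take_drop (size s - q.+1 * l) s) -/s1 -/s2 -{1}(cat_take_drop l s2) er' r0.
- by rewrite eb'.
- by split=> //; rewrite size_takel.
- by rewrite size_takel// leq_subr.
Qed.

Lemma each_flatten (T : Type) (Q : T -> Prop) bs : each Q (flatten bs) -> each (each Q) bs.
Proof. by elim: bs => //= w ws ih /each_cat[? /ih]. Qed.

Lemma blocks_spread d kap xs ys l bs : 0 <= kap ->
  size xs = l -> size ys = l -> \sum_(j <- xs) j = 0 -> \sum_(j <- ys) j = 1 ->
  each (fun b => size b = l) bs ->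
  each (is_step d) (flatten bs) -> each (mass kap (xs ++ ys)) (flatten bs) ->
  each (spread d (kap ^+ l / 2)) bs.
Proof.
move=> k0 sx sy Sx Sy + /each_flatten + /each_flatten.
elim: bs => //= b bs ih [eb hb] [tb tbs] [mb mbs]; split; last exact: ih.
by rewrite -eb; exact: (block_spread k0 (etrans sx (esym eb)) (etrans sy (esym eb)) Sx Sy tb mb).
Qed.

(** The steps are grouped into blocks of length l, and the walk conditioned on its
    remainder is bounded by [spread_upper]. *)
Lemma llt_upper d kap xs ys : 0 < d -> 0 < kap -> size xs = size ys ->
  \sum_(j <- xs) j = 0 -> \sum_(j <- ys) j = 1 ->
  exists2 C, 0 < C & forall s x y, (0 < size s)%N ->
    each (is_step d) s -> each (mass kap (xs ++ ys)) s ->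
    kwalk predT s (ind y) x <= C / Num.sqrt (size s)%:R.
Proof.
move=> d0 k0 sxy Sx Sy; pose l := size ys; have d0' := ltW d0.
have l0 : (0 < l)%N.
  by rewrite /l; case: ys Sy {sxy l} => //=; rewrite big_nil.
have lR : 0 < l%:R :> R by rewrite ltr0n.
pose K := kap ^+ l / 2; have K0 : 0 < K by rewrite /K; pos.
pose C1 := ((Num.sqrt K)^-1 + (K ^+ 2)^-1).
have sK : 0 < Num.sqrt K by rewrite sqrtr_gt0.
have C10 : 0 < C1 by rewrite /C1; pos.
have s2l : 0 < Num.sqrt (2 * l%:R) :> R by rewrite sqrtr_gt0; pos.
exists ((C1 + 1) * Num.sqrt (2 * l%:R)); first by pos.
move=> s x y sz ts ms.
have szR : 0 < (size s)%:R :> R by rewrite ltr0n.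
have ssz : 0 < Num.sqrt (size s)%:R :> R by rewrite sqrtr_gt0.
have [r [bs [er eb el es]]] := @block_split _ l (size s %/ l) s (leq_trunc_div _ _).
have [q0|q0] := posnP (size s %/ l).
  apply: (le_trans (kwalk_ind_le1 y d0 ts (isT : predT x))).
  rewrite ler_pdivlMr// mul1r; apply: (@le_trans _ _ (Num.sqrt (2 * l%:R))).
    rewrite ler_wsqrtr// -natrM ler_nat; have := ltn_ceil (size s) l0.
    by rewrite q0; clear; lia.
  by rewrite ler_peMl ?(ltW s2l)//; lra.
have [tr tbs] : each (is_step d) r /\ each (is_step d) (flatten bs).
  by apply/each_cat; rewrite -er.
have [_ mbs] : each (mass kap (xs ++ ys)) r /\ each (mass kap (xs ++ ys)) (flatten bs).
  by apply/each_cat; rewrite -er.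
have gbs := blocks_spread (ltW k0) sxy erefl Sx Sy el tbs mbs.
have qR : 0 < (size bs)%:R :> R by rewrite ltr0n eb.
have sq : 0 < Num.sqrt (size bs)%:R :> R by rewrite sqrtr_gt0.
have hb z : kwalk predT (flatten bs) (ind y) z <= C1 / Num.sqrt (size bs)%:R.
  apply: le_trans (spread_upper _ _ d0 K0 _ gbs) _; first by rewrite eb.
  rewrite /C1 mulrDl lerD// invfM ler_wpM2l//; first by pos.
  rewrite lef_pV2 ?posrE// -[leRHS]sqr_sqrtr ?ler0n// expr2 ler_peMl ?(ltW sq)//.
  by rewrite -{1}sqrtr1 ler_wsqrtr// ler1n eb.
rewrite {1}er kwalk_cat.
apply: (@le_trans _ _ (kwalk predT r (fun=> C1 / Num.sqrt (size bs)%:R) x)).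
  apply: (kwalk_le tr) => //; last exact: adm_cst.
  by apply: adm_kwalk => //; exact: adm_ind.
rewrite (kwalk_cst _ _ d0' tr) ler_pdivlMr// mulrAC ler_pdivrMr//.
have h : Num.sqrt (size s)%:R <= Num.sqrt (2 * l%:R) * Num.sqrt (size bs)%:R :> R.
  apply: sqrt_nat_le; first by pos.
  rewrite -!natrM ler_nat eb; apply: leq_trans (ltnW (ltn_ceil (size s) l0)) _.
  by rewrite mulSn -mulnA mul2n -addnn [(l * _)%N]mulnC leq_add2r leq_pmull.
rewrite -mulrA ler_pM//; [exact: ltW|lra].
Qed.

End LocalLimitTheorems.

(** * Local limit theorem: lower bound *)

Section BlockLemma.
Context {R : realType}.
Implicit Types (d C k H kap x y z u v w lo hi : R) (p : @step R) (s : seq (@step R)).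
Implicit Types (g f : R -> R) (N q : nat) (xs ys : seq int) (D : R -> bool).

Lemma good_refl d C k H mu p : good d C k H mu p -> good d C k H mu (refl p).
Proof.
move=> [sp hC hk hm]; have d0 := step_d sp; split; rewrite /refl /=.
- exact: is_step_refl.
- by rewrite (_ : (fun t => _) = (fun t => expR (d * `|t|)))//; apply/funext => t; rewrite normrN.
- rewrite (_ : (fun t => _) = (fun t => if `|t| <= H then t ^+ 2 else 0))//.
  by apply/funext => t; rewrite normrN sqrrN.
- have -> : p.1 (fun t => - t) = - p.1 id; last by rewrite normrN.
  rewrite -mulN1r -(exZ sp); last exact: adm_id.
  by congr (p.1 _); apply/funext => t; rewrite mulN1r.
Qed.

Lemma good0_id d C k H p : good d C k H 0 p -> p.1 id = 0.
Proof. by move=> [_ _ _]; rewrite normr_le0 => /eqP. Qed.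

Definition vbound d C := 2 / d ^+ 2 * C.

Lemma adm_sq d w : 0 < d -> adm d (fun z : R => (z - w) ^+ 2).
Proof.
move=> d0; apply: (@adm_le _ _ _ (fun x => (- w + x) ^+ 2)).
  by move=> z; rewrite addrC.
exact: (adm_shift _ (ltW d0) (adm_sqr d0)).
Qed.

Lemma ex_sq d C k H p w x : good d C k H 0 p ->
  p.1 (fun t => (x + t - w) ^+ 2) <= (x - w) ^+ 2 + vbound d C.
Proof.
move=> gp; have [sp hC _ _] := gp; have d0 := step_d sp.
rewrite (_ : (fun t => _) = fun t => ((x - w) ^+ 2 + 2 * (x - w) * t) + t ^+ 2); last first.
  by apply/funext => t; ring.
have ac c : adm d (fun=> c : R) by exact/adm_cst/ltW.
have ai c : adm d (fun t : R => c * t) by exact/admZ/adm_id.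
rewrite (exD sp); [|exact: admD|exact: adm_sqr].
rewrite (exD sp)// (exZ sp (2 * (x - w)) (adm_id d0)) (ex_cst sp) (good0_id gp) mulr0 addr0 lerD2l.
exact: var_le.
Qed.

Lemma vbound_ge0 d C k H mu p : good d C k H mu p -> 0 <= vbound d C.
Proof.
move=> [sp hC _ _]; have := var_le sp hC; apply: le_trans.
by apply: (ex_ge0 sp); [exact/adm_sqr/(step_d sp)|move=> t _; exact: sqr_ge0].
Qed.

Lemma kwalk_sq d C k H s w x : 0 < d -> each (good d C k H 0) s ->
  kwalk predT s (fun z => (z - w) ^+ 2) x <= (x - w) ^+ 2 + vbound d C * (size s)%:R.
Proof.
move=> d0; elim: s x => [|p s ih] x /=; first by rewrite mulr0 addr0.
move=> [gp gs]; have ss := good_each gs; have sp := good_step gp.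
apply: (@le_trans _ _ (kstep predT p (fun z => (z - w) ^+ 2 + vbound d C * (size s)%:R) x)).
  apply: (kstep_le sp); [apply: adm_kwalk => //|apply: admD|]; [exact: adm_sq..| |].
    exact/adm_cst/ltW.
  by move=> z _ _; exact: ih.
rewrite /kstep /= (exD sp) ?(ex_cst sp); [|exact: (adm_shift x (ltW d0) (adm_sq w d0))|exact/adm_cst/ltW].
by have := ex_sq w x gp; rewrite -natr1; lra.
Qed.

(** A parabola that is nonpositive outside of D loses at most be V per step of the
    life of the killed walk. *)
Lemma kwalk_sub d C k H D s al be w x : 0 < d -> 0 <= be -> each (good d C k H 0) s ->
  (forall z, ~~ D z -> al - be * (z - w) ^+ 2 <= 0) ->
  al - be * (x - w) ^+ 2 - be * vbound d C * \sum_(i < size s) kwalk D (take i s) (fun=> 1) x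
  <= kwalk D s (fun z => al - be * (z - w) ^+ 2) x.
Proof.
move=> d0 be0 + hD; have d0' := ltW d0; elim: s x => [|p s ih] x /=.
  by move=> _; rewrite big_ord0 mulr0 subr0.
move=> [gp gs]; have ss := good_each gs; have sp := good_step gp.
have v0 := vbound_ge0 gp; set V := vbound d C in v0 *.
pose f z := al - be * (z - w) ^+ 2; rewrite -/f.
have af : adm d f.
  by apply: admB; [exact: adm_cst|apply/admZ/adm_sq].
pose S z := \sum_(i < size s) kwalk D (take i s) (fun=> 1) z.
have aS : adm d S.
  by apply: adm_sum => // i; apply: adm_kwalk; [exact: each_take|exact: adm_cst].
have S0 z : 0 <= S z.
  by apply: sumr_ge0 => i _; apply: (kwalk_ge0 D z (each_take i ss)); [exact: adm_cst|].
rewrite big_ord_recl /=.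
have -> : \sum_(i < size s) kstep D p (kwalk D (take i s) (fun=> 1)) x = kstep D p S x.
  have E := @kwalk_sum _ d D [:: p] _ (index_enum 'I_(size s))
    (fun (i : 'I_(size s)) => kwalk D (take i s) (fun=> 1)) x d0' (conj sp I).
  by rewrite /= in E; rewrite E// => i; apply: adm_kwalk; [exact: each_take|exact: adm_cst].
apply: (@le_trans _ _ (kstep D p (fun z => f z + (- (be * V)) * S z) x)); last first.
  apply: (kstep_le sp); [by apply: admD => //; exact: admZ|exact: adm_kwalk|].
  move=> z Dz _; have h : f z - be * V * S z <= kwalk D s f z := ih z gs; lra.
rewrite (kstepD _ _ sp)//; last exact: admZ.
rewrite (kstepZ _ _ _ sp)//.
suff h : f x - be * V <= kstep D p f x by rewrite /f in h *; lra.
apply: (@le_trans _ _ (p.1 (fun t => f (x + t)))).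
  have -> : p.1 (fun t => f (x + t)) = al - be * p.1 (fun t => (x + t - w) ^+ 2).
    have a2 := adm_shift x d0' (adm_sq w d0).
    by rewrite (exB sp) ?(ex_cst sp) ?(exZ sp)//; [exact: adm_cst|exact: admZ].
  by have := ler_wpM2l be0 (ex_sq w x gp); rewrite /f -/V; lra.
apply: (ex_le sp); [exact: adm_shift|exact: adm_in|] => t _.
by case: ifP => // /negbT /hD.
Qed.

(** Chebyshev with stopping: apply [kwalk_sub] to 1 - (z - x)^2 / rho^2, the
    lifetime being at most [size s]. *)
Lemma kwalk_stay d C k H lo hi s x rho : 0 < d -> 0 < rho -> each (good d C k H 0) s ->
  lo <= x - rho -> x + rho <= hi ->
  1 - vbound d C * (size s)%:R / rho ^+ 2 <= kwalk (seg lo hi) s (fun=> 1) x.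
Proof.
move=> d0 r0 gs h1 h2; have ss := good_each gs; have d0' := ltW d0.
case: s gs ss => [_ _|p s gs ss]; first by rewrite /= mulr0 mul0r subr0.
have V0 : 0 <= vbound d C by have := gs => -[/vbound_ge0].
have Dx : seg lo hi x by rewrite /seg; apply/andP; split; lra.
have r2 : 0 < rho ^+ 2 by rewrite exprn_gt0.
have i0 : 0 <= (rho ^+ 2)^-1 by pos.
have hD z : ~~ seg lo hi z -> 1 - (rho ^+ 2)^-1 * (z - x) ^+ 2 <= 0.
  move=> hz; rewrite subr_le0 mulrC ler_pdivlMr// mul1r -[leRHS]real_normK ?num_real//.
  rewrite ler_pXn2r ?nnegrE ?(ltW r0)// leNgt; apply: contra hz; rewrite ltr_norml /seg => /andP[].
  by move=> ? ?; apply/andP; split; lra.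
have := kwalk_sub x d0 i0 gs hD; rewrite subrr expr0n /= mulr0 subr0 => h.
have hs : \sum_(i < size (p :: s)) kwalk (seg lo hi) (take i (p :: s)) (fun=> 1) x <= (size (p :: s))%:R.
  rewrite -[X in _ <= X%:R]card_ord -sumr_const; apply: ler_sum => i _.
  by apply: (kwalk_le1 d0' (each_take i ss)).
apply: (@le_trans _ _ (kwalk (seg lo hi) (p :: s) (fun z => 1 - (rho ^+ 2)^-1 * (z - x) ^+ 2) x)).
  apply: le_trans h; rewrite lerD2l lerN2.
  have := ler_wpM2l (mulr_ge0 i0 V0) hs; move/le_trans; apply.
  by rewrite -mulrA mulrC.
apply: (kwalk_le ss) => //.
- by apply: admB; [exact: adm_cst|apply/admZ/adm_sq].
- exact: adm_cst.
- by move=> z _ _; rewrite gerBl mulr_ge0 ?sqr_ge0.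
Qed.

(** [quad] minorises the binomial mean of the window, and its loss over all blocks
    is at most a fixed fraction of its height a; A is chosen such that the
    starting point, within sqrt (size s) of y, also costs only a fraction. *)
Lemma llt_lower d C k H kap xs ys : 0 < d -> 0 < C -> 0 < kap -> size xs = size ys ->
  \sum_(j <- xs) j = 0 -> \sum_(j <- ys) j = 1 ->
  exists c m0, 0 < c /\ forall s x y, (m0 <= size s)%N ->
    each (good d C k H 0) s -> each (mass kap (xs ++ ys)) s ->
    `|x - y| <= Num.sqrt (size s)%:R -> y - x + drift_sum s \is a Num.int ->
    c / Num.sqrt (size s)%:R <= kwalk predT s (ind y) x.
Proof.
move=> d0 C0 k0 sxy Sx Sy; pose l := size ys; have d0' := ltW d0.
have l0 : (0 < l)%N.
  by rewrite /l; case: ys Sy {sxy l} => //=; rewrite big_nil.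
have lR : 0 < l%:R :> R by rewrite ltr0n.
pose K := Num.min (kap ^+ l / 2) (1 / 2).
have K0 : 0 < K by rewrite /K lt_min; apply/andP; split; pos.
have K2 : K <= 1 / 2 by rewrite ge_min lexx orbT.
have K1 : K <= kap ^+ l / 2 by rewrite ge_min lexx.
pose V := vbound d C; have V0 : 0 < V by rewrite /V /vbound; pos.
(* with this A the position penalties of the blocks, the remainder and the
   starting point add up to a / 4 *)
pose A := Num.sqrt (8 * l%:R * (1 + V)).
have A0 : 0 < A by rewrite sqrtr_gt0; pos.
have A2 : A ^+ 2 = 8 * l%:R * (1 + V) by rewrite sqr_sqrtr//; pos.
have [c [q0 [c0 hc]]] := bavg_win A0 K0 K2.
pose q1 := (maxn q0 (Num.truncn (4 / K ^+ 2)).+1).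
exists (c / 2), (q1 * l)%N; split; first by pos.
move=> s x y hs gs ms hxy hlat.
have ss := good_each gs.
have q0s : (q1 <= size s %/ l)%N by rewrite leq_divRL.
have [r [bs [er eb el es]]] := @block_split _ l (size s %/ l) s (leq_trunc_div _ _).
have /each_cat[tr tbs] : each (is_step d) (r ++ flatten bs) by rewrite -er.
have /each_cat[gr gbs'] : each (good d C k H 0) (r ++ flatten bs) by rewrite -er.
have /each_cat[_ mbs] : each (mass kap (xs ++ ys)) (r ++ flatten bs) by rewrite -er.
have gbs0 := blocks_spread (ltW k0) sxy erefl Sx Sy el tbs mbs.
have gbs : each (spread d K) bs.
  apply: each_imp gbs0 => b [tb hb]; split=> // g z hg g0.
  by apply: le_trans (hb g z hg g0); rewrite ler_wpM2r// addr_ge0.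
set q := size bs; have qe : q = (size s %/ l)%N by [].
have hq : (q0 <= q)%N by rewrite qe; apply: leq_trans q0s; rewrite leq_max leqnn.
have hq' : ((Num.truncn (4 / K ^+ 2)).+1 <= q)%N.
  by rewrite qe; apply: leq_trans q0s; rewrite leq_max leqnn orbT.
have q1' : (0 < q)%N by apply: leq_trans hq'.
have qR : 0 < q%:R :> R by rewrite ltr0n.
have Kq : 4 / K ^+ 2 < q%:R by apply: lt_le_trans (truncnS_gt _) _; rewrite ler_nat.
pose a := c / Num.sqrt q%:R; have a0 : 0 < a by rewrite /a; pos.
have ind_win : kwalk predT s (win y) x <= kwalk predT s (ind y) x.
  apply: (kwalk_le ss) => //; [exact: adm_win|exact: adm_ind|].
  move=> z _ hz; rewrite /win /ind; case: eqVneq => [_|zy]; first by rewrite lern1 leq_b1.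
  case: (boolP (_ && _)) => // /andP[z1 z2]; case/negP: zy.
  have /intrP[i hi] : z - y \is a Num.int.
    rewrite (_ : z - y = (z - x + drift_sum s) - (y - x + drift_sum s)); last by ring.
    by rewrite rpredB.
  have : (i%:~R : R) < 1 by rewrite -hi; lra.
  have : - 1 < (i%:~R : R) by rewrite -hi; lra.
  rewrite -[-1](_ : (-1)%:~R = _)// -[X in _ -> _ < X -> _](_ : 1%:~R = _)// !ltr_int => i1 i2.
  have i0 : i = 0 by move: i1 i2; clear; lia.
  by apply/eqP; move: hi; rewrite i0 => /eqP; rewrite subr_eq0 => /eqP.
apply: le_trans ind_win.
pose be := a / (K * q%:R) ^+ 2; pose ga := a / (A ^+ 2 * q%:R).
have be0 : 0 <= be by rewrite /be; pos.
have ga0 : 0 <= ga by rewrite /ga A2; pos.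
have hbl z : a * (1 - 1 / 4 - V * l%:R / A ^+ 2) - ga * (z - y) ^+ 2 <= kwalk predT (flatten bs) (win y) z.
  have := tw_bavg 0 z d0' gbs (adm_win y d0'); rewrite /= => <-.
  apply: le_trans (tw_le 0 z d0' (ltW K0) gbs (fun N => adm_quad _ _ _ _ _ N d0) (fun N => adm_bavg N d0' (adm_win y d0')) (fun N z => hc q N z y a hq q1' erefl)).
  have hv : each (fun b => forall w z, ga * kwalk predT b (fun z => (z - w) ^+ 2) z <=
      ga * ((z - w) ^+ 2 + V * l%:R)) bs.
    apply: each_imp (each_and (each_flatten gbs') el) => b [gb eb'] w z'.
    by rewrite ler_wpM2l// -eb'; exact: kwalk_sq gb.
  apply: le_trans (tw_quad a (2 * K * q%:R) y 0 z d0 (ltW K0) be0 ga0 gbs hv).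
  rewrite -/q /quad mul0r addr0 subrr subr0 expr0n /= mulr0 subr0 lerD2r.
  have -> : a - (be + ga * (V * l%:R)) * q%:R = a * (1 - (K ^+ 2 * q%:R)^-1 - V * l%:R / A ^+ 2).
    by rewrite /be /ga; field; rewrite !gt_eqF.
  rewrite ler_pM2l// lerD2r lerD2l lerN2 mul1r lef_pV2 ?posrE//; last by pos.
  by move: Kq; rewrite ltr_pdivrMr; [lra|pos].
rewrite er kwalk_cat -er.
apply: (@le_trans _ _ (kwalk predT r (fun z => a * (1 - 1 / 4 - V * l%:R / A ^+ 2) - ga * (z - y) ^+ 2) x)); last first.
  apply: (kwalk_le tr) => //; last by apply: adm_kwalk => //; exact: adm_win.
  by apply: admB; [exact: adm_cst|apply/admZ/adm_sq].
rewrite (kwalkB _ _ tr); [|exact: adm_cst|exact/admZ/adm_sq].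
rewrite (kwalk_cst _ _ d0' tr) (kwalkZ _ _ _ tr); last exact: adm_sq.
have hr : (size r)%:R <= l%:R * q%:R :> R.
  rewrite -natrM ler_nat es qe; apply: leq_trans (_ : l <= _)%N.
    by rewrite leq_subLR addnC -mulSn ltnW// ltn_ceil.
  by rewrite leq_pmulr// -qe.
have hm : (size s)%:R <= 2 * l%:R * q%:R :> R.
  rewrite -!natrM ler_nat qe; apply: leq_trans (ltnW (ltn_ceil (size s) l0)) _.
  by rewrite mulSn -mulnA mul2n -addnn [(l * _)%N]mulnC leq_add2r leq_pmull// -qe.
have sq : (x - y) ^+ 2 <= 2 * l%:R * q%:R.
  apply: le_trans hm; rewrite -[leRHS](@sqr_sqrtr _ (size s)%:R) ?ler0n//.
  by rewrite -[leLHS]real_normK ?num_real// lerXn2r ?nnegrE.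
have := ler_wpM2l ga0 (kwalk_sq y x d0 gr); rewrite -/V => hk.
have h5 : ga * ((x - y) ^+ 2 + V * (size r)%:R) <= a * ((2 + V) * l%:R / A ^+ 2).
  apply: (@le_trans _ _ (ga * ((2 + V) * l%:R * q%:R))).
    by rewrite ler_wpM2l//; have := ler_wpM2l (ltW V0) hr; lra.
  rewrite le_eqVlt; apply/orP; left; apply/eqP; rewrite /ga; field.
  by rewrite !gt_eqF.
have h6 : V * l%:R / A ^+ 2 + (2 + V) * l%:R / A ^+ 2 = 1 / 4.
  by rewrite A2; field; rewrite !gt_eqF//; lra.
have h7 : a / 2 <= a * (1 - 1 / 4 - V * l%:R / A ^+ 2) - a * ((2 + V) * l%:R / A ^+ 2).
  rewrite -mulrBr (_ : _ - _ - _ - _ = 1 / 2); first by lra.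
  by lra.
apply: (@le_trans _ _ (a / 2)); last by lra.
rewrite /a [leRHS]mulrAC ler_pM2l; last by pos.
rewrite lef_pV2 ?posrE ?sqrtr_gt0//; last first.
  by rewrite ltr0n; apply: leq_trans q1' _; rewrite qe leq_div.
by rewrite ler_wsqrtr// ler_nat qe leq_div.
Qed.

End BlockLemma.

(** * One block of steps inside an interval *)

Section Chain.
Context {R : realType}.
Implicit Types (x y z u v w lo hi : R) (p : @step R) (s : seq (@step R)).
Implicit Types (g f : R -> R) (N q m : nat) (D : R -> bool).

Lemma le_sqrtr (a b : R) : 0 <= a -> a ^+ 2 <= b -> a <= Num.sqrt b.
Proof. by move=> a0 h; rewrite -[a]ger0_norm// -sqrtr_sqr ler_wsqrtr. Qed.

Lemma lattice_count b lo hi (P : seq R) :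
  (forall z, (z \in P) = (lo <= z <= hi) && (z - b \is a Num.int)) ->
  hi - lo - 1 <= (size P)%:R.
Proof.
move=> hP; have [h|h] := ltP (hi - lo) 1; first by have := ler0n R (size P); lra.
pose n := Num.truncn (hi - lo).
have nle : n%:R <= hi - lo by rewrite truncn_le; lra.
have ngt : hi - lo < n%:R + 1 by rewrite natr1; exact: truncnS_gt.
pose c := Num.ceil (lo - b).
have c1 : lo - b <= c%:~R by exact: ceil_ge.
have c2 : c%:~R < lo - b + 1 by have := ceilB1_lt (lo - b); rewrite -/c rmorphB /=; lra.
pose pt (i : nat) : R := b + (c + i%:Z)%:~R.
have ptE i : pt i = b + c%:~R + i%:R by rewrite /pt rmorphD /= addrA.
apply: (@le_trans _ _ n%:R); first by lra.
rewrite ler_nat -[X in (X <= _)%N](size_iota 0) -(size_map pt).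
apply: uniq_leq_size.
  rewrite map_inj_uniq ?iota_uniq// => i j.
  by rewrite !ptE => /addrI/eqP; rewrite eqr_nat => /eqP.
move=> _ /mapP[i hi' ->]; rewrite mem_iota add0n /= in hi'.
rewrite hP; apply/andP; split; last by rewrite /pt addrC addKr intr_int.
have i0 : 0 <= i%:R :> R by rewrite ler0n.
have i1 : i%:R + 1 <= n%:R :> R by rewrite natr1 ler_nat.
by rewrite ptE; apply/andP; split; lra.
Qed.

(** Trajectories that leave D but not D' contribute at most the supremum of f
    times their probability. *)
Lemma kwalk_gap d D D' s f (B : R) x : 0 < d -> each (is_step d) s -> adm d f ->
  (forall z, f z <= B) -> (forall z, D z -> D' z) ->
  kwalk D' s f x - kwalk D s f x <= B * (kwalk D' s (fun=> 1) x - kwalk D s (fun=> 1) x).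
Proof.
move=> d0 ss hf fB DD; have ac c : adm d (fun=> c : R) by exact/adm_cst/ltW.
have aB : adm d (fun z => B * 1 - f z) by exact: (admB (ac (B * 1)) hf).
have := kwalk_dom x ss aB (fun z => _) DD.
rewrite !(kwalkB _ _ ss)// !(kwalkZ _ _ _ ss)// => H.
have {}H := H ltac:(by move=> z; rewrite mulr1 subr_ge0).
by lra.
Qed.

Lemma kwalk_trim d D s f x : 0 < d -> each (is_step d) s -> adm d f ->
  (forall z, 0 <= f z) -> kwalk D s f x <= kwalk predT s f x.
Proof. by move=> d0 ss hf f0; exact: (kwalk_dom x ss hf f0 (fun z _ => isT)). Qed.

Variables (d C k H kap : R) (xs ys : seq int).
Hypotheses (d0 : 0 < d) (C0 : 0 < C) (kap0 : 0 < kap) (sxy : size xs = size ys)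
  (Sx : \sum_(j <- xs) j = 0) (Sy : \sum_(j <- ys) j = 1).

(** The two properties needed of an original step: it is centred with uniform
    moments, and it charges the support points xs and ys. *)
Definition regular p : Prop := good d C k H 0 p /\ mass kap (xs ++ ys) p.

Lemma regular_step s : each regular s -> each (is_step d) s.
Proof. by apply: each_imp => p [[]]. Qed.

Lemma regular_good s : each regular s -> each (good d C k H 0) s.
Proof. by apply: each_imp => p []. Qed.

Lemma regular_mass s : each regular s -> each (mass kap (xs ++ ys)) s.
Proof. by apply: each_imp => p []. Qed.

Let V := vbound d C.
Let V0 : 0 < V. Proof. by rewrite /V /vbound; pos. Qed.

Lemma truncS_le (r : R) m : ((Num.truncn r).+1 <= m)%N -> r < m%:R.
Proof. by move=> h; apply: lt_le_trans (truncnS_gt _) _; rewrite ler_nat. Qed.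

(** In a box of radius [size s] the walk exits with probability O(1 / size s), which
    is negligible compared to the local probability. *)
Lemma box_lower : exists c m0, 0 < c /\ forall s x y lo hi, (m0 <= size s)%N ->
  each regular s -> `|x - y| <= Num.sqrt (size s)%:R ->
  y - x + drift_sum s \is a Num.int ->
  lo <= x - (size s)%:R -> x + (size s)%:R <= hi ->
  c / Num.sqrt (size s)%:R <= kwalk (seg lo hi) s (ind y) x.
Proof.
have [c [m0 [c0 hc]]] := llt_lower k H d0 C0 kap0 sxy Sx Sy.
exists (c / 2), (maxn m0 (Num.truncn ((2 * V / c) ^+ 2)).+1); split; first by pos.
move=> s x y lo hi; rewrite geq_max => /andP[hm /truncS_le hm'] rs hxy hlat h1 h2.
have gs := regular_good rs; have ss := regular_step rs.
set m : R := (size s)%:R in hxy hm' h1 h2 *.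
have m0' : 0 < m by apply: le_lt_trans hm'; exact: sqr_ge0.
have sm : 0 < Num.sqrt m by rewrite sqrtr_gt0.
have ssm : Num.sqrt m * Num.sqrt m = m by rewrite -expr2 sqr_sqrtr// ltW.
have hs : 2 * V / c <= Num.sqrt m.
  by apply: le_sqrtr; [pos|exact: ltW].
have lb := hc s x y hm gs (regular_mass rs) hxy hlat.
have ai : adm d (ind y) by exact/adm_ind/ltW.
have gap := @kwalk_gap d (seg lo hi) predT s (ind y) 1 x d0 ss ai
  (fun z => ltac:(by rewrite /ind lern1 leq_b1)) (fun z _ => isT).
have st := kwalk_stay d0 m0' gs h1 h2.
rewrite (kwalk_free1 x (ltW d0) ss) mul1r in gap.
have h3 : V * m / m ^+ 2 <= c / 2 / Num.sqrt m.
  have -> : V * m / m ^+ 2 = V / (Num.sqrt m * Num.sqrt m).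
    by rewrite ssm; field; rewrite gt_eqF.
  rewrite invfM mulrA ler_pM2r ?invr_gt0// ler_pdivrMr//.
  by move: hs; rewrite ler_pdivrMr//; lra.
have -> : c / 2 / Num.sqrt m = c / Num.sqrt m - c / 2 / Num.sqrt m by field; rewrite gt_eqF.
move: st gap lb h3; rewrite -/m -/V; lra.
Qed.

Lemma sqrt_half m (a : R) : 0 <= a -> m%:R <= 4 * a -> Num.sqrt m%:R <= 2 * Num.sqrt a.
Proof.
move=> a0 h; have -> : (2 : R) = Num.sqrt 4.
  by rewrite (_ : 4 = 2 ^+ 2) ?sqrtr_sqr ?ger0_norm// -natrX.
by rewrite -sqrtrM// ler_wsqrtr.
Qed.

Lemma half_bounds m : (4 <= m)%N ->
  [/\ m./2 <= m, m <= 4 * m./2 & m <= 4 * (m - m./2)]%N.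
Proof. by rewrite -divn2 => h; split; lia. Qed.

(** Enlarge the interval to a box in which the local lower bound holds.  The paths
    that leave the original interval do so during the first or during the
    second half; in either case the other half has local probabilities at most
    B, and leaving has probability at most V / rho^2.  For the second half
    the path is read backwards. *)
Lemma block_lower : exists c rho m0, [/\ 0 < c, 0 < rho & forall s x y lo hi,
  (m0 <= size s)%N -> each regular s -> `|x - y| <= Num.sqrt (size s)%:R ->
  y - x + drift_sum s \is a Num.int ->
  lo + rho * Num.sqrt (size s)%:R <= x <= hi - rho * Num.sqrt (size s)%:R ->
  lo + rho * Num.sqrt (size s)%:R <= y <= hi - rho * Num.sqrt (size s)%:R ->
  c / Num.sqrt (size s)%:R <= kwalk (seg lo hi) s (ind y) x].
Proof.
have [c [m0 [c0 hc]]] := box_lower.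
have [U U0 hU] := llt_upper d0 kap0 sxy Sx Sy.
(* the two halves then lose at most a quarter each of the main term *)
pose rho := Num.sqrt (8 * U * V / c).
have r0 : 0 < rho by rewrite sqrtr_gt0; pos.
have r2 : rho ^+ 2 = 8 * U * V / c by rewrite sqr_sqrtr//; pos.
exists (c / 2), rho, (maxn m0 4); split=> //; first by pos.
move=> s x y lo hi; rewrite geq_max => /andP[hm m4] rs hxy hlat hx hy.
have gs := regular_good rs; have ss := regular_step rs; have ms := regular_mass rs.
have d0' := ltW d0.
set m := size s in m4 hxy hx hy *; pose s1 := take m./2 s; pose s2 := drop m./2 s.
have e12 : s = s1 ++ s2 by rewrite cat_take_drop.
have [hm1 hm2 hm3] := half_bounds m4.
have z1 : size s1 = m./2 by rewrite size_takel.
have z2 : size s2 = (m - m./2)%N by rewrite size_drop.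
have mR : 0 < m%:R :> R by rewrite ltr0n (leq_trans _ m4).
have sm0 : 0 < Num.sqrt m%:R :> R by rewrite sqrtr_gt0.
have ssm : Num.sqrt m%:R ^+ 2 = m%:R :> R by rewrite sqr_sqrtr// ltW.
have [g1 g2] : each (good d C k H 0) s1 /\ each (good d C k H 0) s2 by apply/each_cat; rewrite -e12.
have [t1 t2] : each (is_step d) s1 /\ each (is_step d) s2 by apply/each_cat; rewrite -e12.
have [M1 M2] : each (mass kap (xs ++ ys)) s1 /\ each (mass kap (xs ++ ys)) s2 by apply/each_cat; rewrite -e12.
pose D := seg lo hi; pose D' := seg (lo - m%:R) (hi + m%:R).
have DD z : D z -> D' z by rewrite /D /D' /seg => /andP[? ?]; apply/andP; split; lra.
have rs0 : 0 < rho * Num.sqrt m%:R by pos.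
move: hx hy => /andP[x1 x2] /andP[y1 y2].
have Dx : D x by rewrite /D /seg; apply/andP; split; lra.
have Dy : D y by rewrite /D /seg; apply/andP; split; lra.
have lb : c / Num.sqrt m%:R <= kwalk D' s (ind y) x.
  by apply: hc => //; rewrite -/m; lra.
have ai z : adm d (ind z) by exact: adm_ind.
have ac (r : R) : adm d (fun=> r) by exact: adm_cst.
pose B := 2 * U / Num.sqrt m%:R.
have B0 : 0 <= B by rewrite /B; pos.
have small (t : seq (@step R)) z w (DD0 : R -> bool) : (m <= 4 * size t)%N -> each (is_step d) t ->
    each (mass kap (xs ++ ys)) t -> kwalk DD0 t (ind w) z <= B.
  move=> ht tt Mt; apply: (le_trans (kwalk_trim DD0 z d0 tt (ai w) (ind_ge0 w))).
  have tp : (0 < size t)%N by move: ht m4; clear; lia.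
  have tR : 0 < (size t)%:R :> R by rewrite ltr0n.
  have tR' : 0 < Num.sqrt (size t)%:R :> R by rewrite sqrtr_gt0.
  apply: le_trans (hU _ _ _ tp tt Mt) _.
  have hs : Num.sqrt m%:R <= 2 * Num.sqrt (size t)%:R :> R.
    by apply: (@sqrt_half m); rewrite -?natrM ?ler_nat ?ler0n.
  rewrite /B ler_pdivrMr// mulrAC ler_pdivlMr//.
  by have := ler_wpM2l (ltW U0) hs; lra.
have q0 : 0 < V / rho ^+ 2 by rewrite r2; pos.
have stay (t : seq (@step R)) z : (size t <= m)%N -> each (good d C k H 0) t ->
    lo <= z - rho * Num.sqrt m%:R -> z + rho * Num.sqrt m%:R <= hi ->
    1 - V / rho ^+ 2 <= kwalk D t (fun=> 1) z.
  move=> tm gt h1 h2; apply: le_trans (kwalk_stay d0 rs0 gt h1 h2).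
  have tm' : (size t)%:R / m%:R <= 1 :> R by rewrite ler_pdivrMr// mul1r ler_nat.
  rewrite lerD2l lerN2 exprMn ssm -/V.
  rewrite (_ : V * _ / _ = V / rho ^+ 2 * ((size t)%:R / m%:R)).
    by rewrite ler_piMr// ltW.
  by field; rewrite !gt_eqF.
have gap1 : kwalk D' s1 (kwalk D' s2 (ind y)) x - kwalk D s1 (kwalk D' s2 (ind y)) x <= B * (V / rho ^+ 2).
  have a2 : adm d (kwalk D' s2 (ind y)) by exact: adm_kwalk.
  apply: le_trans (@kwalk_gap d D D' s1 _ B x d0 t1 a2 _ DD) _.
    by move=> z; apply: small => //; rewrite z2.
  rewrite ler_wpM2l//; have := @stay s1 x _ g1; rewrite z1 => /(_ _)h.
  have {}h := h hm1 ltac:(lra) ltac:(lra).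
  have := kwalk_le1 d0' t1 (DD x Dx); lra.
have gap2 : kwalk D s1 (kwalk D' s2 (ind y)) x - kwalk D s1 (kwalk D s2 (ind y)) x <= B * (V / rho ^+ 2).
  have a2 : adm d (kwalk D' s2 (ind y)) by exact: adm_kwalk.
  have a3 : adm d (kwalk D s2 (ind y)) by exact: adm_kwalk.
  have [P [uP mP]] := lattice_points (x - drift_sum s1) lo hi.
  have hP z : D z -> z - x + drift_sum s1 \is a Num.int -> z \in P.
    move=> Dz hz; rewrite mP (Dz : is_true (lo <= z <= hi)).
    by rewrite (_ : z - _ = z - x + drift_sum s1); [rewrite hz|ring].
  rewrite (kwalk_lattice d0 t1 a2 Dx uP hP) (kwalk_lattice d0 t1 a3 Dx uP hP).
  rewrite -sumrB.
  have gs2' : each (good d C k H 0) (srev s2) by exact: each_srev (@good_refl _ d C k H 0) g2.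
  have t2' := good_each gs2'.
  pose F z := \sum_(w <- P) ind w z.
  have aF : adm d F by exact: adm_sum.
  have F1 z : F z <= 1.
    have := sum_ind (fun=> 1) z uP; under eq_bigr do rewrite mul1r.
    by rewrite /F => ->; case: ifP.
  apply: (@le_trans _ _ (\sum_(z <- P) B * (kwalk D' (srev s2) (ind z) y - kwalk D (srev s2) (ind z) y))).
    rewrite big_seq [leRHS]big_seq; apply: ler_sum => z; rewrite mP => /andP[Dz _].
    rewrite -mulrBr (@kwalk_rev _ d (lo - m%:R) (hi + m%:R) s2 z y)//; [|exact: DD..].
    rewrite (@kwalk_rev _ d lo hi s2 z y)// ler_wpM2r//.
      by rewrite subr_ge0; exact: (kwalk_dom y t2' (ai z) (ind_ge0 z) DD).
    by apply: small => //; rewrite z1.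
  rewrite -mulr_sumr sumrB -!(kwalk_sum _ _ _ d0' t2' ai) -/F ler_wpM2l//.
  apply: le_trans (@kwalk_gap d D D' (srev s2) F 1 y d0 t2' aF F1 DD) _.
  rewrite mul1r; have := @stay (srev s2) y _ gs2'; rewrite size_srev z2 => /(_ _)h.
  have {}h := h (leq_subr _ _) ltac:(lra) ltac:(lra).
  have := kwalk_le1 d0' t2' (DD y Dy); lra.
have key : B * (V / rho ^+ 2) = c / 4 / Num.sqrt m%:R.
  by rewrite /B r2; field; rewrite !gt_eqF.
move: lb gap1 gap2; rewrite e12 -/m -/D !kwalk_cat key; lra.
Qed.

End Chain.

(** * Chaining blocks *)

Section Chaining.
Context {R : realType}.
Implicit Types (x y z u v w lo hi : R) (p : @step R) (s : seq (@step R)).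
Implicit Types (g f : R -> R) (N q m : nat) (D : R -> bool).

(** An intermediate window for one block: within S of x, closer to y by S / 2 than
    x was allowed to be, and inside of the interval. *)
Lemma window_exists x y lo hi (S T : R) : 0 < S -> S <= T ->
  `|x - y| <= T / 2 + S / 2 -> S <= hi - lo -> lo <= x <= hi -> lo <= y <= hi ->
  exists a, forall z, a <= z <= a + S / 2 ->
    [/\ `|x - z| <= S, `|z - y| <= T / 2 & lo <= z <= hi].
Proof.
move=> S0 ST; rewrite ler_norml => /andP[h1 h2] h3 /andP[x1 x2] /andP[y1 y2].
have fin a : (forall z, a <= z -> z <= a + S / 2 -> [/\ - S <= x - z, x - z <= S,
    - (T / 2) <= z - y, z - y <= T / 2 & lo <= z <= hi]) ->
    exists a, forall z, a <= z <= a + S / 2 ->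
    [/\ `|x - z| <= S, `|z - y| <= T / 2 & lo <= z <= hi].
  move=> h; exists a => z /andP[/h{}h /h[? ? ? ? ?]].
  by split=> //; rewrite ler_norml; apply/andP; split.
have [xy|yx] := leP x y.
  have [a1|a1] := leP x (y - T / 2).
    have [a2|a2] := leP (y - T / 2 + S / 2) hi.
      by apply: (fin (y - T / 2)) => z z1 z2; split; try apply/andP; try split; lra.
    by apply: (fin (y - S / 2)) => z z1 z2; split; try apply/andP; try split; lra.
  have [a2|a2] := leP (x + S / 2) hi.
    by apply: (fin x) => z z1 z2; split; try apply/andP; try split; lra.
  by apply: (fin (y - S / 2)) => z z1 z2; split; try apply/andP; try split; lra.
have [a1|a1] := leP (y + T / 2) x.
  have [a2|a2] := leP lo (y + T / 2 - S / 2).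
    by apply: (fin (y + T / 2 - S / 2)) => z z1 z2; split; try apply/andP; try split; lra.
  by apply: (fin y) => z z1 z2; split; try apply/andP; try split; lra.
have [a2|a2] := leP lo (x - S / 2).
  by apply: (fin (x - S / 2)) => z z1 z2; split; try apply/andP; try split; lra.
by apply: (fin y) => z z1 z2; split; try apply/andP; try split; lra.
Qed.

Lemma itv_shrink lo hi r z : 0 <= r -> lo + r <= z <= hi - r -> lo <= z <= hi.
Proof. by move=> r0 /andP[? ?]; apply/andP; split; lra. Qed.

Lemma itv_halve lo hi r S z : 0 <= r * S -> lo + 2 * r * S <= z <= hi - 2 * r * S ->
  lo + r * S <= z <= hi - r * S.
Proof. by move=> r0 /andP[? ?]; apply/andP; split; lra. Qed.

Variables (d C k H kap : R) (xs ys : seq int).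
Hypotheses (d0 : 0 < d) (C0 : 0 < C) (kap0 : 0 < kap) (sxy : size xs = size ys)
  (Sx : \sum_(j <- xs) j = 0) (Sy : \sum_(j <- ys) j = 1).
Local Notation reg := (regular d C k H kap xs ys).

(** Induction on the number of blocks: the first block leads to each of the at
    least S / 4 lattice points of the window with probability c / S, which
    costs the factor gam. *)
Lemma chain_lower : exists c gam rho m1, [/\ 0 < c, 0 < gam <= 1, 0 < rho &
  forall i m s x y lo hi, (m1 <= m)%N -> (0 < i)%N -> (i * m <= size s < i.+1 * m)%N ->
  each reg s -> `|x - y| <= i%:R * Num.sqrt m%:R / 2 ->
  y - x + drift_sum s \is a Num.int ->
  (2 * rho + 1) * Num.sqrt m%:R <= hi - lo ->
  lo + rho * Num.sqrt m%:R <= x <= hi - rho * Num.sqrt m%:R ->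
  lo + rho * Num.sqrt m%:R <= y <= hi - rho * Num.sqrt m%:R ->
  c * gam ^+ i / Num.sqrt m%:R <= kwalk (seg lo hi) s (ind y) x].
Proof.
have [c [rho [m0 [c0 r0 hc]]]] := block_lower k H d0 C0 kap0 sxy Sx Sy.
pose gam := Num.min (c / 4) 1.
have g0 : 0 < gam by rewrite lt_min; apply/andP; split; pos.
have g1 : gam <= 1 by rewrite ge_min lexx orbT.
have gc : gam <= c / 4 by rewrite ge_min lexx.
exists (c / 2), gam, (2 * rho), (maxn m0 16); split; [pos|by rewrite g0|pos|].
move=> i m s x y lo hi; rewrite geq_max => /andP[hm m16].
have mR : 16 <= m%:R :> R by rewrite ler_nat.
have m0' : 0 < m%:R :> R by lra.
set S := Num.sqrt m%:R; have S0 : 0 < S by rewrite sqrtr_gt0.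
have S4 : 4 <= S by apply: le_sqrtr => //; rewrite -natrX; apply: le_trans mR; rewrite ler_nat.
move=> i0; rewrite -(prednK i0); move: i.-1 => {i i0} i.
elim: i s x => [|i ih] s x.
  rewrite mul1n => /andP[s1 s2] rs hxy hlat hl /andP[x1 x2] /andP[y1 y2].
  have hS : Num.sqrt (size s)%:R <= 2 * S.
    apply: sqrt_half; first exact: ltW.
    by rewrite -natrM ler_nat; move: s2; clear; lia.
  have hS' : S <= Num.sqrt (size s)%:R by rewrite ler_wsqrtr// ler_nat.
  have rS := ler_wpM2l (ltW r0) hS.
  have sp : 0 < Num.sqrt (size s)%:R :> R by lra.
  apply: le_trans (hc s x y lo hi _ rs _ hlat _ _).
  - rewrite expr1 ler_pdivlMr// mulrAC ler_pdivrMr//.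
    have a1 := ler_wpM2l (ltW c0) hS; have a2 : 0 <= c / 2 * (1 - gam) by rewrite mulr_ge0 ?subr_ge0//; pos.
    by have := mulr_ge0 a2 (ltW sp); lra.
  - exact: leq_trans hm s1.
  - by apply: le_trans hxy _; rewrite mul1r; lra.
  - by apply/andP; split; lra.
  - by apply/andP; split; lra.
move=> /andP[s1 s2] rs hxy hlat hl hx hy.
pose sa := take m s; pose sb := drop m s.
have e12 : s = sa ++ sb by rewrite cat_take_drop.
have ms : (m <= size s)%N by apply: leq_trans s1; rewrite mulSn leq_addr.
have za : size sa = m by rewrite size_takel.
have zb : size sb = (size s - m)%N by rewrite size_drop.
have /each_cat[ra rb] : each reg (sa ++ sb) by rewrite -e12.
have ta := regular_step ra; have tb := regular_step rb.
have [a ha] : exists a, forall z, a <= z <= a + S / 2 ->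
    [/\ `|x - z| <= S, `|z - y| <= (i.+1)%:R * S / 2 &
        lo + 2 * rho * S <= z <= hi - 2 * rho * S].
  have [] := @window_exists x y (lo + 2 * rho * S) (hi - 2 * rho * S) S ((i.+1)%:R * S) S0.
  - by rewrite ler_peMl ?ler1n// ltW.
  - by apply: le_trans hxy _; rewrite -(natr1 i.+1); lra.
  - by lra.
  - exact: hx.
  - exact: hy.
  - by move=> a ha; exists a.
have [P [uP mP]] := lattice_points (x - drift_sum sa) a (a + S / 2).
(* a window of length S / 2 >= 2 contains at least S / 2 - 1 lattice points *)
have nP : S / 4 <= (size P)%:R.
  by apply: le_trans (lattice_count mP); lra.
pose B := c / 2 * gam ^+ i.+1 / S; have B0 : 0 <= B by rewrite /B; pos.
set D := seg lo hi.
have d0' := ltW d0.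
have ai z : adm d (ind z) by exact: adm_ind.
have ab : adm d (kwalk D sb (ind y)) by exact: adm_kwalk.
have k0 z : 0 <= kwalk D sb (ind y) z by apply: (kwalk_ge0 D z tb) => // w; exact: ind_ge0.
have hxS : 0 <= rho * S by pos.
move: (hx) => /andP[x1 x2].
have Dx : D x := itv_shrink hxS (itv_halve hxS hx).
have hb z : z \in P -> B <= kwalk D sb (ind y) z.
  rewrite mP => /andP[/ha[z1 z2 z3] hz]; apply: ih => //.
  - by rewrite zb leq_subRL// ltn_subLR// -!mulSn s1.
  - rewrite (_ : _ + _ = (y - x + drift_sum s) - (z - (x - drift_sum sa))); first by rewrite rpredB.
    by rewrite e12 drift_sum_cat; ring.
have ha' z : z \in P -> c / S <= kwalk D sa (ind z) x.
  rewrite mP => /andP[/ha[z1 z2 z3] hz].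
  have := hc sa x z lo hi; rewrite za => /(_ hm ra z1); apply.
  - by rewrite (_ : _ + _ = z - (x - drift_sum sa)); [exact: hz|ring].
  - exact: itv_halve hxS hx.
  - exact: itv_halve hxS z3.
rewrite e12 kwalk_cat.
apply: (@le_trans _ _ (kwalk D sa (fun w => \sum_(z <- P) B * ind z w) x)); last first.
  apply: (kwalk_le ta) => //; first by apply: adm_sum => // z; exact: admZ.
  move=> w _ _; rewrite sum_ind//; case: ifP => [/hb//|_]; exact: k0.
rewrite (kwalk_sum D P x d0' ta); last by move=> z; exact: admZ.
apply: (@le_trans _ _ (\sum_(z <- P) B * (c / S))); last first.
  rewrite big_seq [leRHS]big_seq; apply: ler_sum => z /ha' h.
  by rewrite (kwalkZ D B x ta (ai z)) ler_wpM2l.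
rewrite big_const_seq count_predT iter_addr addr0 -(mulr_natr (B * (c / S))).
have -> : c / 2 * gam ^+ i.+2 / S = B * gam by rewrite /B exprSr; ring.
rewrite -mulrA ler_wpM2l//; apply: le_trans gc _.
apply: (@le_trans _ _ (c / S * (S / 4))).
  by rewrite le_eqVlt; apply/orP; left; apply/eqP; field; rewrite gt_eqF.
by rewrite ler_wpM2l//; pos.
Qed.

End Chaining.

(** * Escape from the boundary *)

Section Escape.
Context {R : realType}.
Implicit Types (d C k H x y z b lo hi M : R) (p : @step R) (s : seq (@step R)).
Implicit Types (g f : R -> R) (N q m : nat) (D : R -> bool).

Lemma kwalk_translate D s f x b :
  kwalk D s f (b + x) = kwalk (fun z => D (b + z)) s (fun z => f (b + z)) x.
Proof.
elim: s x => //= p s ih x; congr (p.1 _); apply/funext => t.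
by rewrite -addrA; case: ifP => // _; rewrite ih.
Qed.

Lemma kwalk_reflect D s f x :
  kwalk D s f x = kwalk (fun z => D (- z)) (map refl s) (fun z => f (- z)) (- x).
Proof.
elim: s x => [|p s ih] x /=; first by rewrite opprK.
congr (p.1 _); apply/funext => t; rewrite opprD !opprK.
by case: ifP => // _; rewrite ih opprD.
Qed.

(** E t = 0 and E |t| >= k / H force a positive part of mean at least k / (2 H);
    values of t below a contribute at most a, values above h at most
    E t^2 / h, so the range [a, h] has probability bounded below. *)
Lemma upstep_exists d C k H : 0 < d -> 0 < C -> 0 < k -> 0 < H ->
  exists a h kap, [/\ 0 < a, a <= h, 0 < kap & forall p, good d C k H 0 p ->
    kap <= p.1 (fun t => if (a <= t) && (t <= h) then 1 else 0)].
Proof.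
move=> d0 C0 k0 H0; pose V := vbound d C; have V0 : 0 < V by rewrite /V /vbound; pos.
pose a := k / (8 * H); pose h := a + 8 * H * V / k.
have a0 : 0 < a by rewrite /a; pos.
have hp : 0 < 8 * H * V / k by pos.
have h0 : 0 < h by rewrite /h; lra.
have kap0 : 0 < k / (4 * H * h) by pos.
exists a, h, (k / (4 * H * h)); split=> //; first by rewrite /h; lra.
move=> p gp; have [sp hC hk _] := gp; have m0 := good0_id gp; have d0' := ltW d0.
set I := fun t => if (a <= t) && (t <= h) then 1 else 0.
have aI : adm d I by apply: (@adm_if _ _ (fun t => (a <= t) && (t <= h))); exact: adm_cst.
have ai : adm d (fun t : R => t) := adm_id d0.
have an : adm d (fun t : R => `|t|) := adm_norm ai.
have aq : adm d (fun t : R => if `|t| <= H then t ^+ 2 else 0).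
  by apply: (@adm_if _ _ (fun t => `|t| <= H)); exact: adm_sqr.
have hab : k <= H * p.1 (fun t => `|t|).
  apply: le_trans hk _; rewrite -(exZ sp)//; apply: (ex_le sp) => //; first exact: admZ.
  move=> t _; case: ifP => h1; last by pos.
  by rewrite -[t ^+ 2]real_normK ?num_real// expr2 ler_wpM2r.
have e1 : p.1 (fun t => 2^-1 * (`|t| + t)) = 2^-1 * p.1 (fun t => `|t|).
  rewrite (exZ sp); last exact: admD.
  by rewrite (exD sp)// (_ : p.1 (fun t => t) = 0) ?addr0.
have h2 : p.1 (fun t => 2^-1 * (`|t| + t)) <= a + h * p.1 I + h^-1 * p.1 (fun t => t ^+ 2).
  rewrite -(ex_cst sp a) -(exZ sp h aI) -(exZ sp h^-1 (adm_sqr d0)).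
  rewrite -(exD sp); [|exact: adm_cst|exact: admZ].
  rewrite -(exD sp); [|by apply: admD; [exact: adm_cst|exact: admZ]|by apply: admZ; exact: adm_sqr].
  apply: (ex_le sp).
  - by apply: admZ; exact: admD.
  - by apply: admD; [apply: admD; [exact: adm_cst|exact: admZ]|apply: admZ; exact: adm_sqr].
  move=> t _; have q0 : 0 <= h^-1 * t ^+ 2 by pos.
  rewrite /I; have [t0|t0] := leP 0 t; last first.
    rewrite (ltr0_norm t0); case: ifP => _; lra.
  rewrite (ger0_norm t0); have [ta|ta] := leP a t => /=; last by lra.
  have [th|th] := leP t h; first by lra.
  suff : t <= h^-1 * t ^+ 2 by lra.
  by rewrite mulrC ler_pdivlMr// expr2 ler_wpM2l// ltW.
have h3 : h^-1 * p.1 (fun t => t ^+ 2) <= a.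
  rewrite mulrC ler_pdivrMr//; apply: (le_trans (var_le sp hC)); rewrite -/(vbound d C) -/V.
  have -> : V = a * (8 * H * V / k) by rewrite /a; field; rewrite !gt_eqF.
  by rewrite ler_wpM2l ?(ltW a0)// /h; lra.
rewrite ler_pdivrMr; last by pos.
have e2 : 8 * H * a = k by rewrite /a; field; rewrite !gt_eqF.
have : H * (2^-1 * p.1 (fun t => `|t|)) <= H * (a + h * p.1 I + a).
  by rewrite ler_wpM2l ?(ltW H0)//; lra.
lra.
Qed.

(** The first steps all go up by an amount between a and h. *)
Lemma kwalk_raise (d kap a h B : R) s lo hi f x : 0 < d -> 0 <= kap -> 0 < a -> a <= h ->
  each (is_step d) s ->
  each (fun p => kap <= p.1 (fun t => if (a <= t) && (t <= h) then 1 else 0)) s ->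
  adm d f -> (forall z, 0 <= f z) -> lo <= x -> x + (size s)%:R * h <= hi -> 0 <= B ->
  (forall z, x + (size s)%:R * a <= z <= x + (size s)%:R * h -> B <= f z) ->
  kap ^+ size s * B <= kwalk (seg lo hi) s f x.
Proof.
move=> d0 k0 a0 ah + + hf f0 + + B0; have d0' := ltW d0.
elim: s x => [|p s ih] x /=.
  by move=> _ _ _ _ hB; rewrite expr0 mul1r; apply: hB; rewrite !mul0r !addr0 lexx.
move=> [sp ss] [kp ks] xlo xhi hB.
have n0 : 0 <= (size s)%:R :> R by rewrite ler0n.
rewrite -natr1 in xhi hB.
have aK : adm d (kwalk (seg lo hi) s f) by exact: adm_kwalk.
pose G := kap ^+ size s * B; have G0 : 0 <= G by rewrite mulr_ge0 ?exprn_ge0.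
have aI : adm d (fun t : R => if (a <= t) && (t <= h) then 1 else 0 : R).
  by apply: (@adm_if _ _ (fun t => (a <= t) && (t <= h))); exact: adm_cst.
apply: (@le_trans _ _ (G * p.1 (fun t => if (a <= t) && (t <= h) then 1 else 0))).
  by rewrite exprSr mulrAC -/G ler_wpM2l.
rewrite -(exZ sp)//; apply: (ex_le sp); [exact: admZ|exact: adm_in|] => t _.
have k1 : 0 <= kwalk (seg lo hi) s f (x + t) by exact: (kwalk_ge0 _ _ ss).
case: ifP => [/andP[ta th]|_]; last by rewrite mulr0; case: ifP.
have nh : 0 <= (size s)%:R * h by rewrite mulr_ge0//; lra.
rewrite mulr1 /seg (_ : _ && _ = true); last by apply/andP; split; lra.
apply: ih => //; [lra|lra|] => z /andP[z1 z2]; apply: hB.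
by apply/andP; split; lra.
Qed.

End Escape.

(** After a bounded number of upward steps the height y is at least 1.  The
    parabola f z = z (M - z) / M starts at f y >= y / 4 and loses at most
    V / M times the expected lifetime, which [ballot] bounds by a multiple of
    y sqrt m: for A large this is at most y / 8.  The strips of width
    eps sqrt m near the ends account for at most
    y / 16, since survival has probability O(y / sqrt m).  The rest is carried
    by the bulk, where f <= M / 4. *)
Lemma escape (R : realType) (d C k H : R) : 0 < d -> 0 < C -> 0 < k -> 0 < H ->
  exists A eps c m0, [/\ 0 < A, 0 < eps, 0 < c & forall (s : seq (@step R)) (x : R), (m0 <= size s)%N ->
    each (good d C k H 0) s ->
    let S := Num.sqrt (size s)%:R in
    0 <= x <= A * S / 2 ->
    c * (x + 1) / S <=
    kwalk (seg 0 (A * S)) s (on (seg (eps * S) (A * S - eps * S))) x].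
Proof.
move=> d0 C0 k0 H0; have d0' := ltW d0.
have [a [h [kap [a0 ah kap0 hup]]]] := upstep_exists d0 C0 k0 H0.
have [K [th1 [K0 th10 hbal]]] := ballot d0 C0 k0 H0.
pose V := vbound d C; have V0 : 0 < V by rewrite /V /vbound; pos.
(* this makes the loss of the parabola at most y / 8 *)
pose A := 32 * V * K + 1; have A0 : 0 < A by rewrite /A; have : 0 < 32 * V * K by [pos]; clra.
(* this makes the contribution of the boundary strips at most y / 16 *)
pose eps := (128 * K)^-1; have e0 : 0 < eps by rewrite /eps; pos.
pose j := (Num.truncn (a^-1)).+1.
have ja : 1 <= j%:R * a.
  have := truncnS_gt (a^-1); rewrite -/j => h1.
  by rewrite -ler_pdivrMr// div1r ltW.
pose c := kap ^+ j / (4 * A).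
have c0 : 0 < c by rewrite /c; pos.
pose m0 := maxn (4 * j)%N (maxn (Num.truncn (4 * th1^-1 ^+ 2)).+1
   (Num.truncn ((4 * j%:R * h / A) ^+ 2)).+1).
exists A, eps, c, m0; split=> // s x.
rewrite !geq_max => /and3P[mj /truncS_le mth /truncS_le mh] gs S /andP[x0 xA].
have hpos : 0 < h := lt_le_trans a0 ah.
have mR : 0 < (size s)%:R :> R by apply: le_lt_trans mh; exact: sqr_ge0.
have S0 : 0 < S by rewrite sqrtr_gt0.
have SS : S ^+ 2 = (size s)%:R by rewrite sqr_sqrtr// ltW.
have ss := good_each gs.
pose s1 := take j s; pose s2 := drop j s.
have e12 : s = s1 ++ s2 by rewrite cat_take_drop.
have js : (j <= size s)%N by apply: leq_trans mj; rewrite leq_pmull.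
have z1 : size s1 = j by rewrite size_takel.
have z2 : size s2 = (size s - j)%N by rewrite size_drop.
have /each_cat[g1 g2] : each (good d C k H 0) (s1 ++ s2) by rewrite -e12.
have t1 := good_each g1; have t2 := good_each g2.
set M := A * S; have M0 : 0 < M by rewrite /M; pos.
set bulk := seg (eps * S) (M - eps * S); set D := seg 0 M.
pose f z := M / 4 - M^-1 * (z - M / 2) ^+ 2.
have fE z : f z = z - z ^+ 2 / M by rewrite /f; field; rewrite gt_eqF.
have fout z : ~~ D z -> f z <= 0.
  rewrite fE /D /seg negb_and -!ltNge => /orP[zz|zz].
    have : 0 <= z ^+ 2 / M by [pos]; move: zz; clra.
  rewrite subr_le0 ler_pdivlMr// expr2 ler_wpM2l//; move: zz M0; clra.
have hjh : j%:R * h <= M / 4.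
  have h1 : 4 * j%:R * h / A <= S by apply: le_sqrtr; [pos|exact: ltW].
  by rewrite ler_pdivrMr// in h1; rewrite /M; move: h1; clra.
pose S2 : R := Num.sqrt (size s2)%:R.
have m2R : (size s)%:R <= 4 * (size s2)%:R :> R.
  by rewrite -natrM ler_nat z2; move: mj js; clear; lia.
have m2p : 0 < (size s2)%:R :> R by move: m2R mR; clra.
have S20 : 0 < S2 by rewrite sqrtr_gt0.
have S2S : S2 ^+ 2 = (size s2)%:R by rewrite sqr_sqrtr// ltW.
have S2le : S2 <= S by rewrite ler_wsqrtr// ler_nat z2 leq_subr.
have S2ge : S <= 2 * S2 by apply: sqrt_half; [exact: ltW|exact: m2R].
have th : 0 < S2^-1 <= th1.
  rewrite invr_gt0 S20 /=; rewrite -[leRHS]invrK lef_pV2 ?posrE ?invr_gt0//.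
  have h1 : 2 * th1^-1 <= S by apply: le_sqrtr; [pos|rewrite exprMn -natrX; exact: ltW].
  by move: h1 S2ge; clra.
have af : adm d f.
  by apply: admB; [exact: adm_cst|apply/admZ/adm_sq].
have aon : adm d (on bulk) by exact: adm_on.
have main y : 1 <= y -> y <= 3 / 4 * M -> y / (4 * M) <= kwalk D s2 (on bulk) y.
  move=> y1 y3; have y0 : 0 <= y by move: y1; clra.
  have Dy : D y by rewrite /D /seg; apply/andP; split=> //; move: y0 y3; clra.
  have mu0 : 0 <= k / 8 * S2^-1 by pos.
  have [b1 b2] := hbal _ 0 th mu0 D s2 y (fun z hz => (andP hz).1) g2 Dy.
  have s2p : (0 < size s2)%N by rewrite -(ltr_nat R).
  have {}b2 := b2 s2p.
  have eb1 : S2^-1 * (size s2)%:R + S2^-1^-1 = 2 * S2.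
    by rewrite -S2S; field; rewrite gt_eqF.
  have eb2 : S2^-1 + ((size s2)%:R * S2^-1)^-1 = 2 / S2.
    by rewrite -S2S; field; rewrite gt_eqF.
  rewrite eb1 in b1; rewrite eb2 in b2.
  have Mi0 : 0 <= M^-1 by pos.
  have sub := kwalk_sub y d0 Mi0 g2 fout; rewrite -/(f y) -/V in sub.
  have loss : M^-1 * V * \sum_(i < size s2) kwalk D (take i s2) (fun=> 1) y <= y / 8.
    apply: (@le_trans _ _ (M^-1 * V * (K * (2 * y) * (2 * S)))).
      rewrite ler_wpM2l//; first by pos.
      apply: le_trans b1 _; apply: ler_pM; [by pos|by pos| |by move: S2le; clra].
      by rewrite ler_wpM2l ?(ltW K0)//; move: y1; clra.
    have -> : M^-1 * V * (K * (2 * y) * (2 * S)) = 4 * V * K * y / A.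
      by rewrite /M; field; rewrite !gt_eqF.
    by rewrite ler_pdivrMr// /A; move: y0; clra.
  have fy : y / 4 <= f y.
    rewrite fE; have : y ^+ 2 / M <= 3 / 4 * y; last by clra.
    by rewrite ler_pdivrMr//; move: y0 y3; clear; nra.
  have up : kwalk D s2 f y <= kwalk D s2 (fun z => eps * S * 1 + M / 4 * on bulk z) y.
    apply: (kwalk_le t2) => //.
      by apply: admD; [apply: admZ; exact: adm_cst|exact: admZ].
    move=> z /andP[zz1 zz2] _; rewrite mulr1 /on /bulk /seg.
    have zM : 0 <= z ^+ 2 / M by pos.
    have [e1|e1] := leP (eps * S) z => /=; last by rewrite fE mulr0; move: zM e1; clra.
    have [e2|e2] := leP z (M - eps * S).
      rewrite mulr1 /f; have : 0 <= M^-1 * (z - M / 2) ^+ 2 by [pos].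
      by have : 0 <= eps * S by [pos]; clra.
    have : z - z ^+ 2 / M = z / M * (M - z) by field; rewrite gt_eqF.
    rewrite fE mulr0 addr0 => ->; apply: (@le_trans _ _ (M - z)); last by move: e2; clra.
    by rewrite ler_piMl ?subr_ge0// ler_pdivrMr// mul1r.
  have a1 : adm d (fun=> eps * S * 1) by exact: adm_cst.
  have a2 : adm d (fun z => M / 4 * on bulk z) by exact: admZ.
  rewrite (kwalkD D y t2 a1 a2) (kwalkZ D (eps * S) y t2 (adm_cst 1 d0')) in up.
  rewrite (kwalkZ D (M / 4) y t2 aon) in up.
  have small : eps * S * kwalk D s2 (fun=> 1) y <= y / 16.
    apply: (@le_trans _ _ (eps * S * (K * (2 * y) * (2 / S2)))).
      rewrite ler_wpM2l//; first by pos.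
      apply: le_trans b2 _; rewrite ler_wpM2r//; first by pos.
      by rewrite ler_wpM2l ?(ltW K0)//; move: y1; clra.
    apply: (@le_trans _ _ (eps * (2 * S2) * (K * (2 * y) * (2 / S2)))).
      by rewrite ler_wpM2r//; [pos|rewrite ler_wpM2l// ltW].
    rewrite le_eqVlt; apply/orP; left; apply/eqP; rewrite /eps; field.
    by rewrite !gt_eqF.
  have fin : y / 16 <= M / 4 * kwalk D s2 (on bulk) y by move: (le_trans sub up) loss fy small; clra.
  by rewrite ler_pdivrMr; [move: fin; clra|pos].
rewrite e12 kwalk_cat.
have Qp : 0 <= (x + 1) / (4 * M) by pos.
have -> : c * (x + 1) / S = kap ^+ size s1 * ((x + 1) / (4 * M)).
  by rewrite z1 /c /M; field; rewrite !gt_eqF.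
apply: (@kwalk_raise _ d kap a h _ s1 0 M _ x d0 (ltW kap0) a0 ah t1) => //.
- by apply: each_imp g1 => p; exact: hup.
- exact: adm_kwalk.
- by move=> z; apply: (kwalk_ge0 D z t2) => // w; exact: on_ge0.
- by rewrite z1; rewrite -/M in xA; move: xA hjh M0; clra.
move=> z; rewrite z1 => /andP[z3 z4]; apply: le_trans (main z _ _).
- by rewrite ler_wpM2r//; [pos|move: ja z3; clra].
- by move: x0 ja z3; clra.
- by rewrite -/M in xA; move: xA hjh z4; clra.
Qed.

(** * Lower bound for the bridge probability *)

Section LowerBound.
Context {R : realType}.
Implicit Types (x y z u v w b lo hi lam : R) (p : @step R) (s : seq (@step R)).
Implicit Types (g f : R -> R) (N q m : nat) (D : R -> bool).

Variables (d C k H kap : R) (xs ys : seq int).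
Hypotheses (d0 : 0 < d) (C0 : 0 < C) (k0 : 0 < k) (H0 : 0 < H) (kap0 : 0 < kap)
  (sxy : size xs = size ys) (Sx : \sum_(j <- xs) j = 0) (Sy : \sum_(j <- ys) j = 1).
Local Notation reg := (regular d C k H kap xs ys).

(** The points at distance at least e from the ends and at most M from x. *)
Definition inner lo hi e x (M : R) : R -> bool :=
  fun z => seg (lo + e) (hi - e) z && (`|z - x| <= M).

(** Near the lower end [escape] is applied in an interval of length A sqrt m that
    starts at lo, or further up when x is far from lo; near the upper end the
    picture is reflected. *)
Lemma start_lower : exists A eps c m0, [/\ 0 < A, 0 < eps, 0 < c &
  forall s x lo hi, (m0 <= size s)%N -> each (good d C k H 0) s ->
    let S := Num.sqrt (size s)%:R in
    2 * (A * S) <= hi - lo -> lo <= x <= hi ->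
    c * (Num.min (Num.min (x - lo) (hi - x)) (A * S / 2) + 1) / S <=
    kwalk (seg lo hi) s (on (inner lo hi (eps * S) x (A * S))) x].
Proof.
have [A [eps [c [m0 [A0 e0 c0 hesc]]]]] := escape d0 C0 k0 H0.
exists A, eps, c, m0; split=> //; have d0' := ltW d0.
have half s x lo hi : (m0 <= size s)%N -> each (good d C k H 0) s ->
    let S := Num.sqrt (size s)%:R in
    2 * (A * S) <= hi - lo -> lo <= x <= (lo + hi) / 2 ->
    c * (Num.min (x - lo) (A * S / 2) + 1) / S <=
    kwalk (seg lo hi) s (on (inner lo hi (eps * S) x (A * S))) x.
  move=> hm gs S hM /andP[x1 x2]; have ss := good_each gs.
  have AS0 : 0 <= A * S by rewrite /S; pos.
  set M := A * S in hM AS0 *.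
  pose b := x - Num.min (x - lo) (M / 2).
  have -> : x = b + Num.min (x - lo) (M / 2) by rewrite /b subrK.
  set x' := Num.min (x - lo) (M / 2).
  have bE : b = x - x' by [].
  have x'0 : 0 <= x' by rewrite le_min; apply/andP; split; lra.
  have x'1 : x' <= x - lo by rewrite ge_min lexx.
  have x'2 : x' <= M / 2 by rewrite ge_min lexx orbT.
  have e : Num.min (b + x' - lo) (M / 2) = x' by rewrite /b subrK.
  rewrite e kwalk_translate.
  have hb : c * (x' + 1) / S <= kwalk (seg 0 M) s (on (seg (eps * S) (M - eps * S))) x'.
    by apply: hesc => //; rewrite x'0.
  apply: (le_trans hb).
  pose F := on (inner lo hi (eps * S) (b + x') M).
  have aF : adm d (fun z => F (b + z)) by apply: (adm_shift b d0'); exact: adm_on.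
  apply: (@le_trans _ _ (kwalk (seg 0 M) s (fun z => F (b + z)) x')).
    apply: (kwalk_le ss) => //; first exact: adm_on.
      by rewrite /seg; apply/andP; split; lra.
    move=> z /andP[z1 z2] _; rewrite /on /F /on; case: ifP => [/andP[z3 z4]|_]; last by case: ifP.
    rewrite (_ : inner _ _ _ _ _ _ = true)// /inner /seg.
    apply/andP; split; [apply/andP; split|rewrite ler_norml; apply/andP; split]; move: bE; lra.
  apply: (kwalk_dom x' ss aF).
    by move=> z; exact: on_ge0.
  by move=> z /andP[z1 z2]; rewrite /seg; apply/andP; split; move: bE; lra.
move=> s x lo hi hm gs S hM /andP[x1 x2].
have S0 : 0 <= S by exact: sqrtr_ge0.
have [xh|hx] := leP x ((lo + hi) / 2).
  apply: le_trans (half s x lo hi hm gs hM _); last by rewrite x1.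
  rewrite ler_wpM2r ?invr_ge0// ler_wpM2l ?(ltW c0)// lerD2r.
  by rewrite le_min; apply/andP; split; rewrite !ge_min lexx ?orbT.
rewrite kwalk_reflect.
have -> : (fun z => seg lo hi (- z)) = seg (- hi) (- lo).
  by apply/funext => z; rewrite /seg lerNr andbC; congr (_ && _); rewrite lerNl.
have -> : (fun z => on (inner lo hi (eps * S) x (A * S)) (- z)) =
    on (inner (- hi) (- lo) (eps * S) (- x) (A * S)).
  apply/funext => z; rewrite /on /inner /seg.
  have -> : `|- z - x| = `|z - - x| by rewrite opprK -normrN opprD !opprK.
  have -> : (lo + eps * S <= - z) = (z <= - lo - eps * S) by rewrite lerNr opprD.
  have -> : (- z <= hi - eps * S) = (- hi + eps * S <= z) by rewrite lerNl opprB addrC.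
  by rewrite [X in if X && _ then _ else _]andbC.
have gs' : each (good d C k H 0) (map refl s).
  by apply/each_map; apply: each_imp gs => p; exact: good_refl.
have := half (map refl s) (- x) (- hi) (- lo); rewrite size_map => /(_ hm gs') hh.
have {}hh := hh ltac:(by rewrite opprK addrC) ltac:(by apply/andP; split; lra).
apply: le_trans hh.
rewrite ler_wpM2r ?invr_ge0// ler_wpM2l ?(ltW c0)// lerD2r.
have -> : - x - - hi = hi - x by ring.
by rewrite le_min; apply/andP; split; rewrite !ge_min lexx ?orbT.
Qed.

Lemma min_scale (u t r z w0 : R) : 0 <= u -> 0 <= t -> 0 <= r -> 0 <= w0 <= 1 -> w0 * r <= z ->
  w0 * (Num.min u (Num.min t r) + 1) <= Num.min (Num.min u t) z + 1.
Proof.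
move=> u0 t0 r0 /andP[w00 w01] rz; rewrite mulrDr mulr1 lerD//.
set a := Num.min u _.
have a0 : 0 <= a by rewrite !le_min u0 t0 r0.
have [a1 a2] : a <= u /\ a <= t by rewrite !ge_min !lexx !orbT.
have a3 : a <= r by rewrite !ge_min lexx !orbT.
rewrite !le_min; apply/andP; split; first by apply/andP; split; nra.
by apply: le_trans rz; rewrite ler_wpM2l.
Qed.

Lemma sqr_twice_add_le (a r : R) : (2 * a + r) * (2 * a + r) <= 8 * (r ^+ 2 + a ^+ 2).
Proof. by have := sqr_ge0 (2 * a - r); have := sqr_ge0 r; lra. Qed.

(** Choose i near 2 K (1 + t) and blocks of length n2 / i.  The condition
    t^3 <= n makes i^2 of smaller order than n, so that the blocks are
    long. *)
Lemma block_count (K t : R) (m1 : nat) : 0 <= K -> exists n0 : nat, forall (n n2 : nat) t,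
  (n0 <= n)%N -> n%:R <= 2 * n2%:R :> R -> 0 <= t -> t ^+ 3 <= n%:R ->
  exists i m : nat, [/\ (0 < i)%N, (m1 <= m)%N, (i * m <= n2 < i.+1 * m)%N,
    2 * K * (1 + t) <= i%:R & i%:R <= (2 * K + 1) * (1 + t)].
Proof.
move=> K0; pose Q : R := 2 * (2 * K + 1) ^+ 2; have Q0 : 2 <= Q by rewrite /Q; nra.
exists (maxn (2 * m1 ^ 2) (Num.truncn (2 * Q * (1 + 16 * Q ^+ 2))).+1) => n n2 {}t.
rewrite geq_max => /andP[n1 /truncS_le nQ] nn2 t0 t3.
pose i := (Num.truncn (2 * K * (1 + t))).+1.
have i1 : 2 * K * (1 + t) <= i%:R by exact/ltW/truncnS_gt.
have i2 : i%:R <= (2 * K + 1) * (1 + t).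
  have : (Num.truncn (2 * K * (1 + t)))%:R <= 2 * K * (1 + t).
    by rewrite truncn_le; pos.
  by rewrite /i -(natr1 (Num.truncn _)); lra.
have ii : (i * i <= n2)%N.
  rewrite -(ler_nat R) natrM.
  have h1 : i%:R * i%:R <= ((2 * K + 1) * (1 + t)) ^+ 2 :> R.
    by rewrite expr2 ler_pM ?ler0n.
  have h2 : ((2 * K + 1) * (1 + t)) ^+ 2 <= Q * (1 + t ^+ 2).
    rewrite exprMn /Q; have := sqr_ge0 (1 - t); have := sqr_ge0 (2 * K + 1); nra.
  have h3 : 2 * Q * (1 + t ^+ 2) <= n%:R.
    have [tQ|tQ] := leP t (4 * Q).
      apply: ltW; apply: le_lt_trans nQ; rewrite ler_wpM2l//; first by lra.
      rewrite lerD2l (_ : 16 * Q ^+ 2 = (4 * Q) ^+ 2); last by ring.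
      by rewrite lerXn2r ?nnegrE//; lra.
    apply: le_trans t3; have t1 : 1 <= t by lra.
    have h5 : 4 * Q * t ^+ 2 <= t ^+ 3 by rewrite exprS ler_wpM2r ?sqr_ge0// ltW.
    have h6 : 1 <= t ^+ 2 by rewrite expr_ge1.
    by apply: le_trans h5; have := ler_wpM2l (_ : 0 <= 2 * Q) h6; rewrite mulr1 => /(_ ltac:(lra)); lra.
  by lra.
have i0 : (0 < i)%N by [].
have im : (i <= n2 %/ i)%N by rewrite leq_divRL.
exists i, (n2 %/ i)%N; split=> //.
- rewrite leq_divRL//; have [mi|im1] := leqP m1 i.
    by apply: leq_trans ii; rewrite leq_mul2r mi orbT.
  have h : (m1 * m1 <= n2)%N.
    have : (2 * m1 ^ 2 <= 2 * n2)%N.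
      by apply: leq_trans n1 _; rewrite -(ler_nat R) natrM.
    by rewrite leq_pmul2l// mulnn.
  by apply: leq_trans h; rewrite leq_mul2l (ltnW im1) orbT.
- rewrite mulnC leq_trunc_div /=; apply: leq_trans (ltn_ceil n2 i0) _.
  by rewrite !mulSn [(_ %/ _ * i)%N]mulnC leq_add2r.
Qed.

End LowerBound.

(** The initial and final pieces have length n1 = eta n, small enough to move the
    walk by at most a quarter of sqrt n.  The middle piece is then covered by
    i blocks of length m, i of order 1 + t with t = (u - v)^2 / n.  The constant K
    is such that i blocks bridge the distance, and that blocks are short
    compared to the margin eps sqrt n1 gained by the ends. *)
Lemma bridge_lower (R : realType) (d C k H kap : R) (xs ys : seq int) :
  0 < d -> 0 < C -> 0 < k -> 0 < H -> 0 < kap -> size xs = size ys ->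
  \sum_(j <- xs) j = 0 -> \sum_(j <- ys) j = 1 ->
  exists Cm cm (n0 : nat), [/\ 0 < Cm, 0 < cm &
  forall (s : seq (@step R)) (u v lam : R), (n0 <= size s)%N ->
  each (regular d C k H kap xs ys) s ->
  let n : R := (size s)%:R in
  Num.sqrt n <= lam -> 0 <= u <= lam -> 0 <= v <= lam ->
  v - u + drift_sum s \is a Num.int -> `|u - v| ^+ 3 <= n ^+ 2 ->
  Cm * (Num.min u (Num.min (lam - u) (Num.sqrt n)) + 1)
     * (Num.min v (Num.min (lam - v) (Num.sqrt n)) + 1)
     / Num.sqrt n ^+ 3 * expR (- (cm * (u - v) ^+ 2 / n))
  <= kwalk (seg 0 lam) s (ind v) u].
Proof.
move=> d0 C0 k0 H0 kap0 sxy Sx Sy.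
have [A [eps [c1 [m0 [A0 e0 c10 hstart]]]]] := start_lower d0 C0 k0 H0.
have [cc [gam [rho [m1 [cc0 /andP[gam0 gam1] rho0 hchain]]]]] :=
  chain_lower k H d0 C0 kap0 sxy Sx Sy.
(* then A sqrt n1 <= sqrt n / 4, and the middle piece keeps at least half of
   the steps *)
pose eta : R := Num.min (1 / 4) (1 / (16 * A ^+ 2)).
have eta0 : 0 < eta by rewrite lt_min; apply/andP; split; pos.
have eta4 : eta <= 1 / 4 by rewrite ge_min lexx.
have etaA : A ^+ 2 * eta <= 1 / 16.
  have : eta <= 1 / (16 * A ^+ 2) by rewrite ge_min lexx orbT.
  by rewrite ler_pdivlMr; [clra|pos].
(* the three terms serve the conditions c_len, c_box and c_rho of the chaining
   lemma *)
pose K : R := 16 + (2 * rho + 1) ^+ 2 + 2 * rho ^+ 2 / (eps ^+ 2 * eta).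
have K1 : 0 <= (2 * rho + 1) ^+ 2 by pos.
have K2 : 0 <= 2 * rho ^+ 2 / (eps ^+ 2 * eta) by pos.
have K0 : 0 <= K by rewrite /K; move: K1 K2; clra.
have [n0 hcount] := block_count 0 m1 K0.
pose w0 := Num.min 1 (A * Num.sqrt (eta / 2) / 2).
have w00 : 0 < w0 by rewrite lt_min; apply/andP; split; pos.
have w01 : w0 <= 1 by rewrite ge_min lexx.
have w02 : w0 <= A * Num.sqrt (eta / 2) / 2 by rewrite ge_min lexx orbT.
pose b := - ln gam; have b0 : 0 <= b by rewrite oppr_ge0 ln_le0.
have gamE : gam = expR (- b) by rewrite opprK lnK.
pose cm := b * (2 * K + 1) + 1.
have cm0 : 0 < cm by rewrite /cm; have : 0 <= b * (2 * K + 1) by [apply: mulr_ge0 => //; move: K0; clra]; clra.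
pose Cm := cc * expR (- (b * (2 * K + 1))) * (c1 * w0) ^+ 2.
have Cm0 : 0 < Cm by rewrite /Cm; pos.
exists Cm, cm, (maxn (maxn n0 1) (maxn (Num.truncn (2 * m0%:R / eta)).+1 (Num.truncn (2 / eta)).+1)); split=> //.
move=> s u v lam; rewrite !geq_max -!andbA => /and4P[hn0 hn1 /truncS_le hm0 /truncS_le hn2] rs n hlam.
move=> /andP[u0 u1] /andP[v0 v1] hlat h3.
have n1' : 1 <= n by rewrite /n ler1n.
have np : 0 < n by move: n1'; clra.
set S := Num.sqrt n in hlam *; have S0 : 0 < S by rewrite sqrtr_gt0.
have SS : S ^+ 2 = n by rewrite sqr_sqrtr// ltW.
have d0' := ltW d0.
pose n1 := Num.truncn (eta * n).
have n1le : n1%:R <= eta * n by rewrite truncn_le; pos.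
have n1ge : eta / 2 * n <= n1%:R.
  have := truncnS_gt (eta * n); rewrite -/n1 -(natr1 n1).
  by rewrite ltr_pdivrMr// in hn2; rewrite -/n in hn2; move: hn2; clra.
have m0n1 : (m0 <= n1)%N.
  by rewrite -(ler_nat R); rewrite ltr_pdivrMr// -/n in hm0; move: hm0 n1ge; clra.
have n1n : (2 * (2 * n1) <= size s)%N.
  by rewrite -(ler_nat R) !natrM -/n; have := ler_wpM2r (ltW np) eta4; move: n1le; clra.
pose n2 := (size s - 2 * n1)%N.
have nn2 : n <= 2 * n2%:R.
  by rewrite /n -natrM ler_nat /n2; move: n1n; clear; lia.
pose t := (u - v) ^+ 2 / n; have t0 : 0 <= t by rewrite /t; pos.
have t3 : t ^+ 3 <= n.
  rewrite /t expr_div_n ler_pdivrMr ?exprn_gt0//.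
  have -> : n * n ^+ 3 = (n ^+ 2) ^+ 2 by ring.
  rewrite -[(u - v) ^+ 2]real_normK ?num_real//.
  have -> : (`|u - v| ^+ 2) ^+ 3 = (`|u - v| ^+ 3) ^+ 2 by ring.
  by rewrite lerXn2r ?nnegrE ?exprn_ge0// ltW.
have [i [m [i0 hm1 him iK1 iK2]]] := hcount (size s) n2 t hn0 nn2 t0 t3.
have /andP[him1 him2] := him.
pose s1 := take n1 s; pose s2 := take n2 (drop n1 s); pose s3 := drop n2 (drop n1 s).
have es : s = s1 ++ s2 ++ s3 by rewrite !cat_take_drop.
have z1 : size s1 = n1 by rewrite size_takel//; move: n1n; clear; lia.
have z2 : size s2 = n2.
  by rewrite size_takel// size_drop /n2; move: n1n; clear; lia.
have z3 : size s3 = n1 by rewrite !size_drop /n2; move: n1n; clear; lia.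
have /each_cat[r1 /each_cat[r2 r3]] : each (regular d C k H kap xs ys) (s1 ++ s2 ++ s3) by rewrite -es.
have g1 := regular_good r1; have g3 := regular_good r3.
have g3' : each (good d C k H 0) (srev s3) by exact: each_srev (@good_refl _ d C k H 0) g3.
pose S1 : R := Num.sqrt n1%:R.
have n1p : 0 < n1%:R :> R by apply: lt_le_trans n1ge; pos.
have S10 : 0 < S1 by rewrite sqrtr_gt0.
have S1S1 : S1 ^+ 2 = n1%:R by rewrite sqr_sqrtr// ltW.
have AS1 : A * S1 <= S / 4.
  rewrite -(ler_pXn2r (_ : 0 < 2)%N) ?nnegrE//; [|by pos|by pos].
  rewrite exprMn expr_div_n S1S1 SS.
  have h : A ^+ 2 * n1%:R <= A ^+ 2 * (eta * n) by rewrite ler_wpM2l// sqr_ge0.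
  have h' : A ^+ 2 * eta * n <= 1 / 16 * n by rewrite ler_wpM2r// ltW.
  by rewrite (_ : 4 ^+ 2 = 16); [move: h h'; clra|rewrite -natrX].
have S1S : S1 <= S.
  rewrite ler_wsqrtr//; apply: le_trans n1le _.
  by have := ler_wpM2r (ltW np) eta4; move: np; clra.
have S1ge : Num.sqrt (eta / 2) * S <= S1.
  by rewrite -sqrtrM; [rewrite ler_wsqrtr|pos].
have wS : w0 * S <= A * S1 / 2.
  apply: (@le_trans _ _ (A * Num.sqrt (eta / 2) / 2 * S)); first by rewrite ler_wpM2r// ltW.
  by have := ler_wpM2l (ltW A0) S1ge; clra.
pose X x := Num.min x (Num.min (lam - x) S) + 1.
have X0 x : 0 <= x -> x <= lam -> 0 <= X x.
  by move=> x0 x1; rewrite addr_ge0// !le_min x0 subr_ge0 x1 ltW.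
pose P1 := inner 0 lam (eps * S1) u (A * S1).
pose P3 := inner 0 lam (eps * S1) v (A * S1).
have w0b : 0 <= w0 <= 1 by rewrite (ltW w00).
have st (sg : seq (@step R)) x (Pr : R -> bool) : size sg = n1 -> each (good d C k H 0) sg ->
    0 <= x -> x <= lam -> Pr = inner 0 lam (eps * S1) x (A * S1) ->
    c1 * w0 * X x / S <= kwalk (seg 0 lam) sg (on Pr) x.
  move=> zg gg x0 x1 ->.
  have h := hstart sg x 0 lam; rewrite zg in h.
  have {}h := h m0n1 gg; rewrite /= -/S1 in h.
  have {}h := h ltac:(by move: AS1 hlam S0; clra) ltac:(by rewrite x0).
  apply: le_trans h; rewrite subr0.
  have lx : 0 <= lam - x by rewrite subr_ge0.
  have := min_scale x0 lx (ltW S0) w0b wS => hmin.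
  apply: ler_pM.
  - by rewrite !mulr_ge0 ?X0// ltW.
  - by rewrite invr_ge0 ltW.
  - by rewrite -mulrA ler_wpM2l// ltW.
  - by rewrite lef_pV2.
have st1 := st s1 u P1 z1 g1 u0 u1 erefl.
have st3 := st (srev s3) v P3 (etrans (size_srev s3) z3) g3' v0 v1 erefl.
have iR : 0 < i%:R :> R by rewrite ltr0n.
have iR1 : 1 <= i%:R :> R by rewrite ler1n.
have n2p : 0 < n2%:R :> R by move: nn2 np; clra.
have n2n : n2%:R <= n by rewrite /n ler_nat leq_subr.
have mi1 : i%:R * m%:R <= n2%:R :> R by rewrite -natrM ler_nat.
have mi2 : n2%:R <= 2 * (i%:R * m%:R) :> R.
  rewrite -!natrM ler_nat; apply: leq_trans (ltnW him2) _.
  by rewrite mulSn mul2n -addnn leq_add2r leq_pmull.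
have mp : 0 < m%:R :> R.
  have : 0 < i%:R * m%:R :> R by move: mi2 n2p; clra.
  by rewrite pmulr_rgt0.
pose Sm : R := Num.sqrt m%:R; have Sm0 : 0 < Sm by rewrite sqrtr_gt0.
have SmSm : Sm ^+ 2 = m%:R by rewrite sqr_sqrtr// ltW.
have iK : 2 * K <= i%:R.
  have : 0 <= 2 * K * t by apply: mulr_ge0 => //; apply: mulr_ge0.
  by move: iK1; clra.
have tn : t * n = (u - v) ^+ 2 by rewrite /t divfK// gt_eqF.
have c_len : 2 * `|u - v| + S <= i%:R * Sm.
  rewrite -(ler_pXn2r (_ : 0 < 2)%N) ?nnegrE//; [|by pos|by pos].
  rewrite exprMn SmSm expr2.
  have h1 : 8 * (n + (u - v) ^+ 2) <= i%:R * i%:R * m%:R.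
    rewrite -tn -mulrA; apply: (@le_trans _ _ (2 * K * (1 + t) * (n / 4))).
      have : 16 * (n * (1 + t)) <= K * (n * (1 + t)).
        rewrite ler_wpM2r//; first by rewrite mulr_ge0 ?addr_ge0// ltW.
        by rewrite /K; move: K1 K2; clra.
      by clra.
    apply: ler_pM => //; first by rewrite !mulr_ge0 ?addr_ge0.
      by rewrite divr_ge0// ltW.
    by move: mi2 nn2; clra.
  apply: le_trans h1; apply: le_trans (sqr_twice_add_le _ _) _.
  by rewrite SS real_normK ?num_real.
have c_box : (2 * rho + 1) * Sm <= lam - 0.
  rewrite subr0; apply: le_trans hlam.
  rewrite -(ler_pXn2r (_ : 0 < 2)%N) ?nnegrE//; [|by pos|by pos].
  rewrite exprMn SmSm SS; apply: le_trans (le_trans mi1 n2n).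
  by rewrite ler_wpM2r ?ltW//; move: iK K1 K2; rewrite /K; clra.
have c_rho : rho * Sm <= eps * S1.
  rewrite -(ler_pXn2r (_ : 0 < 2)%N) ?nnegrE//; [|by pos|by pos].
  rewrite !exprMn SmSm S1S1.
  have h1 : 2 * rho ^+ 2 / (eps ^+ 2 * eta) <= i%:R.
    by move: iK K1 K2; rewrite /K; clra.
  rewrite ler_pdivrMr in h1; last by pos.
  have h2 : 2 * rho ^+ 2 * m%:R <= eps ^+ 2 * eta * n.
    apply: le_trans (ler_wpM2r (ltW mp) h1) _.
    have h4 : eps ^+ 2 * eta * (i%:R * m%:R) <= eps ^+ 2 * eta * n.
      rewrite ler_wpM2l//; last exact: le_trans mi1 n2n.
      by rewrite mulr_ge0 ?sqr_ge0// ltW.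
    by move: h4; clra.
  have h3' : eps ^+ 2 * (eta / 2 * n) <= eps ^+ 2 * n1%:R by rewrite ler_wpM2l// sqr_ge0.
  by move: h2 h3'; clra.
pose q := cc * gam ^+ i / Sm; have q0 : 0 <= q by rewrite /q; pos.
have hq y w : seg 0 lam y -> seg 0 lam w -> P1 y -> P3 w -> w - y + drift_sum s2 \is a Num.int ->
    q <= kwalk (seg 0 lam) s2 (ind w) y.
  move=> _ _ /andP[/andP[y1 y2] y3] /andP[/andP[w1 w2] w3] hwy.
  apply: (hchain i m s2 y w 0 lam hm1 i0) => //.
  - by rewrite z2.
  - rewrite ler_norml -/Sm; move: y3 w3; rewrite !ler_norml => /andP[y4 y5] /andP[w4 w5].
    have a1 := ler_norm (u - v); have a2 := ler_norm (- (u - v)); rewrite normrN in a2.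
    by apply/andP; split; move: c_len AS1 y4 y5 w4 w5 a1 a2; clra.
  - by rewrite -/Sm; apply/andP; split; move: c_rho y1 y2; clra.
  - by rewrite -/Sm; apply/andP; split; move: c_rho w1 w2; clra.
have hlat' : v - u + drift_sum (s1 ++ s2 ++ s3) \is a Num.int by rewrite -es.
have Du : seg 0 lam u by rewrite /seg u0.
have Dv : seg 0 lam v by rewrite /seg v0.
have := kwalk_three_ge d0 (good_each g1) (regular_step r2) (good_each g3) Du Dv q0 hlat' hq.
rewrite -es; apply: le_trans.
have SmS : Sm <= S.
  rewrite ler_wsqrtr//; apply: le_trans (le_trans mi1 n2n).
  by rewrite ler_peMl// ltW.
have gi : expR (- (b * (2 * K + 1))) * expR (- (cm * t)) <= gam ^+ i.
  rewrite gamE -expRM_natl -expRD ler_expR.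
  have h1 := ler_wpM2l b0 iK2; rewrite /cm; move: h1 t0; clra.
have hqq : cc * (expR (- (b * (2 * K + 1))) * expR (- (cm * t))) / S <= q.
  apply: ler_pM.
  - by pos.
  - by rewrite invr_ge0 ltW.
  - by rewrite ler_wpM2l// ltW.
  - by rewrite lef_pV2.
have Xu := X0 u u0 u1; have Xv := X0 v v0 v1.
have Y1 : 0 <= c1 * w0 * X u / S by rewrite !mulr_ge0 ?invr_ge0// ltW.
have Y3 : 0 <= c1 * w0 * X v / S by rewrite !mulr_ge0 ?invr_ge0// ltW.
apply: le_trans (ler_pM _ Y3 (ler_pM _ Y1 hqq st1) st3).
- rewrite -/(X u) -/(X v) (_ : cm * (u - v) ^+ 2 / n = cm * t); last by rewrite /t -[LHS]mulrA.
  rewrite le_eqVlt; apply/orP; left; apply/eqP; rewrite /Cm; field.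
  by rewrite gt_eqF.
- by apply: mulr_ge0 => //; pos.
- by pos.
Qed.

(** * Exponential tilting *)

(** The law with density proportional to exp (th t), still centred at the
    original mean, so that the lattice of the walk is unchanged. *)
Definition tilt (R : realType) (th : R) (p : @step R) : step :=
  (fun g => p.1 (fun t => expR (th * t) * g t) / p.1 (fun t => expR (th * t)), p.2).

Section Tilt.
Context {R : realType}.
Implicit Types (d C k H mu x y z u v w : R) (p : @step R) (s : seq (@step R)).
Implicit Types (g f : R -> R) (D : R -> bool).
Variables (d C k H kap th : R).
Hypotheses (d0 : 0 < d) (C0 : 0 < C) (k0 : 0 < k) (kap0 : 0 < kap) (thd : `|th| <= d / 2).

Let d20 : 0 < d / 2. Proof. by rewrite divr_gt0. Qed.
Let d0' : 0 <= d. Proof. exact: ltW. Qed.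
Let dd : d / 2 + d / 2 = d. Proof. by lra. Qed.
Let thd' : `|th| <= d. Proof. by apply: le_trans thd _; rewrite ler_pdivrMr// ler_peMr// ler1n. Qed.

Lemma adm_tilt g : adm (d / 2) g -> adm d (fun t => expR (th * t) * g t).
Proof. by move=> hg; have := adm_mulexp thd hg; rewrite dd. Qed.

Let ae : adm d (fun t => expR (th * t)). Proof. exact: adm_exp. Qed.

Lemma tilt_norm_ge1 p : good d C k H 0 p -> 1 <= p.1 (fun t => expR (th * t)).
Proof.
move=> gp; have sp := good_step gp.
have ai : adm d (fun t : R => th * t) by exact/admZ/adm_id.
have -> : 1 = p.1 (fun t => 1 + th * t).
  rewrite (exD sp)//; last exact: adm_cst.
  by rewrite (ex_cst sp) (exZ sp th (adm_id d0)) (good0_id gp) mulr0 addr0.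
apply: (ex_le sp) => //; first by apply: admD => //; exact: adm_cst.
by move=> t _; exact: expR_ge1Dx.
Qed.

Lemma exp_lin_le t : `|th * t| <= d / 2 * `|t|.
Proof. by rewrite normrM ler_wpM2r. Qed.

Lemma tilt_norm_le p : good d C k H 0 p -> p.1 (fun t => expR (th * t)) <= C.
Proof.
move=> [sp hC _ _]; apply: le_trans hC; apply: (ex_le sp) => //; first exact: adm_expabs.
move=> t _; rewrite ler_expR; apply: le_trans (ler_norm _) _.
by rewrite normrM ler_wpM2r.
Qed.

Definition tilt_var := 8 / d ^+ 2 * C.

Lemma sqr_exp_le t : t ^+ 2 * expR `|th * t| <= 8 / d ^+ 2 * expR (d * `|t|).
Proof.
have h1 := sqr_le_expR t d20.
have h2 : expR `|th * t| <= expR (d / 2 * `|t|) by rewrite ler_expR exp_lin_le.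
have -> : 8 / d ^+ 2 * expR (d * `|t|) = 2 / (d / 2) ^+ 2 * expR (d / 2 * `|t|) * expR (d / 2 * `|t|).
  rewrite -[RHS]mulrA -expRD -mulrDl dd; congr (_ * _); field.
  by rewrite gt_eqF.
by apply: ler_pM => //; rewrite ?sqr_ge0 ?expR_ge0.
Qed.

(** The step is centred, so its Laplace transform is 1 + O(th^2). *)
Lemma tilt_norm_quad p : good d C k H 0 p ->
  p.1 (fun t => expR (th * t)) <= expR (tilt_var * th ^+ 2).
Proof.
move=> gp; have [sp hC _ _] := gp.
apply: (@le_trans _ _ (1 + tilt_var * th ^+ 2)); last exact: expR_ge1Dx.
have ai : adm d (fun t : R => th * t) by exact/admZ/adm_id.
apply: (@le_trans _ _ (p.1 (fun t => (1 + th * t) + th ^+ 2 * (8 / d ^+ 2) * expR (d * `|t|)))).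
  have a1 : adm d (fun t => 1 + th * t) by apply: admD => //; exact: adm_cst.
  apply: (ex_le sp) => //; first by apply: admD => //; exact/admZ/adm_expabs.
  move=> t _; have := expR_sub1x_le (th * t); have := ler_wpM2l (sqr_ge0 th) (sqr_exp_le t).
  by rewrite exprMn; move: (expR _) (expR _) (expR _) => *; lra.
have a1 : adm d (fun t => 1 + th * t) by apply: admD => //; exact: adm_cst.
rewrite (exD sp)//; last exact/admZ/adm_expabs.
rewrite (exD sp)//; last exact: adm_cst.
rewrite (ex_cst sp) (exZ sp _ (adm_id d0)) (good0_id gp) mulr0 addr0 lerD2l.
rewrite (exZ sp); last exact: adm_expabs.
rewrite /tilt_var [leRHS]mulrC -[leLHS]mulrA ler_wpM2l ?sqr_ge0// ler_wpM2l//.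
by pos.
Qed.

(** Half of the exponential moment absorbs the density.  The mean becomes
    O(th). *)
Lemma good_tilt p : good d C k H 0 p ->
  good (d / 2) C (expR (- (d / 2 * H)) * k / C) H (tilt_var * `|th|) (tilt th p).
Proof.
move=> gp; have [sp hC hk _] := gp.
have Z1 := tilt_norm_ge1 gp; have ZC := tilt_norm_le gp.
have Z0 : 0 < p.1 (fun t => expR (th * t)) by apply: lt_le_trans Z1.
split.
- split=> //=.
  + rewrite (_ : (fun t => expR (th * t) * 1) = (fun t => expR (th * t))) ?divff ?gt_eqF//.
    by apply/funext => t; rewrite mulr1.
  + move=> f g hf hg; rewrite -mulrDl; congr (_ / _).
    rewrite -(exD sp); [|exact: adm_tilt..].
    by congr (p.1 _); apply/funext => t; rewrite mulrDr.
  + move=> c f hf; rewrite mulrA; congr (_ / _).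
    rewrite -(exZ sp); last exact: adm_tilt.
    by congr (p.1 _); apply/funext => t; rewrite mulrCA.
  + move=> f g hf hg h; rewrite ler_wpM2r ?invr_ge0 ?(ltW Z0)//.
    apply: (ex_le sp); [exact: adm_tilt..|] => t ht.
    by rewrite ler_wpM2l ?expR_ge0// h.
- rewrite /tilt /= ler_pdivrMr//; apply: (@le_trans _ _ C).
    apply: le_trans hC; apply: (ex_le sp); [apply: adm_tilt; exact: adm_expabs|exact: adm_expabs|].
    move=> t _; rewrite -expRD ler_expR -[in leRHS]dd mulrDl lerD2r.
    by apply: le_trans (ler_norm _) _; exact: exp_lin_le.
  by rewrite ler_peMr// ltW.
- rewrite /tilt /= ler_pM ?invr_ge0 ?mulr_ge0 ?expR_ge0 ?(ltW C0) ?(ltW k0)//; last by rewrite lef_pV2.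
  apply: (@le_trans _ _ (expR (- (d / 2 * H)) * p.1 (fun t => if `|t| <= H then t ^+ 2 else 0))).
    by rewrite ler_wpM2l ?expR_ge0.
  have aq e : 0 < e -> adm e (fun t : R => if `|t| <= H then t ^+ 2 else 0).
    by move=> he; apply: (@adm_if _ _ (fun t => `|t| <= H)); exact: adm_sqr.
  rewrite -(exZ sp); last exact: aq.
  apply: (ex_le sp); [by apply: admZ; exact: aq|by apply: adm_tilt; exact: aq|].
  move=> t _; case: ifP => tH; last by rewrite !mulr0.
  rewrite ler_wpM2r ?sqr_ge0// ler_expR lerNl -mulNr.
  apply: (@le_trans _ _ `|- th * t|); first exact: ler_norm.
  rewrite mulNr normrN; apply: le_trans (exp_lin_le t) _.
  by rewrite ler_wpM2l ?(ltW d20).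
- have ai2 : adm (d / 2) (fun t : R => t) by exact: adm_id.
  rewrite /tilt /= normrM (ger0_norm (_ : 0 <= (p.1 _)^-1)) ?invr_ge0 ?(ltW Z0)//.
  rewrite ler_pdivrMr//; apply: (@le_trans _ _ (tilt_var * `|th|)); last first.
    by rewrite ler_peMr// mulr_ge0// /tilt_var; pos.
  have ai : adm d (fun t : R => t) by exact: adm_id.
  have at' : adm d (fun t : R => expR (th * t) * t) by exact: adm_tilt.
  have -> : p.1 (fun t => expR (th * t) * t) = p.1 (fun t => expR (th * t) * t - t).
    by rewrite (exB sp)// (_ : p.1 (fun t => t) = 0) ?subr0//; exact: good0_id gp.
  apply: le_trans (ex_norm sp _) _; first exact: admB.
  apply: (@le_trans _ _ (p.1 (fun t => `|th| * (8 / d ^+ 2) * expR (d * `|t|)))); last first.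
    rewrite (exZ sp); last exact: adm_expabs.
    rewrite /tilt_var [leRHS]mulrC -[leLHS]mulrA ler_wpM2l// ler_wpM2l//.
    by pos.
  apply: (ex_le sp); [by apply: adm_norm; exact: admB|exact/admZ/adm_expabs|].
  move=> t _; have -> : expR (th * t) * t - t = (expR (th * t) - 1) * t by rewrite mulrBl mul1r.
  rewrite normrM; apply: (@le_trans _ _ (`|th * t| * expR `|th * t| * `|t|)).
    by rewrite ler_wpM2r// expR_sub1_le.
  have := sqr_exp_le t; rewrite -[t ^+ 2]real_normK ?num_real// => h.
  by rewrite {1}normrM; have := ler_wpM2l (normr_ge0 th) h; lra.
Qed.

(** An atom of mass kap lies at a distance where exp (d |t0|) <= C / kap, so its
    density is bounded below. *)
Lemma mass_tilt js p : good d C k H 0 p -> mass kap js p -> mass (kap ^+ 2 / C ^+ 2) js (tilt th p).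
Proof.
move=> gp mp j hj; have [sp hC _ _] := gp; have hm := mp j hj.
have Z1 := tilt_norm_ge1 gp; have ZC := tilt_norm_le gp.
have Z0 : 0 < p.1 (fun t => expR (th * t)) by apply: lt_le_trans Z1.
rewrite /tilt /=; set t0 := j%:~R - p.2 in hm *.
have -> : (fun t => expR (th * t) * ind t0 t) = (fun t => expR (th * t0) * ind t0 t).
  by apply/funext => t; rewrite /ind; case: eqVneq => [->|]; rewrite ?mulr0.
rewrite (exZ sp); last exact: adm_ind.
have hE : expR (d * `|t0|) * kap <= C.
  apply: le_trans hC; apply: (@le_trans _ _ (expR (d * `|t0|) * p.1 (ind t0))).
    by rewrite ler_wpM2l ?expR_ge0.
  rewrite -(exZ sp); last exact: adm_ind.
  apply: (ex_le sp); [by apply: admZ; exact: adm_ind|exact: adm_expabs|].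
  by move=> t _; rewrite /ind; case: eqVneq => [->|]; rewrite ?mulr1 ?mulr0 ?expR_ge0.
have hl : kap / C <= expR (th * t0).
  rewrite ler_pdivrMr//; apply: (@le_trans _ _ (expR (- (d * `|t0|)) * C)).
    rewrite expRN mulrC ler_pdivlMr ?expR_gt0//; by rewrite mulrC.
  rewrite ler_wpM2r ?(ltW C0)// ler_expR lerNl -mulNr; apply: le_trans (ler_norm _) _.
  by rewrite mulNr normrN normrM ler_wpM2r.
have -> : kap ^+ 2 / C ^+ 2 = kap / C * kap / C by field; rewrite gt_eqF.
apply: ler_pM => //; [by pos|by pos| |by rewrite lef_pV2].
by apply: ler_pM => //; pos.
Qed.

(** The densities multiply along a path to a function of its endpoints. *)
Lemma kwalk_tilt D s v x : each (good d C k H 0) s ->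
  kwalk D s (ind v) x =
  (\prod_(p <- s) p.1 (fun t => expR (th * t))) * expR (th * (x - v)) *
    kwalk D (map (tilt th) s) (ind v) x.
Proof.
elim: s x => [|p s ih] x /=.
  move=> _; rewrite big_nil mul1r /ind; case: eqVneq => [->|]; rewrite ?mulr0//.
  by rewrite subrr mulr0 expR0 mulr1.
move=> [gp gs]; have sp := good_step gp; have Z1 := tilt_norm_ge1 gp.
have Z0 : 0 < p.1 (fun t => expR (th * t)) by apply: lt_le_trans Z1.
set P := \prod_(p <- s) _ in ih.
have ts : each (is_step (d / 2)) (map (tilt th) s).
  by apply/each_map; apply: each_imp gs => p' /good_tilt/good_step.
set K := kwalk D (map (tilt th) s) (ind v) in ih *.
have aK : adm (d / 2) K by apply: adm_kwalk ts _; exact/adm_ind/ltW.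
rewrite big_cons -/P /kstep /tilt /=.
have aT : adm d (fun t => expR (th * t) * (if D (x + t) then K (x + t) else 0)).
  by apply: adm_tilt; exact: (adm_in D x (ltW d20) aK).
transitivity (p.1 (fun t => P * expR (th * (x - v)) *
   (expR (th * t) * (if D (x + t) then K (x + t) else 0)))).
  congr (p.1 _); apply/funext => t; case: ifP => _; last by rewrite !mulr0.
  rewrite ih// -mulrA -[RHS]mulrA; congr (_ * _); rewrite mulrA -expRD; congr (expR _ * _).
  by ring.
rewrite (exZ sp)//; field; rewrite gt_eqF//.
Qed.

End Tilt.

(** * Upper bound for the bridge probability *)

Lemma third_bounds n : (12 <= n)%N ->
  [/\ n <= 4 * (n %/ 3), n <= 4 * (n - 2 * (n %/ 3)) & 2 * (n %/ 3) <= n]%N.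
Proof. by move=> h; split; lia. Qed.

Lemma seg_flip (R : realType) (lam : R) : 
  (fun z => seg 0 lam (- (- lam + z))) = seg 0 lam.
Proof.
apply/funext => z; rewrite /seg opprD opprK.
by rewrite subr_ge0 gerBl andbC.
Qed.

Lemma kwalk_flip (R : realType) (lam : R) s x :
  kwalk (seg 0 lam) s (fun=> 1) x = kwalk (seg 0 lam) (map refl s) (fun=> 1) (lam - x).
Proof.
have := kwalk_translate (fun z => seg 0 lam (- z)) (map refl s) (fun=> 1) (lam - x) (- lam).
by rewrite seg_flip => <-; rewrite kwalk_reflect; congr (kwalk _ _ _ _); ring.
Qed.

(** [ballot] from both ends of the interval; the third term of the minimum comes
    from the trivial bound 1. *)
Lemma survival_upper (R : realType) (d C k H : R) : 0 < d -> 0 < C -> 0 < k -> 0 < H ->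
  exists K th1, [/\ 0 < K, 0 < th1 & forall th mu (n : nat), 0 < th <= th1 ->
    mu <= k / 8 * th -> 1 <= Num.sqrt n%:R * th ->
    forall lam s x, 0 <= x <= lam -> (n <= 4 * size s)%N -> each (good d C k H mu) s ->
    kwalk (seg 0 lam) s (fun=> 1) x <=
      K * (Num.min x (Num.min (lam - x) (Num.sqrt n%:R)) + 1) * th].
Proof.
move=> d0 C0 k0 H0; have [K [th1 [K0 th10 hb]]] := ballot d0 C0 k0 H0.
exists (5 * K + 1), th1; split; [by pos|by []|].
move=> th mu n tht hmu nth lam s x /andP[x0 x1] ns gs.
have /andP[th0 _] := tht; have d0' := ltW d0.
have np : 0 < n%:R :> R.
  rewrite ltr0n lt0n; apply/negP => /eqP n0; move: nth; rewrite n0 sqrtr0 mul0r.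
  by rewrite ler10.
have nth2 : 1 <= n%:R * th ^+ 2.
  rewrite -[n%:R]sqr_sqrtr ?ler0n// -exprMn; exact: exprn_ege1.
have sR : n%:R <= 4 * (size s)%:R :> R by rewrite -natrM ler_nat.
have sp : 0 < (size s)%:R :> R by move: sR np; clra.
have s0 : (0 < size s)%N by rewrite -(ltr_nat R).
have hth : th + ((size s)%:R * th)^-1 <= 5 * th.
  have : ((size s)%:R * th)^-1 <= 4 * th.
    rewrite -[leLHS]mul1r ler_pdivrMr ?mulr_gt0//.
    have := ler_wpM2r (sqr_ge0 th) sR; move: nth2; clra.
  by clra.
have bound y (t : seq (@step R)) : seg 0 lam y -> size t = size s -> each (good d C k H mu) t ->
    kwalk (seg 0 lam) t (fun=> 1) y <= 5 * K * (y + 1) * th.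
  move=> Dy zt gt; have [_] := hb th mu tht hmu (seg 0 lam) t y (fun z hz => (andP hz).1) gt Dy.
  rewrite zt => /(_ s0) h; apply: le_trans h _.
  have y0 : 0 <= y by case/andP: Dy.
  have : 0 <= K * (y + 1) by apply: mulr_ge0; [exact: ltW|rewrite addr_ge0].
  by move=> hy; have := ler_wpM2l hy hth; clra.
have Dx : seg 0 lam x by rewrite /seg x0.
have b1 := bound x s Dx erefl gs.
have Dx' : seg 0 lam (lam - x) by rewrite /seg subr_ge0 x1 gerBl.
have gs' : each (good d C k H mu) (map refl s).
  by apply/each_map; apply: each_imp gs => p; exact: good_refl.
have b2 := bound (lam - x) (map refl s) Dx' (size_map _ _) gs'.
rewrite -kwalk_flip in b2.
have b3 : kwalk (seg 0 lam) s (fun=> 1) x <= 1 by exact: kwalk_le1 d0' (good_each gs) Dx.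
set P := kwalk _ _ _ _ in b1 b2 b3 *; set S := Num.sqrt n%:R in nth *.
have key y : 0 <= y -> (P <= 5 * K * (y + 1) * th \/ y = S) -> P <= (5 * K + 1) * (y + 1) * th.
  move=> y0 [h|->].
    have : 0 <= (y + 1) * th by apply: mulr_ge0; [rewrite addr_ge0|exact: ltW].
    by move: h; clra.
  have S0 : 0 <= S by exact: sqrtr_ge0.
  have : 0 <= 5 * K * ((S + 1) * th) by pos.
  by move: b3 nth th0; clra.
apply: key; first by rewrite !le_min x0 subr_ge0 x1 sqrtr_ge0.
rewrite /Num.min; case: ltP => _; first by left.
by case: ltP => _; [left|right].
Qed.

(** Lets a fraction of the Gaussian factor absorb the polynomial factor 1 + t. *)
Lemma poly_le_expR (R : realType) (e t : R) : 0 < e -> 0 <= t ->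
  1 + t <= (1 + 4 / e) * expR (e * t / 4).
Proof.
move=> e0 t0; have h := expR_ge1Dx (e * t / 4).
have e1 : 1 <= expR (e * t / 4) by apply: le_trans h; rewrite lerDl; pos.
have : t <= 4 / e * expR (e * t / 4).
  rewrite mulrAC ler_pdivlMr//; move: h; clra.
by move: e1; clra.
Qed.

(** The survival estimate is used with th' = 1 / sqrt n + |u - v| / n, large
    enough for the drift of order |u - v| / n of the tilted steps.  Its square
    is at most 2 (1 + (u - v)^2 / n) / n, and part of the Gaussian factor absorbs
    the numerator. *)
Lemma bridge_upper (R : realType) (d C k H kap : R) (xs ys : seq int) :
  0 < d -> 0 < C -> 0 < k -> 0 < H -> 0 < kap -> size xs = size ys ->
  \sum_(j <- xs) j = 0 -> \sum_(j <- ys) j = 1 ->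
  exists Cp cp (n0 : nat), [/\ 0 < Cp, 0 < cp &
  forall (s : seq (@step R)) (u v lam : R), (n0 <= size s)%N ->
  each (regular d C k H kap xs ys) s ->
  let n : R := (size s)%:R in
  0 <= u <= lam -> 0 <= v <= lam -> `|u - v| ^+ 3 <= n ^+ 2 ->
  kwalk (seg 0 lam) s (ind v) u <=
  Cp * (Num.min u (Num.min (lam - u) (Num.sqrt n)) + 1)
     * (Num.min v (Num.min (lam - v) (Num.sqrt n)) + 1)
     / Num.sqrt n ^+ 3 * expR (- (cp * (u - v) ^+ 2 / n))].
Proof.
move=> d0 C0 k0 H0 kap0 sxy Sx Sy.
have d20 : 0 < d / 2 by pos.
pose k' := expR (- (d / 2 * H)) * k / C; have k'0 : 0 < k' by rewrite /k'; pos.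
pose kap' := kap ^+ 2 / C ^+ 2; have kap'0 : 0 < kap' by rewrite /kap'; pos.
have [K [th1 [K0 th10 hsurv]]] := survival_upper d20 C0 k'0 H0.
have [U U0 hU] := llt_upper d20 kap'0 sxy Sx Sy.
pose W := tilt_var d C; have W0 : 0 < W by rewrite /W /tilt_var; pos.
(* the tilt is admissible, costs at most half of what it gains, and creates a
   drift that the survival estimate allows *)
pose e1 := Num.min (d / 2) (Num.min (1 / (2 * W)) (k' / (8 * W))).
have e10 : 0 < e1 by rewrite !lt_min; apply/and3P; split; pos.
have e1d : e1 <= d / 2 by rewrite ge_min lexx.
have e1W : e1 * W <= 1 / 2.
  have : e1 <= 1 / (2 * W) by rewrite !ge_min lexx !orbT.
  by rewrite ler_pdivlMr; [clra|pos].
have e1k : e1 * W <= k' / 8.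
  have : e1 <= k' / (8 * W) by rewrite !ge_min lexx !orbT.
  by rewrite ler_pdivlMr; [clra|pos].
pose Cp := 2 * U * K ^+ 2 * 2 * (1 + 4 / e1); have Cp0 : 0 < Cp by rewrite /Cp; pos.
exists Cp, (e1 / 4), (maxn 12 (maxn (Num.truncn ((2 / th1) ^+ 2)).+1 (Num.truncn ((2 / th1) ^+ 3)).+1)).
split=> //; first by pos.
move=> s u v lam; rewrite !geq_max => /and3P[n12 /truncS_le hn2 /truncS_le hn3] rs n.
move=> /andP[u0 u1] /andP[v0 v1] h3.
have n1' : 1 <= n by rewrite /n ler1n (leq_trans _ n12).
have np : 0 < n by move: n1'; clra.
set S := Num.sqrt n; have S0 : 0 < S by rewrite sqrtr_gt0.
have SS : S ^+ 2 = n by rewrite sqr_sqrtr// ltW.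
have S1 : 1 <= S by apply: le_sqrtr => //; rewrite expr1n.
set X := `|u - v| in h3 *; have X0 : 0 <= X by exact: normr_ge0.
have Xn : X <= n.
  rewrite -(ler_pXn2r (_ : 0 < 3)%N) ?nnegrE ?X0 ?(ltW np)//; apply: le_trans h3 _.
  by rewrite [leRHS]exprS ler_peMl// sqr_ge0.
pose th := e1 * (v - u) / n.
have thE : `|th| = e1 * (X / n).
  by rewrite /th normrM normfV (gtr0_norm np) normrM (gtr0_norm e10) distrC mulrA.
have Xn1 : X / n <= 1 by rewrite ler_pdivrMr// mul1r.
have Xn0 : 0 <= X / n by rewrite divr_ge0// ltW.
have thd : `|th| <= d / 2.
  by rewrite thE; apply: le_trans e1d; rewrite ler_piMr// ltW.
pose th' := S^-1 + X / n.
have Si0 : 0 < S^-1 by rewrite invr_gt0.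
have th'0 : 0 < th' by rewrite /th' ltr_wpDr.
have th'1 : th' <= th1.
  have a1 : S^-1 <= th1 / 2.
    rewrite -[leRHS]invrK lef_pV2 ?posrE ?invr_gt0//; last by pos.
    by rewrite invf_div; apply: le_sqrtr; [pos|exact: ltW].
  have a2 : X / n <= th1 / 2.
    have t20 : 0 <= th1 / 2 by pos.
    rewrite -(ler_pXn2r (_ : 0 < 3)%N) ?nnegrE//.
    rewrite expr_div_n; apply: (@le_trans _ _ (n ^+ 2 / n ^+ 3)).
      by rewrite ler_wpM2r// invr_ge0 exprn_ge0// ltW.
    have -> : n ^+ 2 / n ^+ 3 = n^-1 by field; rewrite gt_eqF.
    rewrite -[leRHS]invrK lef_pV2 ?posrE ?invr_gt0//; last by pos.
    by rewrite -exprVn invf_div; exact: ltW.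
  by rewrite /th'; move: a1 a2; clra.
have hth : 0 < th' <= th1 by rewrite th'0.
pose mu := tilt_var d C * `|th|.
have hmu : mu <= k' / 8 * th'.
  rewrite /mu -/W thE; apply: (@le_trans _ _ (k' / 8 * (X / n))).
    by rewrite mulrA ler_wpM2r// mulrC.
  by rewrite ler_wpM2l//; [pos|rewrite /th' lerDr ltW].
have nth : 1 <= Num.sqrt (size s)%:R * th'.
  rewrite -/n -/S /th' mulrDr mulfV ?gt_eqF// lerDl; apply: mulr_ge0 => //; exact: ltW.
pose ts := map (tilt th) s.
have gts : each (good (d / 2) C k' H mu) ts.
  apply/each_map; apply: each_imp rs => p [gp _]; exact: good_tilt.
have mts : each (mass kap' (xs ++ ys)) ts.
  by apply/each_map; apply: each_imp rs => p [gp mp]; exact: (mass_tilt d0 C0 kap0 thd gp mp).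
have zts : size ts = size s by rewrite size_map.
have [l1 l2 l3] := third_bounds n12.
pose n1 := (size s %/ 3)%N.
pose s1 := take n1 ts; pose r := drop n1 ts.
pose s2 := take (size s - 2 * n1) r; pose s3 := drop (size s - 2 * n1) r.
have es : ts = s1 ++ s2 ++ s3 by rewrite !cat_take_drop.
have z1 : size s1 = n1 by rewrite size_takel// zts; move: l3; rewrite -/n1; clear; lia.
have z2 : size s2 = (size s - 2 * n1)%N.
  by rewrite size_takel// size_drop zts; move: l3; rewrite -/n1; clear; lia.
have z3 : size s3 = n1 by rewrite !size_drop zts; move: l3; rewrite -/n1; clear; lia.
have /each_cat[g1 /each_cat[g2 g3]] : each (good (d / 2) C k' H mu) (s1 ++ s2 ++ s3) by rewrite -es.
have /each_cat[_ /each_cat[m2 _]] : each (mass kap' (xs ++ ys)) (s1 ++ s2 ++ s3) by rewrite -es.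
have g3' : each (good (d / 2) C k' H mu) (srev s3).
  by exact: each_srev (@good_refl _ (d / 2) C k' H mu) g3.
pose Y x := Num.min x (Num.min (lam - x) S) + 1.
have Y0 x : 0 <= x -> x <= lam -> 0 <= Y x.
  by move=> x0 x1; rewrite addr_ge0// !le_min x0 subr_ge0 x1 ltW.
have Du : seg 0 lam u by rewrite /seg u0.
have Dv : seg 0 lam v by rewrite /seg v0.
have b1 : kwalk (seg 0 lam) s1 (fun=> 1) u <= K * Y u * th'.
  by apply: (hsurv th' mu (size s)) => //; rewrite z1.
have b3 : kwalk (seg 0 lam) (srev s3) (fun=> 1) v <= K * Y v * th'.
  by apply: (hsurv th' mu (size s)) => //; rewrite size_srev z3.
pose q := 2 * U / S; have q0 : 0 <= q by rewrite /q; pos.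
have t2 := good_each g2.
have hq y w : seg 0 lam y -> seg 0 lam w -> kwalk (seg 0 lam) s2 (ind w) y <= q.
  move=> _ _; have ai : adm (d / 2) (ind w) by exact/adm_ind/ltW.
  apply: (le_trans (kwalk_trim (seg 0 lam) y d20 t2 ai (ind_ge0 w))).
  have s2p : (0 < size s2)%N by rewrite z2; move: l2 n12; rewrite -/n1; clear; lia.
  apply: (le_trans (hU _ y w s2p t2 m2)).
  have sp : 0 < Num.sqrt (size s2)%:R :> R by rewrite sqrtr_gt0 ltr0n.
  have hs : S <= 2 * Num.sqrt (size s2)%:R.
    by apply: sqrt_half; [exact: ler0n|rewrite -natrM ler_nat z2].
  rewrite /q ler_pdivrMr// mulrAC ler_pdivlMr//.
  by have := ler_wpM2l (ltW U0) hs; clra.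
have main := kwalk_three_le d20 (good_each g1) t2 (good_each g3) Du Dv q0 hq.
rewrite -es in main.
rewrite (kwalk_tilt d0 C0 k0 thd (seg 0 lam) v u (regular_good rs)) -/ts.
set Q := kwalk (seg 0 lam) ts (ind v) u in main *.
pose t := (u - v) ^+ 2 / n; have t0 : 0 <= t by rewrite /t divr_ge0 ?sqr_ge0// ltW.
have prod0 l : each (good d C k H 0) l -> 0 <= \prod_(p <- l) p.1 (fun t => expR (th * t)).
  elim: l => [|p l ih] /=; first by rewrite big_nil.
  move=> [gp /ih h]; rewrite big_cons mulr_ge0//; apply: ltW.
  exact: lt_le_trans (tilt_norm_ge1 d0 thd gp).
have prodW : \prod_(p <- s) p.1 (fun t => expR (th * t)) <= expR (W * th ^+ 2 * n).
  rewrite /n mulr_natr; have := regular_good rs; elim: (s) => [|p s' ih] /=.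
    by rewrite big_nil mulr0n expR0.
  move=> [gp gs']; rewrite big_cons mulrS expRD; apply: ler_pM.
  - by apply: ltW; apply: lt_le_trans (tilt_norm_ge1 d0 thd gp).
  - exact: prod0.
  - exact: (tilt_norm_quad d0 thd gp).
  - exact: ih.
have thn : th * (u - v) = - (e1 * t) by rewrite /th /t; field; rewrite gt_eqF.
have thn2 : W * th ^+ 2 * n = e1 * W * (e1 * t).
  by rewrite /th /t; field; rewrite gt_eqF.
have ex : (\prod_(p <- s) p.1 (fun t => expR (th * t))) * expR (th * (u - v)) <= expR (- (e1 * t / 2)).
  apply: (@le_trans _ _ (expR (W * th ^+ 2 * n) * expR (th * (u - v)))).
    by rewrite ler_wpM2r ?expR_ge0.
  rewrite -expRD ler_expR thn thn2.
  have : 0 <= e1 * t by apply: mulr_ge0 => //; exact: ltW.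
  by move=> h; have := ler_wpM2r h e1W; clra.
have th2 : th' ^+ 2 <= 2 * (1 + t) / n.
  have tX : t = X ^+ 2 / n by rewrite /t /X real_normK ?num_real.
  have eS : (S^-1) ^+ 2 = n^-1 by rewrite exprVn SS.
  have eX : (X / n) ^+ 2 = t / n by rewrite tX; field; rewrite gt_eqF.
  have := sqr_ge0 (S^-1 - X / n); rewrite /th'.
  have -> : (S^-1 - X / n) ^+ 2 = 2 * (S^-1 ^+ 2 + (X / n) ^+ 2) - (S^-1 + X / n) ^+ 2 by ring.
  rewrite eS eX; have -> : 2 * (1 + t) / n = 2 * (n^-1 + t / n) by ring.
  by clra.
have Q0 : 0 <= Q.
  apply: (kwalk_ge0 (seg 0 lam) u (good_each gts)); first exact/adm_ind/ltW.
  exact: ind_ge0.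
have Yu := Y0 u u0 u1; have Yv := Y0 v v0 v1.
have hQ : Q <= q * (K * Y u * th') * (K * Y v * th').
  apply: le_trans main _; apply: ler_pM => //.
  - apply: mulr_ge0 => //; apply: (kwalk_ge0 _ _ (good_each g1)) => //.
    exact/adm_cst/ltW.
  - apply: (kwalk_ge0 _ _ (good_each g3')) => //; exact/adm_cst/ltW.
  - by rewrite ler_wpM2l.
apply: (@le_trans _ _ (expR (- (e1 * t / 2)) * Q)); first by rewrite ler_wpM2r.
apply: (@le_trans _ _ (expR (- (e1 * t / 2)) * (q * K ^+ 2 * (Y u * Y v) * (2 * ((1 + 4 / e1) * expR (e1 * t / 4)) / n)))).
  rewrite ler_wpM2l ?expR_ge0//; apply: le_trans hQ _.
  have -> : q * (K * Y u * th') * (K * Y v * th') = q * K ^+ 2 * (Y u * Y v) * th' ^+ 2 by ring.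
  have c0 : 0 <= q * K ^+ 2 * (Y u * Y v).
    by apply: mulr_ge0; [apply: mulr_ge0 => //; exact: sqr_ge0|exact: mulr_ge0].
  rewrite ler_wpM2l//; apply: le_trans th2 _.
  rewrite ler_wpM2r ?invr_ge0 ?(ltW np)// ler_wpM2l//; exact: poly_le_expR.
have ee : expR (- (e1 * t / 2)) * expR (e1 * t / 4) = expR (- (e1 / 4 * t)).
  by rewrite -expRD; congr expR; field.
rewrite -/(Y u) -/(Y v) (_ : e1 / 4 * (u - v) ^+ 2 / n = e1 / 4 * t); last by rewrite /t -[LHS]mulrA.
rewrite -ee /Cp /q -SS le_eqVlt; apply/orP; left; apply/eqP; field.
by rewrite !gt_eqF.
Qed.

(** * Support of an irreducible aperiodic law *)

Section Support.
Context {R : realType}.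
Variable (p : probability int R).

(** n points of the support of p with sum z. *)
Definition reach (n : nat) (z : int) : Prop := exists js : seq int,
  [/\ size js = n, \sum_(j <- js) j = z & forall j, j \in js -> (0 < p [set j])%E].

Lemma reachD n m z w : reach n z -> reach m w -> reach (n + m) (z + w).
Proof.
move=> [js [sj zj pj]] [ks [sk zk pk]]; exists (js ++ ks); split.
- by rewrite size_cat sj sk.
- by rewrite big_cat zj zk.
- by move=> j; rewrite mem_cat => /orP[/pj|/pk].
Qed.

Lemma reach0 : reach 0 0.
Proof. by exists [::]; split=> //; rewrite big_nil. Qed.

Lemma reachM n z q : reach n z -> reach (q * n) (z *+ q).
Proof.
move=> h; elim: q => [|q ih]; first by rewrite mul0n mulr0n; exact: reach0.
by rewrite mulSn mulrS; exact: reachD.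
Qed.

Lemma trans_iter_ge0 n x y : (0 <= trans_iter (walk_trans p) n x y)%E.
Proof.
elim: n x => [|n ih] x /=; first by rewrite lee_fin ler0n.
by apply: esum_ge0 => z _; rewrite mule_ge0.
Qed.

(** A positive sum has a positive term; the intermediate states give the points
    of the support one by one. *)
Lemma trans_iter_reach n x y : (0 < trans_iter (walk_trans p) n x y)%E -> reach n (y - x).
Proof.
elim: n x => [|n ih] x /=.
  by rewrite lte_fin; case: eqVneq => [->|]; rewrite ?ltxx// subrr => _; exact: reach0.
move=> h; have [[z hz]|hno] := pselect (exists z, (0 < walk_trans p x z * trans_iter (walk_trans p) n z y)%E).
  have t0 := trans_iter_ge0 n z y; have p0 : (0 <= walk_trans p x z)%E by exact: measure_ge0.
  have pz : (0 < walk_trans p x z)%E.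
    rewrite lt0e p0 andbT; apply/negP => /eqP e; by rewrite e mul0e ltxx in hz.
  have tz : (0 < trans_iter (walk_trans p) n z y)%E.
    rewrite lt0e t0 andbT; apply/negP => /eqP e; by rewrite e mule0 ltxx in hz.
  have r1 : reach 1 (z - x).
    by exists [:: z - x]; split=> //; rewrite ?big_seq1// => j; rewrite inE => /eqP ->.
  have := reachD r1 (ih z tz); rewrite add1n (_ : z - x + (y - z) = y - x)//; by ring.
move: h; rewrite esum1 ?ltxx// => z _; apply/eqP; rewrite eq_le; apply/andP; split.
  by rewrite leNgt; apply/negP => hz; apply: hno; exists z.
by rewrite mule_ge0 ?trans_iter_ge0.
Qed.

(** A difference of two lengths of loops at 0. *)
Definition loop_diff (g : nat) : Prop := exists b, reach (b + g) 0 /\ reach b 0.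

(** Let g be the least positive difference of loop lengths.  Euclidean division
    shows that g divides every loop length, so g = 1 by aperiodicity. *)
Lemma loop_diff1 : irreducible_law p -> aperiodic_law p -> loop_diff 1.
Proof.
move=> irr ap.
have [n hn] := irr 0 1; have rn := trans_iter_reach hn.
have [m hm] := irr 1 0; have rm := trans_iter_reach hm.
have n0 : (0 < n)%N.
  case: n hn rn => // _ [js [/size0nil -> ]]; by rewrite big_nil subr0.
have r0 : reach (n + m) 0 by have := reachD rn rm; rewrite subr0 sub0r addrN.
have ex : exists g, (0 < g)%N && `[< loop_diff g >].
  (* the loop through 1 differs from the empty loop by its length *)
  by exists (n + m)%N; rewrite addn_gt0 n0; apply/asboolP; exists 0%N; split; [|exact: reach0].
have [g /andP[g0 /asboolP[b [rbg rb]]] gmin] := ex_minnP ex.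
suff -> : (1 = g)%N by exists b.
apply/esym/(ap 0) => l l0 /trans_iter_reach; rewrite subrr => rl.
apply/eqP; case: (posnP (l %% g)) => // r0'; exfalso.
have : (g <= l %% g)%N; last by rewrite leqNgt ltn_mod g0.
apply: gmin; rewrite r0'; apply/asboolP; exists (l %/ g * (b + g))%N; split.
  have -> : (l %/ g * (b + g) + l %% g = l + l %/ g * b)%N.
    by rewrite mulnDr -addnA -divn_eq addnC.
  have := reachD rl (reachM (l %/ g) rb); by rewrite mul0rn addr0.
by have := reachM (l %/ g) rbg; rewrite mul0rn.
Qed.

(** Loops of lengths b + 1 and b, each repeated n times, differ in length by n;
    the shorter one is completed by a path of length n from 0 to 1. *)
Lemma unit_shift : irreducible_law p -> aperiodic_law p -> exists xs ys : seq int,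
  [/\ size xs = size ys, \sum_(j <- xs) j = 0, \sum_(j <- ys) j = 1 &
      forall j, j \in xs ++ ys -> (0 < p [set j])%E].
Proof.
move=> irr ap; have [b [rb1 rb]] := loop_diff1 irr ap.
have [n hn] := irr 0 1; have := trans_iter_reach hn; rewrite subr0 => rn.
have [xs [sx zx px]] := reachM n rb1.
have [ys [sy zy py]] := reachD (reachM n rb) rn.
exists xs, ys; split.
- by rewrite sx sy mulnDr muln1.
- by rewrite zx mul0rn.
- by rewrite zy mul0rn add0r.
- by move=> j; rewrite mem_cat => /orP[/px|/py].
Qed.

End Support.

Lemma support_of_seq (R : realType) (a : int -> R) : irreducible_aperiodic_seq a ->
  exists xs ys : seq int, [/\ size xs = size ys, \sum_(j <- xs) j = 0,
    \sum_(j <- ys) j = 1 & forall j, j \in xs ++ ys -> 0 < a j].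
Proof.
move=> [p [b [irr ap b0 ab]]]; have [xs [ys [sxy Sx Sy pos]]] := unit_shift irr ap.
exists xs, ys; split=> // j /pos pj.
by rewrite -lte_fin ab mule_gt0// lte_fin.
Qed.

(** Otherwise all the points are equal and the two sums, having the same number
    of terms, agree. *)
Lemma two_support_points (xs ys : seq int) : size xs = size ys ->
  \sum_(j <- xs) j = 0 -> \sum_(j <- ys) j = 1 ->
  exists i j, [/\ i \in xs ++ ys, j \in xs ++ ys & i != j].
Proof.
move=> sxy Sx Sy; set l := xs ++ ys; pose c := head 0 ys.
have cl : c \in l.
  rewrite /l mem_cat /c; case: (ys) Sy => [|y ys' _]; first by rewrite big_nil.
  by rewrite /= inE eqxx orbT.
case: (boolP (all (pred1 c) l)) => [/allP h|/allPn[j jl jc]]; last by exists c, j; split=> //; rewrite eq_sym.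
exfalso; have cst (s : seq int) : {subset s <= l} -> \sum_(j <- s) j = c *+ size s.
  move=> sl; have -> : \sum_(j <- s) j = \sum_(j <- s) c.
    by rewrite big_seq [RHS]big_seq; apply: eq_bigr => j /sl/h/eqP.
  by rewrite big_const_seq count_predT iter_addr addr0.
move: Sx Sy; rewrite !cst; first by rewrite sxy => ->.
- by move=> i ii; rewrite mem_cat ii orbT.
- by move=> i ii; rewrite mem_cat ii.
Qed.

Lemma uniform_positive (R : realType) (a : int -> R) (l : seq int) :
  (forall j, j \in l -> 0 < a j) -> exists2 kap, 0 < kap & forall j, j \in l -> kap <= a j.
Proof.
elim: l => [|i l ih] h; first by exists 1.
have [kap k0 hk] := ih (fun j jl => h j (mem_behead (s := i :: l) jl)).
exists (Num.min kap (a i)); first by rewrite lt_min k0 h// mem_head.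
by move=> j; rewrite inE ge_min => /orP[/eqP ->|/hk ->]; rewrite ?lexx ?orbT.
Qed.

Section IntLaw.
Context {R : realType}.

Lemma measurable_int (A : set int) : measurable A.
Proof. by []. Qed.

Lemma measurable_fun_int (d : measure_display) (T : measurableType d) (D : set int)
    (f : int -> T) : measurable_fun D f.
Proof. by move=> _ Y _; exact: measurable_int. Qed.

Lemma integral_int (p : probability int R) (f : int -> \bar R) : (forall k, 0 <= f k)%E ->
  (\int[p]_k f k = \esum_(k in setT) (p [set k] * f k))%E.
Proof.
move=> f0; pose F (n : nat) : set int := [set x | pickle x = n].
have UF : \bigcup_n F n = setT by apply/seteqP; split=> // x _; exists (pickle x).
have tF : trivIset setT F by move=> i j _ _ [x [<- <-]].
rewrite -UF esum_bigcupT//; last by move=> x; rewrite mule_ge0.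
rewrite ge0_integral_bigcup//.
rewrite nneseries_esumT; last by move=> n; apply: integral_ge0 => x _.
apply: eq_esum => n _; have [[x Fx]|no] := pselect (exists x, F n x); last first.
  rewrite (_ : F n = set0) ?integral_set0 ?esum_set0//.
  by apply/seteqP; split=> // x Fx; apply: no; exists x.
have -> : F n = [set x].
  apply/seteqP; split=> y /=; last by move=> ->.
  by move=> Fy; apply: (pcan_inj pickleK); rewrite Fy Fx.
rewrite esum_set1; last by rewrite mule_ge0.
rewrite (eq_integral (cst (f x))); last by move=> y; rewrite inE /= => ->.
by rewrite integral_cst// muleC.
Qed.

End IntLaw.

(** * Steps of integer random variables *)

Section StepOfRV.
Context {R : realType} {d : measure_display} {T : measurableType d}.
Variables (P : probability T R) (X : {RV P >-> int}).

Definition rv_mean : R := fine ('E_P[fun w => (X w)%:~R])%E.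

Definition rv_step : @step R := (fun g => \int[P]_w g ((X w)%:~R - rv_mean), rv_mean).

Lemma measurable_of_int (h : int -> R) : measurable_fun setT (EFin \o (fun w => h (X w))).
Proof.
have mX : measurable_fun setT X by exact: measurable_funPT.
exact: (measurableT_comp (measurable_fun_int (EFin \o h)) mX).
Qed.

Variables (dl c : R) (a : int -> R).
Hypotheses (dl0 : 0 < dl) (lawX : law_class dl c a (distribution P X)).

Lemma mgf_le t : `|t| <= dl -> (\int[P]_w (expR (t * (X w)%:~R))%:E <= c%:E)%E.
Proof.
move=> tdl; have [h _] := lawX.
apply: le_trans h; apply: ereal_sup_ubound; exists t => //.
have e0 k : (0 <= (expR (t * k%:~R))%:E :> \bar R)%E by rewrite lee_fin expR_ge0.
rewrite -(integral_int _ (f := fun k => (expR (t * k%:~R))%:E))//.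
by rewrite ge0_integral_distribution//; exact: measurable_fun_int.
Qed.

Lemma integrable_exp t : `|t| <= dl ->
  P.-integrable setT (fun w => (expR (t * (X w)%:~R))%:E).
Proof.
move=> tdl; apply/integrableP; split.
  exact: (measurable_of_int (fun k => expR (t * k%:~R))).
rewrite (eq_integral (fun w => (expR (t * (X w)%:~R))%:E)); last first.
  by move=> w _; rewrite gee0_abs// lee_fin expR_ge0.
by apply: le_lt_trans (mgf_le tdl) _; rewrite ltry.
Qed.

(** Dominates exp (dl |X|). *)
Definition mgf2 (w : T) : R := expR (dl * (X w)%:~R) + expR (- dl * (X w)%:~R).

Lemma integrable_mgf2 : P.-integrable setT (EFin \o mgf2).
Proof.
rewrite (_ : EFin \o mgf2 = (fun w => (expR (dl * (X w)%:~R))%:E) \+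
  (fun w => (expR (- dl * (X w)%:~R))%:E))%E; last first.
  by apply/funext => w; rewrite /= /mgf2 EFinD.
by apply: integrableD => //; apply: integrable_exp; rewrite ?normrN ger0_norm// ltW.
Qed.

Lemma exp_abs_le (m : R) w :
  expR (dl * `|(X w)%:~R - m|) <= expR (dl * `|m|) * mgf2 w.
Proof.
have dl0' := ltW dl0.
apply: (@le_trans _ _ (expR (dl * `|m|) * expR (dl * `|(X w)%:~R : R|))).
  rewrite -expRD ler_expR -mulrDr ler_wpM2l//.
  by apply: le_trans (ler_normB _ _) _; rewrite addrC.
rewrite ler_wpM2l ?expR_ge0// /mgf2.
have [x0|x0] := leP 0 ((X w)%:~R : R).
  by rewrite ger0_norm// lerDl expR_ge0.
by rewrite ltr0_norm// mulrN -mulNr lerDr expR_ge0.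
Qed.

Lemma integrable_adm (m : R) (g : R -> R) : adm dl g ->
  P.-integrable setT (fun w => (g ((X w)%:~R - m))%:E).
Proof.
move=> /adm_pos[A [A0 hA]].
have hi : P.-integrable setT (fun w => ((A * expR (dl * `|m|)) * mgf2 w)%:E).
  rewrite (_ : (fun w => _) = (fun w => (A * expR (dl * `|m|))%:E * (EFin \o mgf2) w)%E); last first.
    by apply/funext => w; rewrite /= EFinM.
  exact: (integrableZl measurableT _ integrable_mgf2).
apply: (le_integrable measurableT _ _ hi).
  exact: (measurable_of_int (fun k => g (k%:~R - m))).
move=> w _; rewrite !abse_EFin lee_fin; apply: le_trans (hA _) _.
apply: le_trans (ler_norm _); rewrite -mulrA ler_wpM2l//; exact: exp_abs_le.
Qed.

Lemma rint_le (m : R) (f g : R -> R) : adm dl f -> adm dl g ->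
  (forall w, f ((X w)%:~R - m) <= g ((X w)%:~R - m)) ->
  \int[P]_w f ((X w)%:~R - m) <= \int[P]_w g ((X w)%:~R - m).
Proof.
move=> hf hg h; apply: le_Rintegral => //; exact: integrable_adm.
Qed.

Lemma rint_cst (r : R) : \int[P]_w r = r.
Proof.
have e : fine (P setT) = 1 by have := congr1 fine (probability_setT P).
by rewrite Rintegral_cst// -[RHS]mulr1; congr (_ * _).
Qed.

Lemma rv_is_step : is_step dl rv_step.
Proof.
split=> //=.
- exact: rint_cst.
- by move=> f g hf hg; rewrite RintegralD//; exact: integrable_adm.
- by move=> r f hf; rewrite RintegralZl//; exact: integrable_adm.
- move=> f g hf hg h; apply: rint_le => // w; apply: h.
  by rewrite subrK intr_int.
Qed.

Lemma mgf2_le : \int[P]_w mgf2 w <= 2 * c.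
Proof.
have i1 := integrable_exp (_ : `|dl| <= dl); have i2 := integrable_exp (_ : `|- dl| <= dl).
have h1 : `|dl| <= dl by rewrite ger0_norm// ltW.
have h2 : `|- dl| <= dl by rewrite normrN.
rewrite RintegralD//; [|exact: i1|exact: i2].
have fl t : `|t| <= dl -> \int[P]_w expR (t * (X w)%:~R) <= c.
  move=> ht; rewrite -lee_fin; apply: le_trans (mgf_le ht).
  by rewrite /Rintegral fineK// integrable_fin_num//; exact: integrable_exp.
by rewrite mulr_natl mulr2n; apply: lerD; exact: fl.
Qed.

Lemma rv_mean_int : rv_mean = \int[P]_w (X w)%:~R.
Proof. by rewrite /rv_mean unlock. Qed.

Lemma rv_mean_le : `|rv_mean| <= 2 * c / dl.
Proof.
have ii := integrable_adm 0 (adm_id dl0).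
have ii' : P.-integrable setT (EFin \o (fun w => ((X w)%:~R : R))).
  rewrite (_ : _ \o _ = fun w => ((X w)%:~R - 0 : R)%:E)//.
  by apply/funext => w /=; rewrite subr0.
rewrite rv_mean_int; apply: (le_trans (le_normr_Rintegral _ ii')) => //.
have im : P.-integrable setT (EFin \o (fun w => dl^-1 * mgf2 w)).
  rewrite (_ : _ \o _ = (fun w => dl^-1%:E * (EFin \o mgf2) w)%E); last first.
    by apply/funext => w; rewrite /= EFinM.
  exact: (integrableZl measurableT _ integrable_mgf2).
apply: (@le_trans _ _ (\int[P]_w (dl^-1 * mgf2 w))).
  apply: le_Rintegral => //.
    have := integrable_adm 0 (adm_norm (adm_id dl0)).
    by rewrite (_ : (fun w => _) = EFin \o (fun w => `|(X w)%:~R|))//; apply/funext => w /=; rewrite subr0.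
  move=> w _; apply: le_trans (abs_le_expR _ dl0) _.
  rewrite ler_wpM2l ?invr_ge0 ?(ltW dl0)//.
  by have := exp_abs_le 0 w; rewrite subr0 normr0 mulr0 expR0 mul1r.
rewrite RintegralZl//; last exact: integrable_mgf2.
by rewrite mulrC ler_wpM2r ?invr_ge0 ?(ltW dl0)// mgf2_le.
Qed.

Lemma rv_mass (j : int) : fine (P (X @^-1` [set j])) = rv_step.1 (ind (j%:~R - rv_step.2)).
Proof.
rewrite /=; have mA : measurable (X @^-1` [set j]) by exact: measurable_funPTI.
rewrite (@eq_Rintegral _ _ _ P setT (\1_(X @^-1` [set j]))).
  by rewrite /Rintegral integral_indic// setIT.
move=> w _; rewrite /ind indicE; congr ((nat_of_bool _)%:R); apply/idP/idP.
  by move=> /eqP/addIr/intr_inj e; rewrite inE /= e.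
by rewrite inE /= => ->.
Qed.

Lemma rv_mass_ge (j : int) : a j <= rv_step.1 (ind (j%:~R - rv_step.2)).
Proof.
have [_ /(_ j)] := lawX; rewrite -rv_mass /distribution /pushforward => h.
by rewrite -lee_fin fineK// fin_num_measure//; exact: measurable_funPTI.
Qed.

Lemma rv_mean_zero : rv_step.1 id = 0.
Proof.
rewrite /= RintegralB//.
- by rewrite rint_cst rv_mean_int subrr.
- have := integrable_adm 0 (adm_id dl0).
  by rewrite (_ : (fun w => _) = EFin \o (fun w => ((X w)%:~R : R)))//; apply/funext => w /=; rewrite subr0.
- exact: finite_measure_integrable_cst.
Qed.

End StepOfRV.

(** The exponential moment bounds the mean, hence the centred moment.  Two distinct
    support points, each of mass at least kap, give the truncated variance. *)
Lemma rv_regular (R : realType) (dl c : R) (a : int -> R) (xs ys : seq int) :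
  0 < c -> 0 < dl -> size xs = size ys -> \sum_(j <- xs) j = 0 -> \sum_(j <- ys) j = 1 ->
  (forall j, j \in xs ++ ys -> 0 < a j) ->
  exists C k H kap : R, [/\ 0 < C, 0 < k, 0 < H, 0 < kap &
    forall (d : measure_display) (T : measurableType d) (P : probability T R)
      (X : {RV P >-> int}), law_class dl c a (distribution P X) ->
      regular dl C k H kap xs ys (rv_step X)].
Proof.
move=> c0 dl0 sxy Sx Sy a0.
have [kap kap0 hkap] := uniform_positive a0.
have [i [j [ixy jxy ij]]] := two_support_points sxy Sx Sy.
pose M := 2 * c / dl; have M0 : 0 < M by rewrite /M; pos.
pose C := expR (dl * M) * (2 * c); have C0 : 0 < C by rewrite /C; pos.
pose H : R := `|i%:~R| + `|j%:~R| + M.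
have H0 : 0 < H by rewrite /H; have := normr_ge0 (i%:~R : R); have := normr_ge0 (j%:~R : R); lra.
exists C, (kap / 2), H, kap; split=> //; first by pos.
move=> d T P X lX; have sp := rv_is_step dl0 lX; have mM := rv_mean_le dl0 lX.
have ms : mass kap (xs ++ ys) (rv_step X).
  by move=> l lxy; apply: le_trans (hkap l lxy) _; exact: rv_mass_ge lX l.
split=> //; split=> //.
- have hm := rv_mean_le dl0 lX.
  apply: (@le_trans _ _ (\int[P]_w (expR (dl * M) * mgf2 X dl w))).
    apply: le_Rintegral => //.
    + exact: (integrable_adm dl0 lX (rv_mean X) (adm_expabs dl)).
    + rewrite (_ : _ \o _ = (fun w => (expR (dl * M))%:E * (EFin \o mgf2 X dl) w)%E); last first.
        by apply/funext => w; rewrite /= EFinM.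
      exact: (integrableZl measurableT _ (integrable_mgf2 dl0 lX)).
    + move=> w _; apply: le_trans (exp_abs_le X dl0 _ w) _.
      rewrite ler_wpM2r ?ler_expR ?ler_wpM2l ?(ltW dl0)//.
      by rewrite addr_ge0 ?expR_ge0.
  rewrite RintegralZl//; last exact: (integrable_mgf2 dl0 lX).
  by rewrite ler_wpM2l ?expR_ge0// (mgf2_le dl0 lX).
- set t1 : R := i%:~R - (rv_step X).2; set t2 : R := j%:~R - (rv_step X).2.
  have t12 : 1 <= `|t1 - t2|.
    rewrite (_ : t1 - t2 = (i - j)%:~R); last by rewrite /t1 /t2 rmorphB /=; ring.
    rewrite -intr_norm.
    by rewrite -[1]/(1%:~R) ler_int -gtz0_ge1 normr_gt0 subr_eq0.
  have t1H : `|t1| <= H.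
    apply: le_trans (ler_normB _ _) _; rewrite /H -addrA lerD2l.
    by have := normr_ge0 (j%:~R : R); move: mM; rewrite /= /M; lra.
  have t2H : `|t2| <= H.
    apply: le_trans (ler_normB _ _) _; rewrite /H.
    by have := normr_ge0 (i%:~R : R); move: mM; rewrite /= /M; lra.
  have aq : adm dl (fun t : R => if `|t| <= H then t ^+ 2 else 0).
    by apply: (@adm_if _ _ (fun t => `|t| <= H)); exact: adm_sqr.
  have ai z : adm dl (ind z) by apply: adm_ind; exact: ltW.
  apply: (@le_trans _ _ ((rv_step X).1 (fun t => t1 ^+ 2 * ind t1 t + t2 ^+ 2 * ind t2 t))).
    rewrite (exD sp); [|exact: admZ..]; rewrite (exZ sp _ (ai t1)) (exZ sp _ (ai t2)).
    have h1 := ler_wpM2l (sqr_ge0 t1) (ms i ixy); have h2 := ler_wpM2l (sqr_ge0 t2) (ms j jxy).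
    apply: le_trans (lerD h1 h2); rewrite -mulrDl mulrC ler_wpM2r ?(ltW kap0)//.
    have : 1 <= (t1 - t2) ^+ 2.
      by rewrite -[(t1 - t2) ^+ 2]real_normK ?num_real// expr_ge1.
    by have := sqr_ge0 (t1 + t2); lra.
  apply: (ex_le sp) => //; first by apply: admD; exact: admZ.
  move=> t _; rewrite /ind; have [->|n1] := eqVneq t t1.
    rewrite t1H; case: eqVneq => [e|_]; last by rewrite mulr1 mulr0 addr0.
    by move: t12; rewrite e subrr normr0 ler10.
  have [->|n2] := eqVneq t t2; first by rewrite t2H mulr0 mulr1 add0r.
  by rewrite !mulr0 addr0; case: ifP => // _; exact: sqr_ge0.
- by rewrite (rv_mean_zero dl0 lX) normr0.
Qed.

(** * Independence turns path probabilities into operator products *)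

Section Link.
Context {R : realType} {d : measure_display} {T : measurableType d} {I : finType}.
Variables (P : probability T R) (X : I -> {RV P >-> int}).

(** The path event of the steps listed in l, by recursion on the first step like
    [kwalk]. *)
Fixpoint bridge_event (D : R -> bool) (l : seq I) (x v : R) (w : T) : Prop :=
  if l is i :: l' then
    let y := x + ((X i w)%:~R - rv_mean (X i)) in D y /\ bridge_event D l' y v w
  else x = v.

Variables (dl c : R) (a : int -> R).
Hypotheses (dl0 : 0 < dl) (lawX : forall i, law_class dl c a (distribution P (X i))).
Hypothesis indX : mutually_independent X.

Lemma prob_fine (A : set T) : measurable A -> P A = (fine (P A))%:E.
Proof. by move=> mA; rewrite fineK// fin_num_measure. Qed.

Lemma measurable_preX i (A : set int) : measurable (X i @^-1` A).
Proof. exact: measurable_funPTI. Qed.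

Lemma measurable_boxes (J : {set I}) (A : I -> set int) :
  measurable (\bigcap_(j in [set` J]) X j @^-1` A j).
Proof.
by apply: fin_bigcap_measurable => // i _; exact: measurable_preX.
Qed.

Lemma bridge_event_cons lo hi i l x v (pts : seq R) :
  (forall z, (z \in pts) = (lo <= z <= hi) && (z - (x - rv_mean (X i)) \is a Num.int)) ->
  bridge_event (seg lo hi) (i :: l) x v =
  \bigcup_(z in [set` pts]) (X i @^-1` [set Num.floor (z - (x - rv_mean (X i)))]
     `&` bridge_event (seg lo hi) l z v).
Proof.
move=> mp; apply/seteqP; split=> w /=.
  set y := x + (_%:~R - _) => -[Dy hy].
  have e : y - (x - rv_mean (X i)) = (X i w)%:~R by rewrite /y; move: (rv_mean (X i)) ((X i w)%:~R : R) => m r; ring.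
  exists y; first by rewrite /= mp (Dy : is_true (lo <= y <= hi)) e intr_int.
  by split=> //=; rewrite e intrKfloor.
move=> [z /= zp [Xw hz]]; move: zp; rewrite mp => /andP[Dz zi].
have -> : x + ((X i w)%:~R - rv_mean (X i)) = z.
  by rewrite Xw floorK//; move: (rv_mean (X i)) => m; ring.
by [].
Qed.

(** The steps in J are those already prescribed.  In the induction the first step
    of the path is fixed to an integer and moves to J; independence enters once
    the path is exhausted. *)
Lemma prob_bridge_event lo hi (l : seq I) (x v : R) (J : {set I}) (A : I -> set int) :
  uniq l -> (forall i, i \in l -> i \notin J) -> seg lo hi x ->
  measurable (bridge_event (seg lo hi) l x v) /\
  P (\bigcap_(j in [set` J]) X j @^-1` A j `&` bridge_event (seg lo hi) l x v) =
  ((\prod_(j in J) fine (P (X j @^-1` A j))) *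
    kwalk (seg lo hi) (map (fun i => rv_step (X i)) l) (ind v) x)%:E.
Proof.
elim: l x J A => [|i l ih] x J A.
  move=> _ _ _ /=; rewrite /ind; have [->|xv] := eqVneq x v.
    rewrite (_ : (fun w : T => v = v) = setT); last by apply/seteqP.
    split=> //; rewrite setIT mulr1 indX// -prodEFin; apply: eq_bigr => j _.
    by rewrite -prob_fine//; exact: measurable_preX.
  rewrite (_ : (fun w : T => x = v) = set0); last first.
    by apply/seteqP; split=> // w /= e; rewrite e eqxx in xv.
  by split=> //; rewrite setI0 measure0 mulr0.
rewrite cons_uniq => /andP[il ul] hJ Dx.
have iJ : i \notin J by apply: hJ; rewrite mem_head.
have [pts [up mp]] := lattice_points (x - rv_mean (X i)) lo hi.
set F := fun z => X i @^-1` [set Num.floor (z - (x - rv_mean (X i)))]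
     `&` bridge_event (seg lo hi) l z v.
rewrite (bridge_event_cons l v mp) -/F.
have ptsP z : z \in pts -> seg lo hi z by rewrite mp => /andP[].
have mF z : [set` pts] z -> measurable (F z).
  move=> /= /ptsP Dz; apply: measurableI; first exact: measurable_preX.
  by have [] := ih z finset.set0 (fun=> set0) ul (fun j _ => negbT (finset.in_set0 j)) Dz.
have mU : measurable (\bigcup_(z in [set` pts]) F z).
  exact: fin_bigcup_measurable.
split=> //.
rewrite setI_bigcupr measure_fin_bigcup; last 3 first.
- exact: finite_seq.
- move=> z y /= zp yp [w [[_ [e1 _]] [_ [e2 _]]]].
  move: zp yp; rewrite !mp => /andP[_ z1] /andP[_ z2].
  have : (X i w)%:~R = (X i w)%:~R :> R by [].
  by rewrite {1}e1 e2 !floorK// => /addIr.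
- by move=> z zp; apply: measurableI; [exact: measurable_boxes|exact: mF].
rewrite -(fsbig_seq _ _ up).
have sp := rv_is_step dl0 (lawX i).
have ss : each (is_step dl) (map (fun i => rv_step (X i)) l).
  by rewrite each_map; elim: (l) => //= j l' h; split=> //; exact: rv_is_step dl0 (lawX j).
have d0' := ltW dl0.
have -> : kwalk (seg lo hi) (map (fun i => rv_step (X i)) (i :: l)) (ind v) x
  = \sum_(z <- pts) kstep (seg lo hi) (rv_step (X i)) (ind z) x *
     kwalk (seg lo hi) (map (fun i => rv_step (X i)) l) (ind v) z.
  apply: (@kwalk_lattice _ dl (seg lo hi) [:: rv_step (X i)]) => //.
    by apply: adm_kwalk => //; exact: adm_ind.
  move=> z Dz; rewrite /drift_sum big_seq1 mp => hz.
  by rewrite (Dz : is_true (lo <= z <= hi)) opprB addrA addrAC.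
rewrite mulr_sumr -sumEFin big_seq [RHS]big_seq; apply: eq_bigr => z zp.
have Dz := ptsP z zp.
set k := Num.floor (z - (x - rv_mean (X i))).
pose A' j := if j == i then [set k] else A j.
have -> : \bigcap_(j in [set` J]) X j @^-1` A j `&` F z =
  \bigcap_(j in [set` (i |: J)]) X j @^-1` A' j `&` bridge_event (seg lo hi) l z v.
  rewrite /F setIA; congr (_ `&` _); apply/seteqP; split=> w /=.
    move=> [h1 h2] j /=; rewrite finset.in_setU1 /A'; case: eqVneq => [-> //|_] /=.
    exact: h1.
  move=> h; split; last by have := h i; rewrite /= finset.setU11 /A' eqxx; apply.
  move=> j /= jJ; have := h j; rewrite /= finset.setU1r// /A'.
  by case: eqVneq => [ji|_]; [rewrite ji in jJ; rewrite (negPf iJ) in jJ|apply].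
have [] := ih z (i |: J) A' ul _ Dz.
  move=> j jl; rewrite finset.in_setU1 negb_or hJ ?inE ?jl ?orbT// andbT.
  by apply: contraNneq il => <-.
move=> _ e; apply: (etrans e); rewrite big_setU1// /A' eqxx; congr EFin.
have -> : \prod_(j in J) fine (P (X j @^-1` (if j == i then [set k] else A j))) =
  \prod_(j in J) fine (P (X j @^-1` A j)).
  apply: eq_bigr => j jJ; case: eqVneq => // ji; by rewrite ji (negPf iJ) in jJ.
rewrite [RHS]mulrA; congr (_ * _); rewrite [LHS]mulrC; congr (_ * _).
rewrite rv_mass; congr (_.1 _); apply/funext => t.
have kz : k%:~R = z - (x - rv_mean (X i)).
  by rewrite floorK//; move: zp; rewrite mp => /andP[].
rewrite /ind [RHS](_ : _ = (x + t == z)%:R :> R); last first.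
  by case: ifP => // /negP h; case: eqVneq => // ez; rewrite ez in h.
congr ((nat_of_bool _)%:R); rewrite kz /=; apply/eqP/eqP; lra.
Qed.

End Link.

Section Centered.
Context {R : realType} {d : measure_display} {T : measurableType d} {n : nat}.
Variables (P : probability T R) (X : 'I_n -> {RV P >-> int}).

Lemma bridge_eventP D (l : seq 'I_n) (x v : R) w : bridge_event X D l x v w <->
  (forall k, (0 < k <= size l)%N -> D (x + \sum_(i <- take k l) centered X i w)) /\
  x + \sum_(i <- l) centered X i w = v.
Proof.
elim: l x => [|i l ih] x /=.
  rewrite big_nil addr0; split=> [->|[]//]; split=> // -[|k] //.
rewrite ih big_cons -/(centered X i w) [x + (_ + _)]addrA; split.
  move=> [Dy [h e]]; split=> // -[|[|k]] // hk.
    by rewrite /= take0 big_seq1.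
  by rewrite /= big_cons addrA; apply: h.
move=> [h e]; split; first by have := h 1%N isT; rewrite /= take0 big_seq1.
split=> // -[|k] // hk; have := h k.+2 hk.
by rewrite /= big_cons addrA.
Qed.

Lemma sum_take_enum (F : 'I_n -> R) k : (k <= n)%N ->
  \sum_(i <- take k (enum 'I_n)) F i = \sum_(i < n | (i < k)%N) F i.
Proof.
move=> kn; rewrite -[RHS]big_filter; congr (\sum_(i <- _) _).
apply: (inj_map val_inj); rewrite map_take val_enum_ord take_iota (minn_idPl kn).
rewrite -[index_enum _]enumT; have := filter_map val (fun i => i < k)%N (enum 'I_n).
rewrite val_enum_ord => <-; have := @filter_iota_ltn 0 n k kn.
by rewrite add0n => ->.
Qed.

(** The minimum and the maximum range over S_1, ..., S_n, as [bridge_event]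
    does. *)
Lemma walk_event u lam v : (0 < n)%N ->
  [set w | [/\ 0 <= walk_min X u w, walk_max X u w <= lam & centered_walk X u n w = v]] =
  bridge_event X (seg 0 lam) (enum 'I_n) u v.
Proof.
move=> n0; have sE k w : (k <= n)%N ->
    u + \sum_(i <- take k (enum 'I_n)) centered X i w = centered_walk X u k w.
  by move=> kn; rewrite sum_take_enum.
have sz : size (enum 'I_n) = n by rewrite size_enum_ord.
have full w : u + \sum_(i <- enum 'I_n) centered X i w = centered_walk X u n w.
  by rewrite -sE// take_oversize// sz.
apply/seteqP; split=> w.
  move=> [hmin hmax e]; apply/bridge_eventP; rewrite full sz; split=> // k /andP[k0 kn].
  have kin : k \in index_iota 1 n.+1 by rewrite mem_index_iota k0 ltnS.
  rewrite sE//; apply/andP; split.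
    by apply: le_trans hmin _; exact: ge_bigmin_seq.
  by apply: le_trans hmax; exact: (Order.TotalTheory.le_bigmax_seq (r := index_iota 1 n.+1) _ k xpredT (fun k => centered_walk X u k w)).
move=> /bridge_eventP; rewrite full sz => -[h e].
have hk k : (1 <= k < n.+1)%N -> 0 <= centered_walk X u k w <= lam.
  by rewrite ltnS => kn; have := h k kn; rewrite sE//; case/andP: kn.
have /andP[h1 h1'] := hk 1%N n0.
split=> //; rewrite /walk_min /walk_max big_nat_cond.
  by apply: le_bigmin => // k; rewrite andbT => /hk/andP[].
by apply: bigmax_le => // k; rewrite andbT => /hk/andP[].
Qed.

End Centered.

(** * The theorem *)

Lemma each_in (T : eqType) (T' : Type) (Q : T' -> Prop) (f : T -> T') s :
  (forall i, Q (f i)) -> each Q (map f s).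
Proof. by move=> h; elim: s => //= i s ih; split. Qed.

Lemma powR_three_halves (R : realType) (n : nat) :
  n%:R `^ (3 / 2) = Num.sqrt n%:R ^+ 3 :> R.
Proof. by rewrite mulrC powRrM powR12_sqrt// powR_mulrn ?sqrtr_ge0. Qed.

(** The bound on the exponent is used through 3 alpha <= 2. *)
Lemma cube_le_sqr (R : realType) (n : nat) (x alpha : R) : (0 < n)%N ->
  alpha < 2 / 3 -> `|x| <= n%:R `^ alpha -> `|x| ^+ 3 <= n%:R ^+ 2.
Proof.
move=> n0 al h; have n1 : 1 <= n%:R :> R by rewrite ler1n.
apply: (@le_trans _ _ ((n%:R `^ alpha) ^+ 3)).
  by rewrite lerXn2r ?nnegrE ?powR_ge0.
rewrite -powR_mulrn ?powR_ge0// -powRrM -powR_mulrn//; apply: ler_powR => //.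
by lra.
Qed.

Lemma bridge_boundE (R : realType) (C c lam u v : R) n : bridge_bound C c n lam u v =
  C * (Num.min u (Num.min (lam - u) (Num.sqrt n%:R)) + 1)
    * (Num.min v (Num.min (lam - v) (Num.sqrt n%:R)) + 1)
    / Num.sqrt n%:R ^+ 3 * expR (- (c * (u - v) ^+ 2 / n%:R)).
Proof. by rewrite /bridge_bound powR_three_halves. Qed.

Theorem theorem7p3 (R : realType) (c0 delta0 : R) (a : int -> R) (alpha : R) :
  0 < c0 -> 0 < delta0 ->
  (forall i : int, 0 <= a i <= 1) -> irreducible_aperiodic_seq a ->
  0 < alpha < 2 / 3 ->
  exists Cm Cp cm cp : R, [/\ 0 < Cm, 0 < Cp, 0 < cm & 0 < cp] /\
  exists n0 : nat, forall n : nat, (n0 <= n)%N ->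
  forall (d : measure_display) (T : measurableType d) (P : probability T R)
    (X : 'I_n -> {RV P >-> int}),
  mutually_independent X ->
  (forall i : 'I_n, law_class delta0 c0 a (distribution P (X i))) ->
  forall lambda u v : R,
  Num.sqrt n%:R <= lambda -> 0 <= u <= lambda -> 0 <= v <= lambda ->
  (0 < P [set w | centered_walk X u n w = v])%E ->
  `|u - v| <= n%:R `^ alpha ->
  let p := P [set w | [/\ 0 <= walk_min X u w, walk_max X u w <= lambda &
                          centered_walk X u n w = v]] in
  ((bridge_bound Cm cm n lambda u v)%:E <= p)%E /\
  (p <= (bridge_bound Cp cp n lambda u v)%:E)%E.
Proof.
move=> c0_gt0 d0 _ /support_of_seq[xs [ys [sxy Sx Sy a0]]] /andP[_ al].
have [C [k [H [kap [C0 k0 H0 kap0 reg]]]]] := rv_regular c0_gt0 d0 sxy Sx Sy a0.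
have [Cm [cm [nm [Cm0 cm0 lower]]]] := bridge_lower d0 C0 k0 H0 kap0 sxy Sx Sy.
have [Cp [cp [np [Cp0 cp0 upper]]]] := bridge_upper d0 C0 k0 H0 kap0 sxy Sx Sy.
exists Cm, Cp, cm, cp; split=> //; exists (maxn 1 (maxn nm np)) => n.
rewrite !geq_max => /and3P[n1 nnm nnp] d T P X indX lawX lam u v slam hu hv Pv uv.
cbv zeta; rewrite (walk_event X u lam v n1).
set s := map (fun i => rv_step (X i)) (enum 'I_n).
have ss : size s = n by rewrite size_map size_enum_ord.
have hs : each (regular delta0 C k H kap xs ys) s by apply: each_in => i; exact: reg.
have -> : P (bridge_event X (seg 0 lam) (enum 'I_n) u v) = (kwalk (seg 0 lam) s (ind v) u)%:E.
  have [_] := prob_bridge_event d0 lawX indX v (J := finset.set0) (fun=> set0)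
    (enum_uniq 'I_n) (fun i _ => negbT (finset.in_set0 i)) hu.
  rewrite big_set0 mul1r => <-; congr (P _); apply/seteqP; split=> w /=; last by case.
  by move=> h; split=> // i /=; rewrite finset.in_set0.
rewrite !lee_fin !bridge_boundE.
have cube := cube_le_sqr n1 al uv.
have latt : v - u + drift_sum s \is a Num.int.
  have [w <-] : exists w, centered_walk X u n w = v.
    apply: contrapT => no; move: Pv; rewrite (_ : [set w | _] = set0) ?measure0 ?ltxx//.
    by apply/seteqP; split=> // w e; apply: no; exists w.
  rewrite /centered_walk [u + _]addrC addrK /drift_sum big_map big_enum /=.
  rewrite (eq_bigl xpredT); last by move=> i; rewrite ltn_ord.
  rewrite -big_split /=; apply: rpred_sum => i _.
  by rewrite /centered subrK intr_int.
move: (lower s u v lam) (upper s u v lam); rewrite ss => lo up.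
by split; [exact: lo|exact: up].
Qed.
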